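(* Let $0\le k\le n$ be integers. The posets $(\mathcal{Q}(k,n),\le)$, $(\mathrm{Bound}(k,n),\le)$ and $(\mathrm{Jugg}(k,n),\le)$, and their duals, are Eulerian and $EL$-shellable.
   Context: **Poset notions.** A graded poset $P$ is Eulerian if for all $x\le y$ in $P$ with $[x,y]$ finite, the Möbius function satisfies $\mu(x,y)=(-1)^{\mathrm{rank}(x)-\mathrm{rank}(y)}$. A labeling of the edges of the Hasse diagram of $P$ by a totally ordered set $\Lambda$ is an $EL$-labeling if for any $x\le y$: (1) there is a unique strictly label-increasing saturated chain $C$ from $x$ to $y$, and (2) the label sequence of $C$ is $\Lambda$-lexicographically minimal among those of saturated chains from $x$ to $y$. $P$ is $EL$-shellable if it has an $EL$-labeling. **$\mathcal{Q}(k,n)$.** In $S_n$ (with $(uw)(i)=u(w(i))$, $\ell$ = number of inversions, $\le$ Bruhat order, $[u,w]$ Bruhat interval), say $u$ $k$-covers $w$ if $u\gtrdot w$ and $u([k])\neq w([k])$, where $[k]=\{1,\dots,k\}$; $\le_k$ is the generated partial order, and $[u,w]_k$ an interval in it. $\mathcal{Q}(k,n)$ is the set of equivalence classes of $k$-Bruhat intervals $[u,w]_k$ under the relation generated by $[u,w]_k\sim[uz,wz]_k$ whenever $z\in S_k\times S_{n-k}$ and both products are length-additive. Order: $q\le q'$ iff there are representatives $[u,w]_k\in q$, $[u',w']_k\in q'$ with $[u',w']\subseteq[u,w]$. **$\mathrm{Bound}(k,n)$.** $\tilde{S}_n$ is the group of bijections $f:\mathbb{Z}\to\mathbb{Z}$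 with $f(i+n)=f(i)+n$; $\tilde{S}_n^k$ is the subset with $\frac1n\sum_{i=1}^n(f(i)-i)=k$. $\tilde{S}_n^0$ is the affine symmetric group (Coxeter generators $s_0,\dots,s_{n-1}$, $s_i$ swapping $i+rn$ and $i+1+rn$ for all $r$), and its Bruhat order is transported to $\tilde{S}_n^k$ via $f\mapsto f\circ(i\mapsto i+k)$. $\mathrm{Bound}(k,n)=\{f\in\tilde{S}_n^k:i\le f(i)\le i+n\ \forall i\}$ with the induced order. **$\mathrm{Jugg}(k,n)$.** The set of $(J_1,\dots,J_n)\in\binom{[n]}{k}^n$ (tuples of $k$-subsets of $[n]$) with $J_{i+1}\supseteq\{x-1:x\in J_i\setminus\{1\}\}$ for all $i$ (indices mod $n$). Order: $(J_i)\le(J_i')$ iff $J_i\le J_i'$ for each $i$, where $\{a_1<\dots<a_k\}\le\{b_1<\dots<b_k\}$ iff $a_r\le b_r$ for all $r$. *)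

(* Defs.v *)
From Stdlib Require Import Relation_Operators.
From HB Require Import structures.
From mathcomp Require Import all_boot all_order all_algebra all_fingroup.
From mathcomp Require Import boolp classical_sets cardinality fsbigop.

Set Implicit Arguments.
Unset Strict Implicit.
Unset Printing Implicit Defensive.

Import Order.TTheory GRing.Theory Num.Theory.

(* Posets are given by a carrier and a relation, so that the partial order     *)
(* axioms are part of what is asserted (see [eulerian]).                       *)

Section Posets.
Local Open Scope ring_scope.
Local Open Scope classical_set_scope.

Variables (T : choiceType) (le : rel T).

Definition dual_rel : rel T := fun x y => le y x.

Definition is_poset : Prop :=
  [/\ reflexive le, antisymmetric le & transitive le].

Definition covered_by : rel T := fun x y =>
  [&& le x y, x != y
    & `[< forall z : T, le x z -> le z y -> z = x \/ z = y >]].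

Definition poset_interval (x y : T) : set T := [set z | le x z /\ le z y].

Definition rank_function (rho : T -> int) : Prop :=
  (forall x y, le x y -> x != y -> rho x < rho y) /\
  (forall x y, covered_by x y -> rho y = rho x + 1).

(* The values of [mu] on finite intervals are uniquely determined by this;     *)
(* its other values are irrelevant.                                            *)
Definition mobius_function (mu : T -> T -> int) : Prop :=
  (forall x, mu x x = 1) /\
  (forall x y, le x y -> x != y -> finite_set (poset_interval x y) ->
     \sum_(z \in poset_interval x y) mu x z = 0).

Definition eulerian : Prop :=
  is_poset /\
  exists rho mu, [/\ rank_function rho, mobius_function mu
    & forall x y, le x y -> finite_set (poset_interval x y) ->
        mu x y = (-1) ^ (rho x - rho y)].

(* The saturated chain x = x_0 <. x_1 <. ... <. x_m = y is encoded by x and    *)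
(* the sequence c = [:: x_1; ...; x_m].                                        *)
Definition saturated_chain (x y : T) (c : seq T) : bool :=
  path covered_by x c && (last x c == y).

Section Labeling.
Variables (d : Order.disp_t) (L : orderType d) (lab : T -> T -> L).

Definition chain_labels (x : T) (c : seq T) : seqlexi L := pairmap lab x c.

Definition increasing_chain (x y : T) (c : seq T) : bool :=
  saturated_chain x y c && sorted <%O (chain_labels x c : seq L).

(* Only the values of [lab] on covering pairs matter. *)
Definition EL_labeling : Prop :=
  forall x y, le x y ->
    exists c : seq T,
      [/\ increasing_chain x y c,
          forall c', increasing_chain x y c' -> c' = c
        & forall c', saturated_chain x y c' ->
            (chain_labels x c <= chain_labels x c')%O].

End Labeling.

Definition EL_shellable : Prop :=
  exists (d : Order.disp_t) (L : orderType d) (lab : T -> T -> L),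
    EL_labeling lab.

End Posets.

Section SymmetricGroup.
Local Open Scope group_scope.

Variables (k n : nat).

(* The product (u w)(i) = u (w i); MathComp's product of permutations composes *)
(* in the opposite order.                                                      *)
Definition pcomp (u w : 'S_n) : 'S_n := w * u.

Definition inversions (u : 'S_n) : nat :=
  #|[set p : 'I_n * 'I_n | (p.1 < p.2)%N && (u p.2 < u p.1)%N]|.

Definition bruhat_step : rel 'S_n := fun u w =>
  [exists i : 'I_n, exists j : 'I_n,
     [&& i != j, w == pcomp u (tperm i j) & (inversions u < inversions w)%N]].

Definition bruhat : rel 'S_n := connect bruhat_step.

Definition bruhat_interval (u w : 'S_n) : {set 'S_n} :=
  [set v | bruhat u v && bruhat v w].

(* [k] = {1,...,k}, with {1,...,n} represented by 'I_n = {0,...,n-1}. *)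
Definition initial_segment : {set 'I_n} := [set i : 'I_n | (i < k)%N].

Definition k_covered_by : rel 'S_n := fun w u =>
  covered_by bruhat w u && (u @: initial_segment != w @: initial_segment).

Definition k_bruhat : rel 'S_n := connect k_covered_by.

(* S_k x S_{n-k} *)
Definition young_subgroup : {set 'S_n} :=
  [set z : 'S_n | z @: initial_segment == initial_segment].

(* The k-Bruhat interval [u, w]_k, encoded by its endpoints. *)
Definition k_interval : finType := {p : 'S_n * 'S_n | k_bruhat p.1 p.2}.

Definition length_additive (u z : 'S_n) : bool :=
  inversions (pcomp u z) == (inversions u + inversions z)%N.

Definition k_interval_step : rel k_interval := fun p q =>
  [exists z in young_subgroup,
    [&& length_additive (val p).1 z, length_additive (val p).2 z
      & val q == (pcomp (val p).1 z, pcomp (val p).2 z)]].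

Definition k_interval_equiv : rel k_interval :=
  connect (fun p q => k_interval_step p q || k_interval_step q p).

Definition Q : finType :=
  {A : {set k_interval} |
    A \in equivalence_partition k_interval_equiv [set: k_interval]}.

Definition Q_le : rel Q := fun q q' =>
  [exists p in val q, exists p' in val q',
     bruhat_interval (val p').1 (val p').2
       \subset bruhat_interval (val p).1 (val p).2].

End SymmetricGroup.

Section Affine.
Local Open Scope ring_scope.
Local Open Scope classical_set_scope.

Variables (k n : nat).

Definition affine_perm : set (int -> int) :=
  [set f | bijective f /\ forall i, f (i + n%:Z) = f i + n%:Z].

(* The average condition with denominator cleared. *)
Definition affine_perm_avg (a : int) : set (int -> int) :=
  [set f | affine_perm f /\
     \sum_(1 <= i < n.+1) (f i%:Z - i%:Z) = a * n%:Z].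

Definition affine_swap (i : int) : int -> int := fun x =>
  if (x == i %[mod n%:Z])%Z then x + 1
  else if (x == i + 1 %[mod n%:Z])%Z then x - 1
  else x.

(* s_0, ..., s_{n-1}; for n <= 1 the affine symmetric group is trivial (or, for *)
(* n = 0, degenerate) and there are no generators.                             *)
Definition simple_reflection : set (int -> int) :=
  [set s | (1 < n)%N /\ exists i : 'I_n, s = affine_swap (i : nat)%:Z].

Inductive affine_word : nat -> (int -> int) -> Prop :=
| affine_word0 : affine_word 0 id
| affine_wordS m s f : simple_reflection s -> affine_word m f ->
    affine_word m.+1 (s \o f).

(* The Coxeter length. The default value 0 of [xget] is only attained outside  *)
(* the group generated by the simple reflections.                              *)
Definition affine_length (f : int -> int) : nat :=
  xget 0%N [set m | affine_word m f /\
                    forall m', affine_word m' f -> (m <= m')%N].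

Definition affine_reflection : set (int -> int) :=
  [set t | exists g h s, [/\ affine_perm_avg 0 g, cancel g h, cancel h g,
                             simple_reflection s & t = g \o s \o h]].

Definition affine_bruhat_step (f g : int -> int) : Prop :=
  exists t, [/\ affine_reflection t, g = f \o t
              & (affine_length f < affine_length g)%N].

Definition affine_bruhat : (int -> int) -> (int -> int) -> Prop :=
  clos_refl_trans (int -> int) affine_bruhat_step.

(* Bruhat order on the permutations of average k, carried over from those of    *)
(* average 0 along f |-> f o (i |-> i + k).                                     *)
Definition affine_bruhat_shifted (f g : int -> int) : Prop :=
  affine_bruhat (f \o (fun i => i - k%:Z)) (g \o (fun i => i - k%:Z)).

Definition bounded_perm : set (int -> int) :=
  [set f | affine_perm_avg k%:Z f /\ forall i, i <= f i <= i + n%:Z].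

Definition Bound : choiceType := {f : int -> int | `[< bounded_perm f >]}.

Definition Bound_le : rel Bound := fun f g =>
  `[< affine_bruhat_shifted (val f) (val g) >].

End Affine.

Section Jugg.

Variables (k n : nat).

(* {x - 1 : x in A \ {1}}, again with {1,...,n} represented by 'I_n. *)
Definition shift_down (A : {set 'I_n}) : {set 'I_n} :=
  [set y : 'I_n | [exists x in A, val x == (val y).+1]].

Definition is_juggling (J : {ffun 'I_n -> {set 'I_n}}) : bool :=
  [forall i, #|J i| == k] && [forall i, shift_down (J i) \subset J (ordS i)].

Definition Jugg : finType := {J : {ffun 'I_n -> {set 'I_n}} | is_juggling J}.

(* [enum] lists a set of ordinals in increasing order. *)
Definition subset_le : rel {set 'I_n} := fun A B =>
  all2 (fun a b : 'I_n => (a <= b)%N) (enum A) (enum B).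

Definition Jugg_le : rel Jugg := fun J J' =>
  [forall i, subset_le (val J i) (val J' i)].

End Jugg.

(* Main.v *)
Require Import Defs.
From Stdlib Require Import Relation_Operators Operators_Properties.
From HB Require Import structures.
From mathcomp Require Import all_boot all_order all_algebra all_fingroup.
From mathcomp Require Import boolp classical_sets functions cardinality fsbigop.
From mathcomp Require Import zify.

(** The three posets are isomorphic, so that shellability has to be proved for
    bounded permutations only, and the Eulerian property only for the finite
    poset of juggling sequences.

    The order on bounded permutations.  By the strong exchange property
    ([word_exchange]) the affine Bruhat order is generated by the exchanges of
    two positions p < q that raise the value at p ([Bound_leP]).  By
    [upath_rkleE] it is also the order of the counts of all m <= a with
    b <= f m, for a < b.

    Juggling sequences.  At time i, record when the balls thrown before i will
    land.  The counts just mentioned are the numbers of balls that land no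
    earlier than a given time, and the comparison of two k-subsets is a
    comparison of such numbers ([subset_leP]); hence [state_map_le].  The inverse
    map throws the ball caught at time i to the only new landing time
    ([unjuggle]).

    Classes of intervals.  An interval [u, w]_k is sent to the bounded permutation
    f = u t w^-1, where t adds n on the first k positions ([fpair]).  The k-Bruhat
    order has a description by inequalities due to Bergeron and Sottile
    ([k_bruhatP]), which allows one to sort the positions of u and w
    simultaneously inside the two blocks; every class therefore contains
    exactly one pair with w Grassmannian, and f determines this pair
    ([grass_unique]).  The difference of the numbers of inversions of u and w is a
    rank function.  Inclusion of intervals does not depend on the
    representatives, by lifting ([contains_indep]); it implies the rank order
    because for a Grassmannian w the counts above are counts over initial
    segments of positions ([contains_rkle]), and conversely each cover of f
    changes only one end of a suitable pair ([cover_pair]).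

    Shellability.  A cover of f exchanges two positions p < q < p + n with
    0 <= p < n; this pair is its label.  In the chosen order of the labels, a
    reflection order, two successive covers whose labels do not increase can be
    replaced by two others with a smaller first and a larger second label
    ([diamond]).  So the chain that starts with the smallest label, and continues
    in this way, is increasing and lexicographically least.  The increasing chain
    is unique because it first permutes the window {0, ..., n - 1} and then only
    exchanges across its end, and each of the two parts is forced
    ([increasing_unique]).  All this is symmetric under reversing the poset and the
    order of the labels ([EL_both]), which gives the dual statement.

    The Eulerian property.  If y has a descent at i, then multiplication by the
    exchange s of i and i + 1 is an involution without fixed points on the
    elements below y, which changes the parity of the rank and has the lifting
    property ([lifting_path]).  Verma's argument shows that the signed sum over
    every nontrivial interval vanishes ([isum_eq0]). *)

Set Implicit Arguments.
Unset Strict Implicit.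
Unset Printing Implicit Defensive.

Import Order.TTheory GRing.Theory Num.Theory.

(** * Periodic maps and exchanges of positions *)

Section Swaps.
Local Open Scope ring_scope.

Variable n : nat.

Definition cong (x y : int) : bool := (n%:Z %| x - y)%Z.

Lemma congP x y : reflect (exists j : int, x = y + j * n%:Z) (cong x y).
Proof.
apply: (iffP idP) => [/dvdzP[j hj]|[j ->]]; first by exists j; lia.
by rewrite /cong; apply/dvdzP; exists j; lia.
Qed.

Lemma cong_refl x : cong x x.
Proof. by apply/congP; exists 0; lia. Qed.

Lemma cong_sym x y : cong x y = cong y x.
Proof. by apply/congP/congP => -[j ->]; exists (- j); lia. Qed.

Lemma cong_trans y x z : cong x y -> cong y z -> cong x z.
Proof. by move=> /congP[i ->] /congP[j ->]; apply/congP; exists (i + j); lia. Qed.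

Lemma cong_congl x y z : cong x y -> cong x z = cong y z.
Proof.
by move=> h; apply/idP/idP; apply: cong_trans => //; rewrite cong_sym.
Qed.

Lemma congDr x y z : cong (x + z) (y + z) = cong x y.
Proof. by rewrite /cong; congr dvdz; lia. Qed.

Lemma cong_addM x j : cong (x + j * n%:Z) x.
Proof. by apply/congP; exists j. Qed.

Lemma cong_add x : cong (x + n%:Z) x.
Proof. by apply/congP; exists 1; lia. Qed.

Lemma cong_near x y : cong x y -> x < y + n%:Z -> y < x + n%:Z -> x = y.
Proof.
move=> /congP[j ->] h1 h2.
have : (j < 1) && (-1 < j) by apply/andP; split; nia.
move=> ?; have -> : j = 0 by lia.
by lia.
Qed.

Lemma not_cong_near x y : x < y -> y < x + n%:Z -> ~~ cong x y.
Proof. by move=> h1 h2; apply/negP => /cong_near; lia. Qed.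

(** The affine reflection that exchanges p + j n and q + j n for all j. *)
Definition swp (p q x : int) : int :=
  if cong x p then x + (q - p) else if cong x q then x - (q - p) else x.

Definition periodic (f : int -> int) := forall i, f (i + n%:Z) = f i + n%:Z.

Lemma periodicM f : periodic f -> forall i j, f (i + j * n%:Z) = f i + j * n%:Z.
Proof.
move=> hf i j.
have H : forall m : nat, forall x, f (x + m%:Z * n%:Z) = f x + m%:Z * n%:Z.
  elim=> [|m IH] x; first by rewrite !mul0r !addr0.
  have -> : x + m.+1%:Z * n%:Z = (x + m%:Z * n%:Z) + n%:Z by lia.
  by rewrite hf IH; lia.
case: j => m; first exact: H.
have := H m.+1 (i + Negz m * n%:Z).
have -> : i + Negz m * n%:Z + m.+1%:Z * n%:Z = i by lia.
by lia.
Qed.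

Lemma periodic_cong f x y : periodic f -> cong x y -> cong (f x) (f y).
Proof.
by move=> hf /congP[j ->]; rewrite periodicM //; apply: cong_addM.
Qed.

Lemma cong_inj f x y : periodic f -> injective f ->
  cong (f x) (f y) = cong x y.
Proof.
move=> hf inf; apply/idP/idP; last exact: periodic_cong.
by move=> /congP[j]; rewrite -periodicM // => /inf ->; apply: cong_addM.
Qed.

Lemma swp_periodic p q : periodic (swp p q).
Proof.
move=> i; rewrite /swp (cong_congl p (cong_add i)) (cong_congl q (cong_add i)).
by case: ifP => _; [|case: ifP => _]; lia.
Qed.

Lemma swp_id p q x : ~~ cong x p -> ~~ cong x q -> swp p q x = x.
Proof. by rewrite /swp => /negbTE-> /negbTE->. Qed.

Lemma swpL p q : swp p q p = q.
Proof. by rewrite /swp cong_refl; lia. Qed.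

Lemma swpR p q : ~~ cong p q -> swp p q q = p.
Proof. by rewrite /swp cong_sym => /negbTE->; rewrite cong_refl; lia. Qed.

Lemma swpLc p q x : cong x p -> swp p q x = x + (q - p).
Proof. by rewrite /swp => ->. Qed.

Lemma swpRc p q x : ~~ cong p q -> cong x q -> swp p q x = x - (q - p).
Proof.
move=> h hx; rewrite /swp ifF ?hx //; apply/negbTE; apply: contra h => h.
by rewrite cong_sym in h; apply: cong_trans h hx.
Qed.

Lemma swpC p q : ~~ cong p q -> swp p q = swp q p.
Proof.
move=> h; apply/funext => x; rewrite /swp.
case: ifPn => h1; case: ifPn => h2; try lia.
by case/negP: h; rewrite cong_sym; apply: (cong_trans _ h1); rewrite cong_sym.
Qed.

Lemma swpK p q : ~~ cong p q -> involutive (swp p q).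
Proof.
move=> h x; case: (boolP (cong x p)) => h1.
  rewrite (swpLc _ h1) swpRc //; first lia.
  by move: h1; rewrite /cong; congr (is_true (dvdz _ _)); lia.
case: (boolP (cong x q)) => h2; last by rewrite !swp_id.
rewrite (swpRc _ h2) // swpLc; first lia.
by move: h2; rewrite /cong; congr (is_true (dvdz _ _)); lia.
Qed.

Lemma swpKf p q (f : int -> int) : ~~ cong p q -> (f \o swp p q) \o swp p q = f.
Proof. by move=> h; apply/funext => x /=; rewrite swpK. Qed.

Lemma swp_inj p q : ~~ cong p q -> injective (swp p q).
Proof. by move=> h; apply: inv_inj; apply: swpK. Qed.

Lemma swp_conj g a b x : periodic g -> injective g ->
  g (swp a b x) = swp (g a) (g b) (g x).
Proof.
move=> hg ig; rewrite /swp !cong_inj //.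
case: ifP => [/congP[j ->]|_].
  have -> : a + j * n%:Z + (b - a) = b + j * n%:Z by lia.
  by rewrite !periodicM //; lia.
case: ifP => [/congP[j ->]|_] //.
have -> : b + j * n%:Z - (b - a) = a + j * n%:Z by lia.
by rewrite !periodicM //; lia.
Qed.

Lemma swp_shift p q j : swp (p + j * n%:Z) (q + j * n%:Z) = swp p q.
Proof.
apply/funext => x; rewrite /swp.
have H y : cong x (y + j * n%:Z) = cong x y.
  by rewrite cong_sym (cong_congl _ (cong_addM _ _)) cong_sym.
by rewrite !H; case: ifP => _; [|case: ifP => _]; lia.
Qed.

Lemma affine_swapE i : affine_swap n i = swp i (i + 1).
Proof.
apply/funext => x; rewrite /affine_swap /swp !eqz_mod_dvd /cong.
by case: ifP => _; [|case: ifP => _]; lia.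
Qed.

Lemma swp_comm_r p q p' q' : ~~ cong p' q' ->
  swp p q \o swp p' q' = swp p' q' \o swp (swp p' q' p) (swp p' q' q).
Proof.
move=> h; apply/funext => x /=.
rewrite [RHS]swp_conj; [by rewrite !swpK|exact: swp_periodic|exact: swp_inj].
Qed.

Lemma swp_comm_l p q p' q' : ~~ cong p q ->
  swp p q \o swp p' q' = swp (swp p q p') (swp p q q') \o swp p q.
Proof.
move=> h; apply/funext => x /=.
by rewrite swp_conj //; [exact: swp_periodic|exact: swp_inj].
Qed.

Lemma sum_two (H H0 : int -> int) (m : nat) (a b : nat) :
  (a < m)%N -> (b < m)%N -> a != b ->
  (forall d : nat, (d < m)%N -> d != a -> d != b -> H d%:Z = H0 d%:Z) ->
  \sum_(0 <= d < m) H d%:Z =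
  \sum_(0 <= d < m) H0 d%:Z + (H a%:Z - H0 a%:Z) + (H b%:Z - H0 b%:Z).
Proof.
move=> ha hb hab heq; rewrite !big_mkord.
rewrite (bigD1 (Ordinal ha)) //= (bigD1 (Ordinal hb)) /=; last first.
  by rewrite -val_eqE /= eq_sym.
rewrite [in RHS](bigD1 (Ordinal ha)) //= [in RHS](bigD1 (Ordinal hb)) /=; last first.
  by rewrite -val_eqE /= eq_sym.
set S := \sum_(i < m | _) H _; set S0 := \sum_(i < m | _) H0 _.
have -> : S = S0.
  apply: eq_bigr => i /andP[h1 h2]; apply: heq; first exact: ltn_ord.
    by move: h1; rewrite -val_eqE.
  by move: h2; rewrite -val_eqE.
by lia.
Qed.

Hypothesis n_gt0 : (0 < n)%N.

Lemma win_rep (c p : int) : exists d : nat, (d < n)%N /\ cong (c + d%:Z) p.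
Proof.
exists `|modz (p - c) n%:Z|%N.
have h0 : n%:Z != 0 by lia.
have h1 := modz_ge0 (p - c) h0.
have h2 := ltz_mod (p - c) h0.
split; first by lia.
rewrite /cong -eqz_mod_dvd; apply/eqP.
rewrite gez0_abs // -modzDmr modz_mod modzDmr; congr modz; lia.
Qed.

End Swaps.

(** * Length in the affine symmetric group *)

Section AffineLength.
Local Open Scope ring_scope.

Variable n : nat.
Hypothesis n_gt0 : (0 < n)%N.

Lemma sum_window (G : int -> int) :
  \sum_(1 <= i < n.+1) G i%:Z = \sum_(0 <= d < n) G (1 + d%:Z).
Proof. by rewrite big_add1 /=; apply: eq_bigr => i _; congr G; lia. Qed.

Lemma sum_shift (G : int -> int) (c c' : int) :
  (forall i, G (i + n%:Z) = G i) ->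
  \sum_(0 <= d < n) G (c + d%:Z) = \sum_(0 <= d < n) G (c' + d%:Z).
Proof.
move=> hG.
have step x : \sum_(0 <= d < n) G (x + d%:Z) = \sum_(0 <= d < n) G (x + 1 + d%:Z).
  case: n hG => [|m] hm; first by rewrite !big_nil.
  rewrite big_nat_recl // big_nat_recr //= [LHS]addrC; congr (_ + _).
    by apply: eq_bigr => i _; congr G; lia.
  by rewrite -hm; congr G; lia.
have H : forall m : nat, forall x, 
    \sum_(0 <= d < n) G (x + d%:Z) = \sum_(0 <= d < n) G (x + m%:Z + d%:Z).
  elim=> [|m IH] x; first by apply: eq_bigr => i _; congr G; lia.
  by rewrite step IH; apply: eq_bigr => i _; congr G; lia.
have [h|h] := leP c c'.
  rewrite (H `|c' - c|%N); apply: eq_bigr => i _; congr G; lia.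
by rewrite [RHS](H `|c' - c|%N); apply: eq_bigr => i _; congr G; lia.
Qed.

(** Summands that are invariant under simultaneous translation may be moved to
    other windows, so exchanging p and q only changes the summands at p and q,
    also when no window of the sum contains both. *)
Lemma win_swap (F : int -> int -> int) (f : int -> int) (c p q : int) :
  (forall i v, F (i + n%:Z) (v + n%:Z) = F i v) -> periodic n f ->
  ~~ cong n p q ->
  \sum_(0 <= d < n) F (c + d%:Z) (f (swp n p q (c + d%:Z))) =
  \sum_(0 <= d < n) F (c + d%:Z) (f (c + d%:Z)) +
   (F p (f q) - F p (f p)) + (F q (f p) - F q (f q)).
Proof.
move=> hF hf hpq.
have FM i v j : F (i + j * n%:Z) (v + j * n%:Z) = F i v.
  pose G j := F (i + j * n%:Z) (v + j * n%:Z).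
  have hG x : G (x + 1) = G x.
    by rewrite /G -[RHS]hF; congr F; lia.
  have H : forall m : nat, forall x, G (x + m%:Z) = G x.
    elim=> [|m IH] x; first by congr G; lia.
    by rewrite -(IH x) -[RHS]hG; congr G; lia.
  have -> : F i v = G 0 by rewrite /G; congr F; lia.
  rewrite -/(G j); have [h|h] := leP 0 j.
    by rewrite -(H `|j|%N 0); congr G; lia.
  by rewrite -(H `|j|%N j); congr G; lia.
have [a [ha hap]] := win_rep n_gt0 c p.
have [b [hb hbq]] := win_rep n_gt0 c q.
have hab : a != b.
  apply: contra hpq => /eqP e; subst b.
  by rewrite cong_sym in hap; apply: cong_trans hap hbq.
rewrite (sum_two (H0 := fun x => F (c + x) (f (c + x)))
  (H := fun x => F (c + x) (f (swp n p q (c + x)))) ha hb hab); last first.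
  move=> d hd hda hdb; rewrite swp_id //.
    apply: contra hda => h; apply/eqP.
    have := cong_trans h (etrans (cong_sym _ _ _) hap).
    by move=> /cong_near; lia.
  apply: contra hdb => h; apply/eqP.
  have := cong_trans h (etrans (cong_sym _ _ _) hbq).
  by move=> /cong_near; lia.
rewrite swpLc // swpRc //.
move: hap hbq => /congP[i ->] /congP[j ->].
have -> : p + i * n%:Z + (q - p) = q + i * n%:Z by lia.
have -> : q + j * n%:Z - (q - p) = p + j * n%:Z by lia.
rewrite !(periodicM hf).
by rewrite !FM.
Qed.

Lemma swp_bij p q : ~~ cong n p q -> bijective (swp n p q).
Proof. by move=> h; apply: inv_bij; apply: swpK. Qed.

Lemma comp_swp_affine f p q : affine_perm n f -> ~~ cong n p q ->
  affine_perm n (f \o swp n p q).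
Proof.
move=> [bf pf] h; split; first by apply: bij_comp => //; exact: swp_bij.
by move=> i /=; rewrite swp_periodic pf.
Qed.

Lemma avg_swp a f p q : affine_perm_avg n a f -> ~~ cong n p q ->
  affine_perm_avg n a (f \o swp n p q).
Proof.
move=> [af hs] h; split; first exact: comp_swp_affine.
rewrite -hs (sum_window (fun i => (f \o swp n p q) i - i))
  (sum_window (fun i => f i - i)) /=.
rewrite (win_swap (F := fun i v => v - i)) //; first by set S := \sum_(_ <= _ < _) _; lia.
  by move=> i v; lia.
by case: af.
Qed.

Lemma avg_shift a f : affine_perm_avg n a f ->
  affine_perm_avg n 0 (f \o (fun i => i - a)).
Proof.
move=> [[bf pf] hs]; split.
  split.
    apply: bij_comp => //; exists (fun i => i + a) => i; lia.
  by move=> i /=; rewrite -pf; congr f; lia.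
rewrite (sum_window (fun i => (f \o (fun i => i - a)) i - i)) /=.
move: hs; rewrite (sum_window (fun i => f i - i)).
rewrite (@sum_shift (fun i => f i - i) 1 (1 - a)); last first.
  by move=> i; rewrite pf; lia.
move=> hs.
transitivity (\sum_(0 <= d < n) ((f (1 - a + d%:Z) - (1 - a + d%:Z)) - a)).
  apply: eq_bigr => i _; have -> : 1 + i%:Z - a = 1 - a + i%:Z by lia.
  by lia.
by rewrite sumrB hs big_const_nat subn0 iter_addr_0; lia.
Qed.

(** * Words in the simple reflections *)

Lemma simple_reflectionP s : simple_reflection n s <->
  (1 < n)%N /\ exists i, s = swp n i (i + 1).
Proof.
split=> [[h [i ->]]|[h [i ->]]].
  by split => //; exists (i : nat)%:Z; rewrite affine_swapE.
split=> //; have [d [hd /congP[j hj]]] := win_rep n_gt0 0 i.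
exists (Ordinal hd); rewrite affine_swapE /= -(swp_shift n i (i + 1) j).
by congr swp; lia.
Qed.

Lemma simple_ncong i : (1 < n)%N -> ~~ cong n i (i + 1).
Proof. by move=> h; apply: not_cong_near; lia. Qed.

Lemma word_affine m f : affine_word n m f -> affine_perm n f.
Proof.
elim=> [|m' s g /simple_reflectionP[h [i ->]] _ [bg pg]].
  by split => //; exists id.
split; first exact: bij_comp (swp_bij (simple_ncong i h)) bg.
by move=> x /=; rewrite pg swp_periodic.
Qed.

Lemma word_cat m f : affine_word n m f -> forall m' g, affine_word n m' g ->
  affine_word n (m + m') (f \o g).
Proof.
elim=> [|l s h hs _ IH] m' g hg; first by [].
by rewrite addSn; apply: (@affine_wordS _ _ s (h \o g)) => //; apply: IH.
Qed.

Lemma word_simple i : (1 < n)%N -> affine_word n 1 (swp n i (i + 1)).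
Proof.
move=> h; have hs : simple_reflection n (swp n i (i + 1)).
  by apply/simple_reflectionP; split => //; exists i.
exact: (affine_wordS hs (affine_word0 n)).
Qed.

(** An increasing bijection of the integers cannot skip a value. *)
Lemma incr_affine f : affine_perm n f -> (forall i, f i <= f (i + 1)) ->
  forall i, f i = f 0 + i.
Proof.
move=> [bf pf] mf.
have inf := bij_inj bf.
have mono (m : nat) x : f x + m%:Z <= f (x + m%:Z).
  elim: m => [|m IH]; first by have -> : x + 0%:Z = x; lia.
  have h1 := mf (x + m%:Z).
  have h2 : f (x + m%:Z) != f (x + m%:Z + 1) by apply/eqP => /inf; lia.
  have -> : x + m.+1%:Z = x + m%:Z + 1 by lia.
  by lia.
have step x : f (x + 1) = f x + 1.
  have [g gK Kg] := bf.
  pose y := g (f x + 1); have hy : f y = f x + 1 by rewrite /y Kg.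
  have hyx : x < y.
    rewrite ltNge; apply/negP => h.
    have := mono `|x - y|%N y; have -> : y + `|x - y|%N%:Z = x by lia.
    by lia.
  have := mono (absz (y - (x + 1))%R) (x + 1).
  have -> : x + 1 + (absz (y - (x + 1))%R)%:Z = y by lia.
  have : f x + 1 <= f (x + 1) := mono 1%N x.
  by lia.
have H (m : nat) x : f (x + m%:Z) = f x + m%:Z.
  elim: m => [|m IH]; first by have -> : x + 0%:Z = x; lia.
  have -> : x + m.+1%:Z = x + m%:Z + 1 by lia.
  by rewrite step IH; lia.
move=> i; have [h|h] := leP 0 i.
  by have := H `|i|%N 0; have -> : 0 + `|i|%N%:Z = i; lia.
by have := H `|i|%N i; have -> : i + `|i|%N%:Z = 0; lia.
Qed.

(** The sum of squared displacements strictly decreases when a descent is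
    removed, so sorting terminates. *)
Definition energy (f : int -> int) : int :=
  \sum_(0 <= d < n) (f (1 + d%:Z) - (1 + d%:Z)) * (f (1 + d%:Z) - (1 + d%:Z)).

Lemma energy_ge0 f : 0 <= energy f.
Proof. by apply: sumr_ge0 => i _; rewrite -expr2 sqr_ge0. Qed.

Lemma energy_swp f i : periodic n f -> ~~ cong n i (i + 1) ->
  energy (f \o swp n i (i + 1)) = energy f + 2%:Z * (f (i + 1) - f i).
Proof.
move=> pf h; rewrite /energy.
rewrite (win_swap (F := fun i v => (v - i) * (v - i))) //; first by set S := \sum_(_ <= _ < _) _; lia.
by move=> x v; lia.
Qed.

(** Sorting by exchanges of neighbours; [energy] bounds the number of steps. *)
Lemma word_exists f : affine_perm_avg n 0 f -> exists m, affine_word n m f.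
Proof.
have [m] := ubnP `|energy f|%N; elim: m f => // m IH f hm hf.
have [af hs] := hf; have [bf pf] := af.
case: (pselect (forall i, f i <= f (i + 1))) => [mf|/existsNP[i /negP hi]].
  have hfi := incr_affine af mf.
  have f0 : f 0 = 0.
    move: hs; rewrite (sum_window (fun i => f i - i)).
    have -> : \sum_(0 <= d < n) (f (1 + d%:Z) - (1 + d%:Z)) =
              \sum_(0 <= d < n) f 0.
      by apply: eq_bigr => i _; rewrite hfi; lia.
    by rewrite big_const_nat subn0 iter_addr_0 mul0r -mulr_natr; nia.
  exists 0%N; have -> : f = id by apply/funext => i; rewrite hfi f0 add0r.
  exact: affine_word0.
have n_gt1 : (1 < n)%N.
  rewrite ltnNge; apply/negP => hn; have n1 : n = 1%N by lia.
  have h1 : f (i + 1%N%:Z) = f i + 1%N%:Z by rewrite -n1; exact: pf.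
  by move: hi; rewrite h1; lia.
have hc := simple_ncong i n_gt1.
have [||l hl] := IH (f \o swp n i (i + 1)).
- have := energy_swp pf hc; have := energy_ge0 (f \o swp n i (i + 1)).
  have := energy_ge0 f; lia.
- exact: avg_swp.
exists (l + 1)%N; rewrite -(swpKf f hc); apply: word_cat => //.
exact: word_simple.
Qed.

(** Strong exchange.  Read a word for f from the right: the values at p and q
    start in increasing order and end in decreasing order, so some letter
    exchanges them; deleting this letter gives a word for f o (p q). *)
Lemma word_exchange m f p q : affine_word n m f -> p < q -> f q < f p ->
  exists2 m', (m' < m)%N & affine_word n m' (f \o swp n p q).
Proof.
move=> hw; elim: hw p q => [|l s g hs hg IH] p q hpq; first by lia.
have [bg pg] := word_affine hg; have ig := bij_inj bg.
move: (hs) => /simple_reflectionP[n_gt1 [i es]] /= hlt.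
have [h|h] := ltP (g q) (g p).
  have [m' hm hm'] := IH _ _ hpq h.
  by exists m'.+1 => //; apply: (@affine_wordS _ _ s (g \o swp n p q)).
have hgpq : g p < g q.
  by rewrite lt_neqAle h andbT; apply/eqP => /ig; lia.
exists l => //.
have hc := simple_ncong i n_gt1.
suff : s = swp n (g p) (g q).
  move=> e; have -> : (s \o g) \o swp n p q = g; last by [].
  apply/funext => x /=; rewrite (swp_conj p q x pg ig) -e es.
  by rewrite swpK.
have hle x : swp n i (i + 1) x <= x + 1 /\ x - 1 <= swp n i (i + 1) x.
  by rewrite /swp; case: ifP => _; [|case: ifP => _]; lia.
have [h1 _] := hle (g p); have [_ h2] := hle (g q).
rewrite es in hlt.
have hq : g q = g p + 1 by lia.
have hci : cong n (g p) i.
  apply: contraT => hn; move: hlt; rewrite {2}/swp (negbTE hn).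
  by case: ifP => _; lia.
rewrite es hq; move: hci => /congP[j ->].
by rewrite -(swp_shift n i (i + 1) j); congr swp; lia.
Qed.

Lemma affine_lengthP f m : affine_word n m f ->
  affine_word n (affine_length n f) f /\ (affine_length n f <= m)%N.
Proof.
move=> hm; rewrite /affine_length.
case: xgetP => [x _ [h1 h2]|h]; first by split=> //; apply: h2.
have [l] := ubnP m; elim: l m hm => // l IH m hm hl.
case: (pselect (exists2 m', (m' < m)%N & affine_word n m' f)).
  by move=> [m' h1 h2]; apply: (IH m') => //; lia.
move=> hn; case: (h m); split=> // m' hm'.
by rewrite leqNgt; apply/negP => ?; apply: hn; exists m'.
Qed.

(** Applied to a shortest word, the strong exchange property shortens the longer
    of the two permutations, so that lengths are compared by comparing two
    values; no formula for the length is involved. *)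
Lemma affine_length_swp f p q : affine_perm_avg n 0 f -> ~~ cong n p q -> p < q ->
  (affine_length n f < affine_length n (f \o swp n p q))%N = (f p < f q).
Proof.
move=> hf hpq lpq; have [[bf _] _] := hf; have inf := bij_inj bf.
have hneq : f p != f q by apply/eqP => /inf; lia.
have [h|h] := ltP (f p) (f q).
  have [m /affine_lengthP[hw _]] := word_exists (avg_swp hf hpq).
  have [] := @word_exchange _ _ p q hw lpq; first by rewrite /= swpL swpR.
  by move=> m' hm'; rewrite swpKf // => /affine_lengthP[_]; lia.
have [m /affine_lengthP[hw _]] := word_exists hf.
have [] := @word_exchange _ _ p q hw lpq; first by lia.
by move=> m' hm' /affine_lengthP[_]; lia.
Qed.

(** * Reflections *)

(** A simple reflection can be moved from the left of a permutation to its right,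
    where it becomes an exchange of positions, which keeps the average. *)
Lemma word_avg m f : affine_word n m f -> affine_perm_avg n 0 f.
Proof.
move=> hw; elim: hw => [|l s g hs hg IH].
  split; first exact: word_affine (affine_word0 n).
  by rewrite big1 ?mul0r // => i _; rewrite subrr.
have [bg pg] := word_affine hg.
move: hs => /simple_reflectionP[n_gt1 [i ->]].
have [g' gK Kg] := bg.
have -> : swp n i (i + 1) \o g = g \o swp n (g' i) (g' (i + 1)).
  by apply/funext => x /=; rewrite (swp_conj _ _ _ pg (bij_inj bg)) !Kg.
apply: avg_swp => //; rewrite -(cong_inj _ _ pg (bij_inj bg)) !Kg.
exact: simple_ncong.
Qed.

Lemma reflection_swp t : affine_reflection n t ->
  exists p q, [/\ p < q, ~~ cong n p q & t = swp n p q].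
Proof.
move=> [g [h [s [[[bg pg] _] gK Kg /simple_reflectionP[n_gt1 [i ->]] ->]]]].
have ig := bij_inj bg.
have E : g \o swp n i (i + 1) \o h = swp n (g i) (g (i + 1)).
  by apply/funext => x /=; rewrite (swp_conj _ _ _ pg ig) Kg.
have hc : ~~ cong n (g i) (g (i + 1)) by rewrite cong_inj // simple_ncong.
have [hlt|hge] := ltP (g i) (g (i + 1)); first by exists (g i), (g (i + 1)).
exists (g (i + 1)), (g i); split.
- by rewrite lt_neqAle hge andbT; apply/eqP => /ig; lia.
- by rewrite cong_sym.
- by rewrite E swpC.
Qed.

(** Conjugation by a simple reflection brings the two positions closer. *)
Lemma swp_reflection p q : p < q -> q < p + n%:Z -> affine_reflection n (swp n p q).
Proof.
move=> lpq; have [m] := ubnP `|q - p|%N; elim: m p q lpq => // m IH p q lpq hm hn.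
have n_gt1 : (1 < n)%N by lia.
have [e|h] := eqVneq q (p + 1).
  exists id, id, (swp n p q); split=> //; first exact: word_avg (affine_word0 n).
  by apply/simple_reflectionP; split => //; exists p; rewrite e.
have hc := simple_ncong (q - 1) n_gt1; rewrite subrK in hc.
have := IH p (q - 1); case; [lia|lia|lia|].
move=> g [g' [s [[ag sg] gK Kg hs hE]]].
have [bg pg] := ag.
pose r := swp n (q - 1) q.
exists (r \o g), (g' \o r), s; split => //.
- have [mg hw] := word_exists (conj ag sg).
  apply: (@word_avg (1 + mg)%N); apply: word_cat hw.
  by rewrite /r -{2}(subrK 1 q); apply: word_simple.
- by move=> x /=; rewrite /r swpK.
- by move=> x /=; rewrite Kg /r swpK.
apply/funext => x /=.
have /(congr1 (fun t => t (r x))) /= <- := hE.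
rewrite /r (swp_conj _ _ _ (@swp_periodic n _ _) (swp_inj hc)) swpK //.
have -> : swp n (q - 1) q p = p by apply: swp_id; apply: not_cong_near; lia.
by rewrite swpL.
Qed.

End AffineLength.

(** * The order on bounded permutations *)

Section BoundOrder.
Local Open Scope ring_scope.

Variables (k n : nat).
Hypothesis n_gt0 : (0 < n)%N.

(** The order generated by exchanges that raise the value at the earlier
    position. *)
Definition ustep (f g : int -> int) : Prop :=
  exists p q, [/\ p < q, ~~ cong n p q, f p < f q & g = f \o swp n p q].

Definition upath : (int -> int) -> (int -> int) -> Prop :=
  clos_refl_trans (int -> int) ustep.

Local Notation bnd := (bounded_perm k n).

Lemma bnd_inj f : bnd f -> injective f.
Proof. by move=> [[[bf _] _] _]; apply: bij_inj. Qed.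

Lemma bnd_per f : bnd f -> periodic n f.
Proof. by move=> [[[_ pf] _] _]. Qed.

Lemma bnd_ge f i : bnd f -> i <= f i.
Proof. by move=> [_ /(_ i)/andP[]]. Qed.

Lemma bnd_le f i : bnd f -> f i <= i + n%:Z.
Proof. by move=> [_ /(_ i)/andP[]]. Qed.

Lemma ustep_avg a f g : ustep f g -> affine_perm_avg n a f -> affine_perm_avg n a g.
Proof. by move=> [p [q [_ h _ ->]]] hf; apply: avg_swp. Qed.

Lemma upath_avg a f g : upath f g -> affine_perm_avg n a f -> affine_perm_avg n a g.
Proof.
elim=> [x y /ustep_avg|//|x y z _ h1 _ h2] h; first exact: h.
by apply: h2; apply: h1.
Qed.

(** Exchanging f p < f q for p < q only spreads the values away from the
    diagonal, so a bounded result forces a bounded source, and the two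
    positions lie within one period. *)
Lemma bnd_down f p q : affine_perm_avg n k%:Z f -> p < q -> ~~ cong n p q -> f p < f q ->
  bnd (f \o swp n p q) -> bnd f /\ q < p + n%:Z.
Proof.
move=> hf lpq hpq lf hg.
have hgp : f q <= p + n%:Z by have := bnd_le p hg; rewrite /= swpL.
have hgq : q <= f p by have := bnd_ge q hg; rewrite /= swpR.
have lqp : q < p + n%:Z by lia.
split => //; split => // i.
have [[_ pf] _] := hf.
have [h|hip] := boolP (cong n i p).
  by move: h => /congP[j ->]; rewrite periodicM //; lia.
have [h|hiq] := boolP (cong n i q).
  by move: h => /congP[j ->]; rewrite periodicM //; lia.
by have [_ /(_ i)] := hg; rewrite /= swp_id.
Qed.

Lemma upath_bnd f g : upath f g -> affine_perm_avg n k%:Z f -> bnd g -> bnd f.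
Proof.
elim=> [x y [p [q [h1 h2 h3 ->]]] hx hy|//|x y z hxy IH1 hyz IH2 hx hz].
  by have [] := bnd_down hx h1 h2 h3 hy.
have hy := upath_avg hxy hx.
by apply: IH1 => //; apply: IH2.
Qed.

Lemma swp_tau (f : int -> int) p q (a : int) :
  (f \o (fun i : int => i - a)) \o swp n p q =
  (f \o swp n (p - a) (q - a)) \o (fun i : int => i - a).
Proof.
apply/funext => x /=; congr f; rewrite /swp.
have H y : cong n (x - a) (y - a) = cong n x y by rewrite congDr.
by rewrite !H; case: ifP => _; [|case: ifP => _]; lia.
Qed.

(** [affine_length_swp] turns a Bruhat step into a condition on two values.  In
    the converse direction boundedness enters: the two positions then lie within
    one period, where [swp_reflection] applies. *)
Lemma Bound_leP (F G : Bound k n) : Bound_le F G <-> upath (val F) (val G).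
Proof.
have /asboolP hF := valP F; have /asboolP hG := valP G.
pose tau := fun i : int => i - k%:Z.
split=> [/asboolP h|h]; last first.
  apply/asboolP; rewrite /affine_bruhat_shifted /affine_bruhat -/tau.
  have hf : affine_perm_avg n k%:Z (val F) by case: hF.
  move: hf hG; elim: h => {hF} [x y [p [q [h1 h2 h3 ->]]] hx hy|x _ _|
     x y z hxy IH1 hyz IH2 hx hz].
  - have [bx lpq] := bnd_down hx h1 h2 h3 hy.
    have hs : affine_perm_avg n 0 (x \o tau) by apply: avg_shift.
    apply: rt_step; exists (swp n (p + k%:Z) (q + k%:Z)); split.
    + by apply: swp_reflection => //; lia.
    + by rewrite swp_tau !addrK.
    + have -> : (x \o swp n p q) \o tau = (x \o tau) \o swp n (p + k%:Z) (q + k%:Z).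
        by rewrite swp_tau !addrK.
      rewrite affine_length_swp //; [by rewrite /tau /= !addrK|by rewrite congDr|lia].
  - exact: rt_refl.
  - have hy := upath_avg hxy hx; have by_ := upath_bnd hyz hy hz.
    by apply: rt_trans (IH1 _ _) (IH2 _ _).
move: h; rewrite /affine_bruhat_shifted /affine_bruhat -/tau => h.
have hs : affine_perm_avg n 0 (val F \o tau) by apply: avg_shift; case: hF.
suff H x y : clos_refl_trans (int -> int) (affine_bruhat_step n) x y ->
    affine_perm_avg n 0 x ->
    upath (x \o (fun i => i + k%:Z)) (y \o (fun i => i + k%:Z))
    /\ affine_perm_avg n 0 y.
  have [+ _] := H _ _ h hs.
  congr upath; apply/funext => i /=; rewrite /tau addrK //.
elim=> {h} [u v [t [ht -> hl]]|u|u v w _ IH1 _ IH2] hu.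
- have [p [q [lpq hpq et]]] := reflection_swp n_gt0 ht; subst t.
  split; last exact: avg_swp.
  apply: rt_step; exists (p - k%:Z), (q - k%:Z); split.
  + by lia.
  + by rewrite congDr.
  + by rewrite /= !subrK -(affine_length_swp n_gt0 hu hpq lpq).
  + have := swp_tau u (p - k%:Z) (q - k%:Z) (- k%:Z).
    have -> : (fun i : int => i - - k%:Z) = (fun i => i + k%:Z).
      by apply/funext => i; rewrite opprK.
    by rewrite !opprK !subrK => ->.
- by split=> //; apply: rt_refl.
- have [h1 hv] := IH1 hu; have [h2 hw] := IH2 hv.
  by split => //; apply: rt_trans h1 h2.
Qed.

End BoundOrder.

(** * Rank counts *)

Section Ranks.
Local Open Scope ring_scope.

Variables (k n : nat).
Hypothesis n_gt0 : (0 < n)%N.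

Local Notation bnd := (bounded_perm k n).
Local Notation ustep := (ustep n).
Local Notation upath := (upath n).

(** Values of a bounded f exceed their positions by at most n, so for a < b the
    window (a - n, a] contains every m <= a with b <= f m. *)
Definition rk (f : int -> int) (a b : int) : nat :=
  (\sum_(0 <= d < n) (b <= f (a - d%:Z)%R)%R)%N.

Lemma sum_slide (G : int -> nat) (a : int) :
  (\sum_(0 <= d < n) G (a - d%:Z)%R + G (a - n%:Z)%R
   = G a + \sum_(0 <= d < n) G (a - 1 - d%:Z)%R)%N.
Proof.
rewrite -(big_nat_recr n 0 (fun d : nat => G (a - d%:Z))) //=.
rewrite big_nat_recl //= subr0; congr (_ + _)%N.
by apply: eq_bigr => i _; congr G; lia.
Qed.

Lemma rk_rec f a b : bnd f -> a < b ->
  rk f a b = (rk f (a - 1) b + (b <= f a)%R)%N.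
Proof.
move=> hf hab; have := sum_slide (fun x => nat_of_bool (b <= f x)) a.
rewrite /rk; have := bnd_le (a - n%:Z) hf.
move=> h; have -> : (b <= f (a - n%:Z)) = false by lia.
by rewrite addn0 addnC => ->.
Qed.

Lemma rk_shift f a b j : bnd f -> rk f (a + j * n%:Z) (b + j * n%:Z) = rk f a b.
Proof.
move=> hf; apply: eq_bigr => d _; congr nat_of_bool.
have -> : a + j * n%:Z - d%:Z = a - d%:Z + j * n%:Z by lia.
by rewrite periodicM ?lerD2r //; apply: bnd_per hf.
Qed.

Lemma rk_far f a b : bnd f -> a + n%:Z < b -> rk f a b = 0%N.
Proof.
move=> hf h; rewrite /rk big1 // => d _.
by have := bnd_le (a - d%:Z) hf; lia.
Qed.

(** The values in a window of n positions, reduced modulo n to that window,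
    form a permutation of the window, so the total displacement k n is n times
    the number of values that leave the window. *)
Lemma rk_ball f b : bnd f -> rk f (b - 1) b = k.
Proof.
move=> hf; have [[[bf pf] hs] _] := hf.
have inf := bij_inj bf.
pose c := b - n%:Z.
have hs' : \sum_(0 <= d < n) (f (c + d%:Z) - (c + d%:Z)) = k%:Z * n%:Z.
  rewrite -hs (sum_window n (fun i => f i - i)).
  by apply: (@sum_shift n n_gt0 (fun i => f i - i) c 1) => i; rewrite pf; lia.
pose g (i : 'I_n) : int := f (c + i%:Z) - c - (if b <= f (c + i%:Z) then n%:Z else 0).
have hg i : 0 <= g i < n%:Z.
  have := bnd_ge (c + i%:Z) hf; have := bnd_le (c + i%:Z) hf.
  by have := ltn_ord i; rewrite /g /c; case: ifP; lia.
have hgn i : (absz (g i) < n)%N by have := hg i; lia.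
pose h (i : 'I_n) : 'I_n := Ordinal (hgn i).
have inh : injective h.
  move=> i j /(congr1 val) /= hij.
  have e : g i = g j by have := hg i; have := hg j; lia.
  have : cong n (f (c + i%:Z)) (f (c + j%:Z)).
    apply/congP; move: e; rewrite /g.
    by case: ifP => _; case: ifP => _ e; [exists 0|exists 1|exists (-1)|exists 0]; lia.
  rewrite cong_inj // => /cong_near; have := ltn_ord i; have := ltn_ord j.
  by move=> h1 h2 h3; apply: val_inj => /=; lia.
have e1 : \sum_(i < n) (h i : nat)%:Z = \sum_(i < n) (i : nat)%:Z.
  by rewrite [RHS](reindex_inj inh).
have e2 : \sum_(i < n) (if b <= f (c + (i : nat)%:Z) then n%:Z else 0) = k%:Z * n%:Z.
  rewrite -hs' big_mkord; apply/eqP; rewrite -subr_eq0 -sumrB.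
  apply/eqP; transitivity (\sum_(i < n) (h i : nat)%:Z - \sum_(i < n) (i : nat)%:Z).
    rewrite -sumrB; rewrite (eq_bigr (fun i : 'I_n => (i : nat)%:Z - (h i : nat)%:Z)) .
      by rewrite !sumrB e1 !subrr.
    by move=> i _; have := hg i; rewrite /h /= /g; lia.
  by rewrite e1 subrr.
have e3 : rk f (b - 1) b = (\sum_(i < n) (b <= f (c + (i : nat)%:Z))%R)%N.
  rewrite /rk big_mkord (reindex_inj rev_ord_inj) /=.
  by apply: eq_bigr => i _; congr (nat_of_bool (b <= f _)); have := ltn_ord i; rewrite /c; lia.
have : (rk f (b - 1) b)%:Z * n%:Z = k%:Z * n%:Z.
  rewrite -e2 e3 -[X in X%:Z]/(\sum_(i < n) _)%N.
  rewrite (big_morph Posz PoszD (id1 := 0)) // mulr_suml.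
  by apply: eq_bigr => i _; case: ifP; lia.
by nia.
Qed.

(** The count of all m <= a with b <= g m, minus that for f; for a >= b the
    two counts agree because both permutations have the same average. *)
Definition slack (f g : int -> int) (a b : int) : int :=
  if a < b then (rk g a b)%:Z - (rk f a b)%:Z else 0.

Lemma slack_rec f g a b : bnd f -> bnd g ->
  slack f g a b = slack f g (a - 1) b + (b <= g a)%R%:Z - (b <= f a)%R%:Z.
Proof.
move=> hf hg; rewrite /slack; case: ifP => hab.
  have -> : a - 1 < b by lia.
  by rewrite (rk_rec hf hab) (rk_rec hg hab); lia.
have := bnd_ge a hf; have := bnd_ge a hg => h1 h2.
case: ifP => h; last by lia.
have e : a = b by lia.
by subst b; rewrite !rk_ball //; lia.
Qed.

(** The tableau form of Bruhat order. *)
Definition rkle f g := forall a b, a < b -> (rk f a b <= rk g a b)%N.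

Lemma slack_ge0 f g a b : rkle f g -> 0 <= slack f g a b.
Proof. by move=> h; rewrite /slack; case: ifP => // /h; lia. Qed.

Lemma slack_in f g a b : bnd f -> bnd g -> slack f g a b != 0 -> a + 1 < b <= a + n%:Z.
Proof.
move=> hf hg; rewrite /slack; case: ifP => // hab.
have [h|h] := ltP (a + n%:Z) b; first by rewrite !rk_far.
move=> hne; rewrite andbT ltNge; apply/negP => h'.
have e : a = b - 1 by lia.
by move: hne; rewrite e !rk_ball //; lia.
Qed.

(** The slack vanishes, and its recursion then says that b <= f a iff b <= g a. *)
Lemma rkle_anti f g : bnd f -> bnd g -> rkle f g -> rkle g f -> f = g.
Proof.
move=> hf hg h1 h2.
have s0 a b : slack f g a b = 0.
  by rewrite /slack; case: ifP => // hab; have := h1 a b hab; have := h2 a b hab; lia.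
have H a b : (b <= g a) = (b <= f a).
  by have := slack_rec a b hf hg; rewrite !s0; lia.
apply/funext => a; have := H a (f a); have := H a (g a).
by rewrite !lexx; lia.
Qed.

Lemma rkle_trans g f h : rkle f g -> rkle g h -> rkle f h.
Proof. by move=> h1 h2 a b hab; apply: leq_trans (h1 a b hab) (h2 a b hab). Qed.

(** Raising the value at p at the cost of the value at q adds one to the count
    exactly on the rectangle spanned by the two points. *)
Lemma rk_swap f (p q a b : int) : bnd f -> p < q -> q < p + n%:Z -> f p < f q ->
  f q <= p + n%:Z -> p <= a < p + n%:Z -> a < b ->
  rk (f \o swp n p q) a b = (rk f a b + ((a < q)%R && (f p < b <= f q)%R))%N.
Proof.
move=> hf lpq lqp lf hfq ha hab.
have hpq : ~~ cong n p q by apply: not_cong_near; lia.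
have toZ h : (rk h a b)%:Z = \sum_(0 <= d < n) (b <= h (a - d%:Z)%R)%R%:Z.
  by rewrite /rk (big_morph Posz PoszD (id1 := 0)).
apply/eqP; rewrite -eqz_nat PoszD !toZ.
pose q' := if a < q then q - n%:Z else q.
have hq' : cong n q' q.
  by rewrite /q'; case: ifP => _; apply/congP; [exists (-1)|exists 0]; lia.
have ea : a - (absz (a - p)%R)%:Z = p by lia.
have eb : a - (absz (a - q')%R)%:Z = q' by rewrite /q'; case: ifP; lia.
rewrite (sum_two (H0 := fun x => (b <= f (a - x)%R)%R%:Z)
  (H := fun x => (b <= f (swp n p q (a - x)%R))%R%:Z)
  (a := absz (a - p)%R) (b := absz (a - q')%R)); first last.
- move=> d hd hda hdb; rewrite swp_id //.
    by apply/negP => /cong_near; lia.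
  apply/negP => h; have := cong_trans h (etrans (cong_sym _ _ _) hq').
  by move=> /cong_near; rewrite /q' in hdb *; case: ifP hdb; lia.
- by rewrite /q'; case: ifP; lia.
- by rewrite /q'; case: ifP; lia.
- by lia.
rewrite ea eb swpL swpRc // /q'; set S := bigop.body _ _ _.
case: ifP => h; last by rewrite (_ : q - (q - p) = p); lia.
have hper x : f (x - n%:Z) = f x - n%:Z.
  by have := bnd_per hf (x - n%:Z); rewrite subrK => ->; lia.
have -> : q - n%:Z - (q - p) = p - n%:Z by lia.
by rewrite !hper; lia.
Qed.

Lemma rkle_swap f p q : bnd f -> p < q -> q < p + n%:Z -> f p < f q ->
  f q <= p + n%:Z -> bnd (f \o swp n p q) -> rkle f (f \o swp n p q).
Proof.
move=> hf lpq lqp lf hfq hg a b hab.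
have [d [hd /congP[j hj]]] := win_rep n_gt0 p a.
rewrite -(rk_shift a b j hf) -(rk_shift a b j hg) rk_swap //; last by lia.
  exact: leq_addr.
by lia.
Qed.

Lemma upath_rkle f g : upath f g -> affine_perm_avg n k%:Z f -> bnd g -> rkle f g.
Proof.
elim=> [x y [p [q [h1 h2 h3 ->]]] hx hy|x _ _ a b _ //|x y z hxy IH1 hyz IH2 hx hz].
  have [bx lqp] := bnd_down n_gt0 hx h1 h2 h3 hy.
  by apply: rkle_swap => //; have := bnd_le p hy; rewrite /= swpL.
have hy := upath_avg n_gt0 hxy hx.
have by_ := upath_bnd n_gt0 hyz hy hz.
exact: rkle_trans (IH1 hx by_) (IH2 hy hz).
Qed.

End Ranks.

(** * The rank criterion *)

Section RankCriterion.
Local Open Scope ring_scope.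

Variables (k n : nat).
Hypothesis n_gt0 : (0 < n)%N.

Local Notation bnd := (bounded_perm k n).
Local Notation upath := (upath n).
Local Notation slack := (slack n).
Local Notation rkle := (rkle n).

Lemma bnd_swp f p q : bnd f -> p < q -> f p < f q -> q <= f p -> f q <= p + n%:Z ->
  bnd (f \o swp n p q).
Proof.
move=> hf lpq lf h1 h2; have hc : ~~ cong n p q by apply: not_cong_near; lia.
have [ha _] := hf; split; first exact: avg_swp.
move=> i /=; have [h|hip] := boolP (cong n i p).
  rewrite swpLc //; move: h => /congP[j ->].
  have -> : p + j * n%:Z + (q - p) = q + j * n%:Z by lia.
  by rewrite (periodicM (bnd_per hf)); lia.
have [h|hiq] := boolP (cong n i q).
  rewrite swpRc //; move: h => /congP[j ->].
  have -> : q + j * n%:Z - (q - p) = p + j * n%:Z by lia.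
  by rewrite (periodicM (bnd_per hf)); lia.
by rewrite swp_id //; have := bnd_ge i hf; have := bnd_le i hf; lia.
Qed.

(** The mixed second difference of the slack counts points of g minus points
    of f in a box, so it is nonnegative on boxes without points of f. *)
Lemma slack_box f g (a1 a2 b1 b2 : int) : bnd f -> bnd g -> a1 <= a2 -> b1 <= b2 ->
  (forall m, a1 < m <= a2 -> ~~ (b1 <= f m < b2)) ->
  slack f g a1 b1 - slack f g a1 b2 <= slack f g a2 b1 - slack f g a2 b2.
Proof.
move=> hf hg + hb; have [m] := ubnP (absz (a2 - a1)%R).
elim: m a2 => // m IH a2 hm ha hbox.
have [e|hne] := eqVneq a1 a2; first by rewrite e.
have := IH (a2 - 1) _ _ _; rewrite (slack_rec n_gt0 a2 b1 hf hg).
rewrite (slack_rec n_gt0 a2 b2 hf hg).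
have := hbox a2; have H : forall m, a1 < m <= a2 - 1 -> ~~ (b1 <= f m < b2).
  by move=> m' hm'; apply: hbox; lia.
move=> h1 h2.
have {}h2 : slack f g a1 b1 - slack f g a1 b2 <=
     slack f g (a2 - 1) b1 - slack f g (a2 - 1) b2 by apply: h2 => //; lia.
have {}h1 : ~~ (b1 <= f a2 < b2) by apply: h1; lia.
by lia.
Qed.

(** A row of the slack has finite support, hence a maximum M.  By [slack_rec] it
    can rise to M at p only if f p < b <= g p, and it can fall from M at r only
    if g r < b <= f r. *)
Lemma row_plateau f g a0 b : bnd f -> bnd g -> rkle f g -> slack f g a0 b != 0 ->
  exists M p r, [/\ p < r, f p < b <= g p, g r < b <= f r &
    forall a, p <= a < r -> slack f g a b = M].
Proof.
move=> hf hg hle h0.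
have sge a := slack_ge0 n_gt0 a b hle.
have sle a : slack f g a b <= n%:Z.
  rewrite /slack; case: ifP => // _.
  suff : (rk n g a b <= n)%N by lia.
  rewrite /rk; apply: leq_trans (_ : \sum_(0 <= d < n) 1 <= n)%N.
    by apply: leq_sum => i _; case: (_ <= _).
  by rewrite sum_nat_const_nat; lia.
pose P m := `[< exists a, slack f g a b = m%:Z >].
have exP : exists m, P m.
  by exists (absz (slack f g a0 b)); apply/asboolP; exists a0; have := sge a0; lia.
have bP m : P m -> (m <= n)%N by move=> /asboolP[a ha]; have := sle a; lia.
have [M /asboolP[aM haM] maxM] := ex_maxnP exP bP.
have leM a : slack f g a b <= M%:Z.
  have := maxM (absz (slack f g a b)) _; have := sge a.
  move=> h1 h2; suff : (absz (slack f g a b) <= M)%N by lia.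
  by apply: h2; apply/asboolP; exists a; lia.
have M_gt0 : (0 < M)%N by have := leM a0; have := sge a0; lia.
have inM a : slack f g a b != 0 -> b - n%:Z <= a < b - 1.
  by move=> h; have := slack_in n_gt0 hf hg h; lia.
have exp : exists d : nat, slack f g (b - n%:Z + d%:Z) b == M%:Z.
  have := inM aM; rewrite haM => h; exists (absz (aM - (b - n%:Z))%R).
  by apply/eqP; rewrite -haM; congr slack; lia.
have [dp /eqP hdp minp] := ex_minnP exp.
pose p := b - n%:Z + dp%:Z.
have hp1 : slack f g (p - 1) b < M%:Z.
  rewrite lt_neqAle leM andbT; apply/eqP => e.
  have := inM (p - 1); rewrite e => h.
  have := minp (absz (p - 1 - (b - n%:Z))%R).
  have -> : b - n%:Z + (absz (p - 1 - (b - n%:Z))%R)%:Z = p - 1 by lia.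
  by rewrite e eqxx => /(_ isT); lia.
have exr : exists d : nat, slack f g (p + d%:Z) b < M%:Z.
  exists (absz (b - p)%R).
  have -> : p + (absz (b - p)%R)%:Z = b by have := inM p; rewrite hdp; lia.
  by rewrite /slack ltxx.
have [dr hdr minr] := ex_minnP exr.
have dr_gt0 : (0 < dr)%N.
  by rewrite lt0n; apply/eqP => e; move: hdr; rewrite e addr0 hdp; lia.
have hpl a : p <= a < p + dr%:Z -> slack f g a b = M%:Z.
  move=> ha; apply/eqP; rewrite eq_le leM /= leNgt; apply/negP => h.
  have := minr (absz (a - p)%R).
  have -> : p + (absz (a - p)%R)%:Z = a by lia.
  by rewrite h => /(_ isT); lia.
exists M%:Z, p, (p + dr%:Z); split=> //; first by lia.
  by have := slack_rec n_gt0 p b hf hg; rewrite hdp; lia.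
have := slack_rec n_gt0 (p + dr%:Z) b hf hg; rewrite (hpl (p + dr%:Z - 1)); lia.
Qed.

(** If f lies strictly below g in the rank order then some exchange raises f
    while staying below g.  Take a maximal plateau of the slack in some row b:
    it begins where f is below b and ends where f is above b.  Among the pairs of
    points of f on the plateau, one below and one above b, the pair closest in
    value spans a rectangle on which the slack is positive, because the smaller
    boxes that compare it to the ends of the plateau contain no point of f. *)
Lemma rkle_step f g : bnd f -> bnd g -> rkle f g -> f <> g ->
  exists p q, [/\ p < q, q < p + n%:Z, f p < f q, bnd (f \o swp n p q) &
    rkle (f \o swp n p q) g].
Proof.
move=> hf hg hle hne.
have [[a0 b] /= h0] : exists ab : int * int, slack f g ab.1 ab.2 != 0.
  apply: contrapT => /forallNP h; apply: hne; apply: (rkle_anti n_gt0 hf hg hle).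
  move=> a b hab; have := h (a, b) => /negP; rewrite negbK /slack /= hab; lia.
have sge a b' := slack_ge0 n_gt0 a b' hle.
have [M [p [r [lpr hp hr hM]]]] := row_plateau hf hg hle h0.
pose C (x : int * int) := [&& p <= x.1, x.1 < x.2, x.2 <= r, f x.1 < b & b <= f x.2].
pose P m := `[< exists2 x, C x & f x.2 - f x.1 = m%:Z >].
have exP : exists m, P m.
  exists (absz (f r - f p)%R); apply/asboolP; exists (p, r) => /=; last by lia.
  by rewrite /C /=; lia.
have [m /asboolP[[p' q'] /= hC hm] minP] := ex_minnP exP.
have {}minP x y : C (x, y) -> f q' - f p' <= f y - f x.
  move=> hxy; have hxy' : f x < f y by move: hxy; rewrite /C /=; lia.
  have := minP (absz (f y - f x)%R); rewrite hm => h.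
  suff : (m <= absz (f y - f x)%R)%N by lia.
  by apply: h; apply/asboolP; exists (x, y) => //=; lia.
rewrite /C /= in hC minP.
have hpp : f p <= f p' by have := minP p q'; lia.
have hrr : f q' <= f r by have := minP p' r; lia.
(* the slack is positive on the rectangle raised by the exchange of p' and q' *)
have pos a c : p' <= a < q' -> f p' < c <= f q' -> 0 < slack f g a c.
  move=> ha hc; have [hcb|hcb] := leP c b.
    (* no point of f in columns p to p' has its value in [c, b), by minimality *)
    have h1 : slack f g p c - slack f g p b <= slack f g p' c - slack f g p' b.
      apply: slack_box => //; first by lia.
      move=> x hx; apply/negP => hfx; have := minP x q'.
      by have [e|?] := eqVneq x p'; [move: hfx; rewrite e; lia|lia].
    have h2 : slack f g p' c - slack f g p' b <= slack f g a c - slack f g a b.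
      apply: slack_box => //; first by lia.
      by move=> x hx; apply/negP => hfx; have := minP x q'; lia.
    have := slack_rec n_gt0 p c hf hg; have := sge (p - 1) c.
    by move: h1 h2; rewrite !hM; lia.
  have h1 : slack f g a b - slack f g a c <= slack f g (r - 1) b - slack f g (r - 1) c.
    apply: slack_box => //; [by lia|by lia|].
    by move=> x hx; apply/negP => hfx; have := minP p' x; lia.
  have := slack_rec n_gt0 r c hf hg; have := sge r c.
  by move: h1; rewrite !hM; lia.
have in1 : p' + 1 < f q' <= p' + n%:Z.
  by apply: (slack_in n_gt0 hf hg); have := pos p' (f q'); lia.
have in2 : q' - 1 + 1 < f p' + 1 <= q' - 1 + n%:Z.
  by apply: (slack_in n_gt0 hf hg); have := pos (q' - 1) (f p' + 1); lia.
have hb : bnd (f \o swp n p' q') by apply: bnd_swp => //; lia.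
exists p', q'; split => //; try by lia.
move=> a c hac; have [d [hd /congP[j hj]]] := win_rep n_gt0 p' a.
rewrite -(rk_shift n_gt0 a c j hb) -(rk_shift n_gt0 a c j hg) (rk_swap n_gt0 hf) //; try by lia.
case: (boolP (_ && _)) => [/andP[h1 h2]|_]; last first.
  by rewrite addn0; apply: hle; lia.
have := pos (a + j * n%:Z) (c + j * n%:Z); rewrite /slack.
have -> : a + j * n%:Z < c + j * n%:Z by lia.
move=> hp1.
suff : 0 < (rk n g (a + j * n%:Z) (c + j * n%:Z))%:Z - (rk n f (a + j * n%:Z) (c + j * n%:Z))%:Z.
  by rewrite subr_gt0 ltz_nat addn1.
by apply: hp1; lia.
Qed.

(** A quantity that grows along every chain, which makes chains finite. *)
Definition rktot f : nat :=
  (\sum_(0 <= a < n) \sum_(0 <= c < n) rk n f a%:Z (a%:Z + 1 + c%:Z)%R)%N.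

Lemma rktot_le f g : rkle f g -> (rktot f <= rktot g)%N.
Proof.
by move=> h; apply: leq_sum => a _; apply: leq_sum => c _; apply: h; lia.
Qed.

Lemma rktot_lt f g : bnd f -> bnd g -> rkle f g -> f <> g -> (rktot f < rktot g)%N.
Proof.
move=> hf hg hle hne.
have [[a0 b] /= h0] : exists ab : int * int, slack f g ab.1 ab.2 != 0.
  apply: contrapT => /forallNP h; apply: hne; apply: (rkle_anti n_gt0 hf hg hle).
  move=> a b hab; have := h (a, b) => /negP; rewrite negbK /slack /= hab; lia.
have hin := slack_in n_gt0 hf hg h0.
have [d [hd /congP[j hj]]] := win_rep n_gt0 0 a0.
have lt1 : (rk n f d%:Z (d%:Z + 1 + (absz (b - a0 - 1)%R)%:Z)
         < rk n g d%:Z (d%:Z + 1 + (absz (b - a0 - 1)%R)%:Z))%N.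
  have -> : d%:Z + 1 + (absz (b - a0 - 1)%R)%:Z = b + j * n%:Z by lia.
  have -> : d%:Z = a0 + j * n%:Z by lia.
  rewrite !(rk_shift n_gt0 _ _ _ hf) !(rk_shift n_gt0 _ _ _ hg).
  move: h0; rewrite /slack; case: ifP => // hab h0; rewrite ltn_neqAle (hle a0 b hab) andbT.
  by apply: contra h0 => /eqP ->; rewrite subrr.
rewrite /rktot !big_mkord (bigD1 (Ordinal hd)) //= [X in (_ < X)%N](bigD1 (Ordinal hd)) //=.
have hc : (absz (b - a0 - 1)%R < n)%N by lia.
rewrite -addSn; apply: leq_add; last first.
  by apply: leq_sum => a _; apply: leq_sum => c _; apply: hle; lia.
rewrite !big_mkord (bigD1 (Ordinal hc)) //= [X in (_ < X)%N](bigD1 (Ordinal hc)) //=.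
rewrite -addSn; apply: leq_add => //.
by apply: leq_sum => c _; apply: hle; lia.
Qed.

Lemma rkle_upath f g : bnd f -> bnd g -> rkle f g -> upath f g.
Proof.
have [m] := ubnP (rktot g - rktot f)%N; elim: m f => // m IH f hm hf hg hle.
case: (pselect (f = g)) => [->|hne]; first exact: rt_refl.
have [p [q [h1 h2 h3 h4 h5]]] := rkle_step hf hg hle hne.
have hc : ~~ cong n p q by apply: not_cong_near; lia.
have hu : ustep n f (f \o swp n p q) by exists p, q.
apply: rt_trans (rt_step _ _ _ _ hu) _; apply: IH => //.
have hle1 : rkle f (f \o swp n p q).
  by apply: (upath_rkle (k := k) n_gt0 (rt_step _ _ _ _ hu))  => //; exact: hf.1.
have : (rktot f < rktot (f \o swp n p q))%N.
  apply: rktot_lt => // e; have := congr1 (fun h => h p) e => /=.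
  by rewrite swpL; lia.
have := rktot_le h5; lia.
Qed.

Lemma upath_rkleE f g : bnd f -> bnd g -> upath f g <-> rkle f g.
Proof.
move=> hf hg; split; last exact: rkle_upath.
by move=> h; apply: (upath_rkle (k := k) n_gt0 h)  => //; exact: hf.1.
Qed.

End RankCriterion.

(** * Bruhat order on the symmetric group *)

Section SymmetricBruhat.
Local Open Scope nat_scope.
Local Open Scope group_scope.

Variable n : nat.
Implicit Types (u v w : 'S_n) (i j m x a b : 'I_n).

Lemma ord_neq i j : i != j -> (i : nat) <> j.
Proof. by move=> /eqP h e; apply: h; apply: val_inj. Qed.

Lemma swapL u i j : (tperm i j * u) i = u j.
Proof. by rewrite permM tpermL. Qed.

Lemma swapR u i j : (tperm i j * u) j = u i.
Proof. by rewrite permM tpermR. Qed.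

Lemma swapD u i j x : x != i -> x != j -> (tperm i j * u) x = u x.
Proof. by move=> h1 h2; rewrite permM tpermD // eq_sym. Qed.

Lemma swapK u i j : tperm i j * (tperm i j * u) = u.
Proof. by rewrite mulgA tperm2 mul1g. Qed.

Definition no_between u i j :=
  forall m, (i < m)%N -> (m < j)%N -> ~~ ((u i < u m) && (u m < u j))%N.

(** The transposition acts on pairs of positions; where this would reverse the
    order of a pair, the pair is kept.  This matches the inversions of u with
    those of the exchanged permutation other than (i, j). *)
Definition tau i j (p : 'I_n * 'I_n) :=
  if (tperm i j p.1 < tperm i j p.2)%N then (tperm i j p.1, tperm i j p.2) else p.

Definition invset u : {set 'I_n * 'I_n} := 
  [set p : 'I_n * 'I_n | (p.1 < p.2)%N && (u p.2 < u p.1)%N].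

Lemma tauK i j (p : 'I_n * 'I_n) : (p.1 < p.2)%N -> tau i j (tau i j p) = p.
Proof.
case: p => a b /= h; rewrite /tau /=.
by case E: (tperm i j a < tperm i j b)%N => /=; [rewrite !tpermK h|rewrite E].
Qed.

Lemma tau_fix i j a b : (a < b)%N -> (tperm i j a < tperm i j b)%N = false ->
  (i < j)%N -> [\/ (a, b) = (i, j), a = i /\ (i < b < j)%N | b = j /\ (i < a < j)%N].
Proof.
move=> hab + hij.
case: (tpermP i j a) => [ea|ea|/eqP/ord_neq na1 /eqP/ord_neq na2];
case: (tpermP i j b) => [eb|eb|/eqP/ord_neq nb1 /eqP/ord_neq nb2]; try subst a; try subst b;
  move=> h; try by [lia|constructor 1]; [constructor 2|constructor 3]; split=> //; lia.
Qed.

Lemma tau_invset u i j p : (i < j)%N -> (u i < u j)%N -> no_between u i j ->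
  p \in invset u -> tau i j p \in invset (tperm i j * u) :\ (i, j).
Proof.
case: p => a b hij hu hn; rewrite !inE /= => /andP[hab hba].
rewrite /tau /=; case: ifP => h.
  rewrite /= !permM !tpermK h hba !andbT; apply/eqP => -[e1 e2].
  have := tpermK i j a; have := tpermK i j b.
  by rewrite e1 e2 tpermL tpermR => e3 e4; subst a b; lia.
have := tau_fix hab h hij; case=> [[ea eb]|[ea hb]|[eb ha]].
- by subst a b; lia.
- subst a; rewrite hab /= swapL swapD; [|by apply/eqP=> e; subst b; lia..].
  by rewrite xpair_eqE eqxx /=; apply/andP; split; [apply/eqP => e; subst b|]; lia.
- subst b; rewrite hab /= swapR swapD; [|by apply/eqP=> e; subst a; lia..].
  by rewrite xpair_eqE eqxx andbT /=; apply/andP; split; [apply/eqP => e; subst a|]; lia.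
Qed.

Lemma invset_tau u i j p : (i < j)%N -> (u i < u j)%N -> no_between u i j ->
  p \in invset (tperm i j * u) :\ (i, j) -> tau i j p \in invset u.
Proof.
case: p => a b hij hu hn; rewrite !inE /= => /andP[hne /andP[hab hba]].
rewrite /tau /=; case: ifP => h.
  by rewrite /= h; rewrite !permM in hba.
have := tau_fix hab h hij; case=> [[ea eb]|[ea hb]|[eb ha]].
- by subst a b; rewrite eqxx in hne.
- subst a; rewrite hab /=; move: hba; rewrite swapL swapD.
  + have := hn b; have : (u b != u i) by apply/eqP => /perm_inj e; subst b; lia.
    by move=> /ord_neq; lia.
  + by apply/eqP => e; subst b; lia.
  + by apply/eqP => e; subst b; lia.
- subst b; rewrite hab /=; move: hba; rewrite swapR swapD.
  + have := hn a; have : (u a != u j) by apply/eqP => /perm_inj e; subst a; lia.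
    by move=> /ord_neq; lia.
  + by apply/eqP => e; subst a; lia.
  + by apply/eqP => e; subst a; lia.
Qed.

Lemma inversions_cover u i j : (i < j)%N -> (u i < u j)%N -> no_between u i j ->
  inversions (tperm i j * u) = (inversions u).+1.
Proof.
move=> hij hu hn; rewrite /inversions -/(invset u) -/(invset (tperm i j * u)).
have hin : (i, j) \in invset (tperm i j * u) by rewrite !inE /= swapL swapR hij.
rewrite (cardsD1 (i, j) (invset (tperm i j * u))) hin add1n; congr _.+1.
have lt1 w p : p \in invset w -> (p.1 < p.2)%N by rewrite inE => /andP[].
have lt2 p : p \in invset (tperm i j * u) :\ (i, j) -> (p.1 < p.2)%N.
  by move=> /setD1P[_ /lt1].
apply/eqP; rewrite eqn_leq; apply/andP; split.
  rewrite -(card_in_imset (f := tau i j)); last first.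
    by move=> p q hp hq /(congr1 (tau i j)); rewrite !tauK //; apply: lt2.
  by apply: subset_leq_card; apply/fintype.subsetP => _ /imsetP[p hp ->]; apply: invset_tau.
rewrite -(card_in_imset (f := tau i j)); last first.
  by move=> p q hp hq /(congr1 (tau i j)); rewrite !tauK //; apply: lt1; eassumption.
by apply: subset_leq_card; apply/fintype.subsetP => _ /imsetP[p hp ->]; apply: tau_invset.
Qed.

(** If u m lies strictly between u i and u j then each of the three exchanges
    raises, so an exchange across such a point can be refined. *)
Lemma swap_split u i m j : (i < m)%N -> (m < j)%N ->
  tperm i m * (tperm m j * (tperm i m * u)) = tperm i j * u.
Proof.
move=> h1 h2; rewrite !mulgA; congr (_ * u).
have e1 : i != m by apply/eqP => e; subst m; lia.
have e2 : m != j by apply/eqP => e; subst m; lia.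
have e3 : i != j by apply/eqP => e; subst j; lia.
have -> : tperm i m * tperm m j * tperm i m = tperm m j ^ tperm i m.
  by rewrite conjgE tpermV mulgA.
by rewrite tpermJ tpermR tpermD // eq_sym.
Qed.

Lemma inversions_lt u i j : (i < j)%N -> (u i < u j)%N ->
  (inversions u < inversions (tperm i j * u))%N.
Proof.
have [d] := ubnP (j - i)%N; elim: d u i j => // d IH u i j hd hij hu.
case: (pselect (no_between u i j)) => [hn|/existsNP[m]].
  by rewrite (inversions_cover hij hu hn).
move=> /not_implyP[him /not_implyP[hmj /negP]]; rewrite negbK => /andP[h1 h2].
have i_m : i != m by apply/eqP => e; subst m; lia.
have m_j : m != j by apply/eqP => e; subst m; lia.
have i_j : i != j by apply/eqP => e; subst j; lia.
have d1 : (inversions u < inversions (tperm i m * u))%N by apply: IH => //; lia.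
apply: ltn_trans d1 _; rewrite -(swap_split u him hmj).
set u1 := tperm i m * u.
have e1 : u1 i = u m by rewrite /u1 swapL.
have e2 : u1 m = u i by rewrite /u1 swapR.
have e3 : u1 j = u j by rewrite /u1 swapD // eq_sym.
have d2 : (inversions u1 < inversions (tperm m j * u1))%N.
  by apply: IH; rewrite ?e2 ?e3 //; lia.
apply: ltn_trans d2 _; apply: IH => //; first by lia.
by rewrite swapL swapD // e1 e3.
Qed.

Lemma bruhat_stepP u w : reflect (exists i j, [/\ (i < j)%N, (u i < u j)%N &
  w = tperm i j * u]) (bruhat_step u w).
Proof.
apply: (iffP existsP) => [[i /existsP[j /and3P[hij /eqP ew hlt]]]|[i [j [h1 h2 ew]]]]; last first.
  exists i; apply/existsP; exists j; apply/and3P; split; first 1 last.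
  - by rewrite ew.
  - by rewrite ew inversions_lt.
  by apply/eqP => e; subst j; lia.
have H a b : w = tperm a b * u -> (a < b)%N -> 
  exists i j, [/\ (i < j)%N, (u i < u j)%N & w = tperm i j * u].
  move=> e hab; exists a, b; split => //; rewrite ltnNge leq_eqVlt.
  apply/negP => /orP[/eqP/val_inj/perm_inj e'|h]; first by subst b; lia.
  have := @inversions_lt w a b hab; rewrite {1 2 4}e swapL swapR swapK.
  by move=> /(_ h); lia.
rewrite /pcomp in ew; case: (ltngtP i j) => h.
- exact: H ew h.
- by apply: (H j i) => //; rewrite tpermC.
- by move/val_inj: h hij => ->; rewrite eqxx.
Qed.

Lemma bruhat_refl u : bruhat u u.
Proof. exact: connect0. Qed.

Lemma bruhat_trans v u w : bruhat u v -> bruhat v w -> bruhat u w.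
Proof. exact: connect_trans. Qed.

Lemma bruhat_up u i j : (i < j)%N -> (u i < u j)%N -> bruhat u (tperm i j * u).
Proof. by move=> h1 h2; apply: connect1; apply/bruhat_stepP; exists i, j. Qed.

Lemma bruhat_ind (P : 'S_n -> 'S_n -> Prop) : (forall u, P u u) ->
  (forall u w i j, (i < j)%N -> (u i < u j)%N -> bruhat (tperm i j * u) w ->
     P (tperm i j * u) w -> P u w) ->
  forall u w, bruhat u w -> P u w.
Proof.
move=> h0 hS u w /connectP[p]; elim: p u => [|v p IH] u /= => [_ ->//|/andP[hs hp] ew].
have [i [j [h1 h2 ev]]] := bruhat_stepP _ _ hs; subst v.
by apply: (hS u w i j) => //; [apply/connectP; exists p|apply: IH].
Qed.

Lemma bruhat_inversions u w : bruhat u w -> u = w \/ (inversions u < inversions w)%N.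
Proof.
move: u w; apply: bruhat_ind => [u|u w i j h1 h2 _]; first by left.
have := inversions_lt h1 h2 => h3 [e|h4]; first by right; rewrite -e.
by right; apply: ltn_trans h4.
Qed.

Definition cntge u (m j : nat) : nat := #|[set x : 'I_n | (x < m)%N && (j <= u x)%N]|.

(** If both exchanged positions lie below m the counted values are only permuted;
    otherwise the initial segment exchanges a value for a larger one. *)
Lemma bruhat_cntge u w (m j : nat) : bruhat u w -> (cntge u m j <= cntge w m j)%N.
Proof.
move: u w; apply: bruhat_ind => [//|u w a b hab hu _]; apply: leq_trans.
have [hb|hb] := leqP m b.
  apply: subset_leq_card; apply/fintype.subsetP => x; rewrite !inE => /andP[hx hj].
  rewrite hx /=; have xb : x != b by apply/eqP => e; subst x; lia.
  by have [e|xa] := eqVneq x a; [subst x; rewrite swapL; lia|rewrite swapD].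
rewrite /cntge -(card_imset _ (@perm_inj _ (tperm a b))).
apply: subset_leq_card; apply/fintype.subsetP => _ /imsetP[x + ->]; rewrite !inE permM tpermK.
move=> /andP[hx ->]; rewrite andbT.
by case: tpermP => [e|e|//]; subst x; lia.
Qed.

Lemma covered_byP u w : covered_by (@bruhat n) u w <->
  exists i j, [/\ (i < j)%N, (u i < u j)%N, no_between u i j & w = tperm i j * u].
Proof.
split=> [/and3P[huw hne /asboolP hc]|[i [j [h1 h2 h3 ew]]]]; last first.
  have hlt := inversions_cover h1 h2 h3.
  apply/and3P; split; first by rewrite ew; apply: bruhat_up.
    by apply/eqP => e; move: hlt; rewrite -ew -e; lia.
  apply/asboolP => z /bruhat_inversions[->|hz1]; first by left.
  move=> /bruhat_inversions[->|hz2]; first by right.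
  by move: hlt; rewrite -ew; lia.
move: huw hne hc => /connectP[[|v p] /= ]; first by move=> _ ->; rewrite eqxx.
move=> /andP[hs hp] ew hne hc; have [i [j [h1 h2 ev]]] := bruhat_stepP _ _ hs.
have huv : bruhat u v by apply: connect1.
have hvw : bruhat v w by apply/connectP; exists p.
have hlt := inversions_lt h1 h2; rewrite -ev in hlt.
have evw : v = w by case: (hc v huv hvw) => // e; move: hlt; rewrite e; lia.
exists i, j; split => //; last by rewrite -evw.
move=> m him hmj; apply/negP => /andP[hm1 hm2].
have i_m : i != m by apply/eqP => e; subst m; lia.
have m_j : m != j by apply/eqP => e; subst m; lia.
have i_j : i != j by apply/eqP => e; subst j; lia.
set u1 := tperm i m * u.
have e1 : u1 i = u m by rewrite /u1 swapL.
have e2 : u1 m = u i by rewrite /u1 swapR.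
have e3 : u1 j = u j by rewrite /u1 swapD // eq_sym.
have hb1 : bruhat u u1 by apply: bruhat_up.
have hlt1 := inversions_lt him hm1; rewrite -/u1 in hlt1.
have hs2 : (u1 m < u1 j)%N by rewrite e2 e3.
have hb2 := bruhat_up hmj hs2; have hlt2 := inversions_lt hmj hs2.
set u2 := tperm m j * u1 in hb2 hlt2.
have hs3 : (u2 i < u2 m)%N by rewrite /u2 swapL swapD // e1 e3.
have hb3 := bruhat_up him hs3; have hlt3 := inversions_lt him hs3.
have e4 : tperm i m * u2 = w by rewrite -evw ev /u2 /u1 swap_split.
rewrite e4 in hb3 hlt3.
case: (hc u1 hb1 (bruhat_trans hb2 hb3)) => e; first by move: hlt1; rewrite e ltnn.
by move: (ltn_trans hlt2 hlt3); rewrite e ltnn.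
Qed.

(** * Lifting in the symmetric group *)

(** For a transposition t other than s = (i i+1), u < u t implies
    u s < u t s, since s keeps the order of the two positions moved by t. *)
Lemma bruhat_conj u i i' a b : (i' : nat) = i.+1 -> (a < b)%N -> (u a < u b)%N ->
  (a, b) != (i, i') ->
  bruhat (tperm i i' * u) (tperm i i' * (tperm a b * u)).
Proof.
move=> hi hab hu hne; set s := tperm i i'.
have -> : s * (tperm a b * u) = tperm (s a) (s b) * (s * u).
  rewrite -tpermJ conjgE /s tpermV !mulgA; congr (_ * u).
  by rewrite -[RHS]mulgA tperm2 mulg1.
apply: bruhat_up; last by rewrite !permM /s !tpermK.
move: hne; rewrite /s xpair_eqE; case: (tpermP i i' a) => [e|e|/eqP/ord_neq e1 /eqP/ord_neq e2];
case: (tpermP i i' b) => [e'|e'|/eqP/ord_neq e1' /eqP/ord_neq e2']; try subst a; try subst b;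
  by rewrite ?eqxx //=; lia.
Qed.

(** The two forms of the lifting property that are used: a chain is conjugated
    step by step, and only a step that is itself the exchange of i and i' is
    lost. *)
Lemma lift_down u w i i' : (i' : nat) = i.+1 -> bruhat u w ->
  bruhat (tperm i i' * u) w \/ bruhat (tperm i i' * u) (tperm i i' * w).
Proof.
move=> hi; move: u w; apply: bruhat_ind => [u|u w a b hab hu hw IH].
  by right; apply: bruhat_refl.
have [[ea eb]|hne] := eqVneq (a, b) (i, i'); first by subst a b; left.
have h := bruhat_conj hi hab hu hne.
by case: IH => h'; [left|right]; apply: bruhat_trans h h'.
Qed.

Lemma lift_up u w i i' : (i' : nat) = i.+1 -> bruhat u w ->
  bruhat u (tperm i i' * w) \/ bruhat (tperm i i' * u) (tperm i i' * w).
Proof.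
move=> hi; move: u w; apply: bruhat_ind => [u|u w a b hab hu hw IH].
  by right; apply: bruhat_refl.
have hb := bruhat_up hab hu.
case: IH => h'; first by left; apply: bruhat_trans hb h'.
have [[ea eb]|hne] := eqVneq (a, b) (i, i').
  by subst a b; left; rewrite -{1}(swapK u i i').
by right; apply: bruhat_trans (bruhat_conj hi hab hu hne) h'.
Qed.

End SymmetricBruhat.

(** * The k-Bruhat order *)

Section KBruhat.
Local Open Scope nat_scope.
Local Open Scope group_scope.

Variables k n : nat.
Implicit Types (u v w : 'S_n) (i j m x a b c : 'I_n).

Lemma k_coverP u w : k_covered_by k u w <->
  exists i j, [/\ (i < k <= j)%N, (u i < u j)%N, no_between u i j & w = tperm i j * u].
Proof.
rewrite /k_covered_by; split=> [/andP[/covered_byP[i [j [hij hu hn ew]]] hne]|].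
  exists i, j; split=> //; apply: contraT => hk; case/negP: hne; apply/eqP.
  have sub : forall y, y \in w @: initial_segment k n -> y \in u @: initial_segment k n.
    move=> _ /imsetP[x + ->]; rewrite ew permM inE => hx; apply: imset_f; rewrite inE.
    by case: tpermP hx => [e|e|//]; subst x; lia.
  apply/eqP; rewrite eqEcard; apply/andP; split; first exact/fintype.subsetP.
  by rewrite !card_imset //; apply: perm_inj.
move=> [i [j [hk hu hn ew]]]; have hij : (i < j)%N by lia.
apply/andP; split; first by apply/covered_byP; exists i, j.
apply/negP => /eqP e.
have : w i \in w @: initial_segment k n by apply: imset_f; rewrite inE; lia.
rewrite e ew swapL => /imsetP[x + /perm_inj ex]; rewrite inE -ex; lia.
Qed.

(** The Bergeron-Sottile description of the k-Bruhat order. *)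
Definition crit u w : Prop :=
  [/\ forall i, (i < k)%N -> (u i <= w i)%N,
      forall i, (k <= i)%N -> (w i <= u i)%N &
      forall i j, (i < j)%N -> (i < k)%N = (j < k)%N -> (u i < u j)%N -> (w i < w j)%N].

Lemma crit_refl u : crit u u.
Proof. by split. Qed.

Lemma crit_trans v u w : crit u v -> crit v w -> crit u w.
Proof.
move=> [h1 h2 h3] [h1' h2' h3']; split=> [i hi|i hi|i j hij hs hu].
- exact: leq_trans (h1 i hi) (h1' i hi).
- exact: leq_trans (h2' i hi) (h2 i hi).
- by apply: h3' => //; apply: h3.
Qed.

Lemma k_cover_crit u w : k_covered_by k u w -> crit u w.
Proof.
move=> /k_coverP[i [j [hk hu hn ->]]]; split=> [x hx|x hx|x y hxy hs hxu].
- have [e|xi] := eqVneq x i; first by subst x; rewrite swapL; lia.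
  by rewrite swapD //; apply/eqP => e; subst x; lia.
- have [e|xj] := eqVneq x j; first by subst x; rewrite swapR; lia.
  by rewrite swapD //; apply/eqP => e; subst x; lia.
have xy : (u x : nat) <> u y by lia.
have [e|xi] := eqVneq x i.
  subst x; rewrite swapL.
  have y_i : y != i by apply/eqP => e; subst y; lia.
  have y_j : y != j by apply/eqP => e; subst y; lia.
  have : u y != u j by apply: contra y_j => /eqP/perm_inj ->.
  by rewrite swapD // => /ord_neq; have := hn y; lia.
have [e|yi] := eqVneq y i.
  subst y; rewrite swapL swapD //; first by lia.
  by apply/eqP => e; subst x; lia.
have [e|xj] := eqVneq x j.
  subst x; rewrite swapR swapD //; first by lia.
  by apply/eqP => e; subst y; lia.
have [e|yj] := eqVneq y j; last by rewrite !swapD.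
subst y; rewrite swapR swapD //.
have : u x != u i by apply: contra xi => /eqP/perm_inj ->.
by move=> /ord_neq; have := hn x; lia.
Qed.

Lemma k_bruhat_crit u w : k_bruhat k u w -> crit u w.
Proof.
move=> /connectP[p]; elim: p u => [|v p IH] u /=; first by move=> _ ->; apply: crit_refl.
by move=> /andP[/k_cover_crit h1 hp] ew; apply: crit_trans h1 (IH v hp ew).
Qed.

(** If the first block agrees, consider the smallest value of w in the second
    block at which the two differ: u takes this value at a position where w is
    not larger, hence strictly smaller. *)
Lemma crit_ltP u w : crit u w -> u <> w -> exists2 a : 'I_n, (a < k)%N & (u a < w a)%N.
Proof.
move=> [h1 h2 _] hne; apply: contrapT => hn.
have he c : (c < k)%N -> u c = w c.
  move=> hc; apply: val_inj => /=; have := h1 c hc; rewrite leq_eqVlt => /orP[/eqP //|h].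
  by case: hn; exists c.
have [b0 hb0] : exists b, u b != w b.
  apply: contrapT => /forallNP h; apply: hne; apply/permP => x.
  by have /negP := h x; rewrite negbK => /eqP.
have [b hb hmin] := arg_minnP (P := fun b => u b != w b) (fun b => w b : nat) hb0.
have hbk : (k <= b)%N by rewrite leqNgt; apply: contra hb => /he ->.
pose c := u^-1 (w b); have ec : u c = w b by rewrite /c permKV.
have hcb : c != b by apply: contra hb => /eqP e; rewrite -ec e.
have hck : (k <= c)%N.
  rewrite leqNgt; apply: contra hcb => /he e; apply/eqP; apply: (@perm_inj _ w).
  by rewrite -e ec.
have hwc : w c != w b by apply: contra hcb => /eqP/perm_inj ->.
have := hmin c; rewrite ec eq_sym hwc => /(_ isT).
by have := h2 c hck; rewrite ec; have := ord_neq hwc; lia.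
Qed.

(** Choose a in the first block that still has to rise, with the largest value,
    so that all values above u a in the first block are final.  Among the b in
    the second block that have to fall and satisfy u a < u b <= w a choose one
    with w b smallest; if w b were above u a, then the position at which u takes
    the value w b would be a better choice. *)
Lemma crit_pair u w : crit u w -> u <> w -> exists a b : 'I_n,
  [/\ (a < k <= b)%N, (w b <= u a)%N, (u a < u b)%N & (u b <= w a)%N].
Proof.
move=> hc hne; have [a0 ha0 hu0] := crit_ltP hc hne; have [h1 h2 _] := hc.
have hP : (a0 < k)%N && (u a0 < w a0)%N by rewrite ha0.
have [a /andP[hak hua] hmax] := arg_maxnP
  (P := fun a => (a < k)%N && (u a < w a)%N) (fun a => u a : nat) hP.
have hfix c : (c < k)%N -> (u a < u c)%N -> u c = w c.
  move=> hck hac; apply: val_inj => /=; have := h1 c hck; rewrite leq_eqVlt.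
  by case/orP => [/eqP //|h]; have := hmax c; rewrite hck h => /(_ isT) /=; lia.
pose D b := [&& (k <= b)%N, (u a < u b)%N, (u b <= w a)%N & (w b < u b)%N].
have inD c e : w e = u c -> e != c -> (u a < w e)%N -> (w e <= w a)%N -> D c.
  move=> ec hec hl hr; have hck : (k <= c)%N.
    rewrite leqNgt; apply: contra hec => hck; apply/eqP.
    by apply: (@perm_inj _ w); rewrite ec hfix // -ec.
  rewrite /D hck -ec hl hr /=; have := h2 c hck; rewrite -ec.
  have : w c != w e by apply: contra hec => /eqP/perm_inj ->.
  by move=> /ord_neq; lia.
have hb0 : D (u^-1 (w a)).
  apply: (inD _ a); rewrite ?permKV //.
  by apply/eqP => e; have := permKV u (w a); rewrite -e => e'; rewrite e' ltnn in hua.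
have [b hb hmin] := arg_minnP (P := D) (fun b => w b : nat) hb0.
have /and4P[hbk hb1 hb2 hb3] := hb.
exists a, b; split=> //; first by rewrite hak.
rewrite leqNgt; apply/negP => hlt.
have hD : D (u^-1 (w b)).
  apply: (inD _ b); rewrite ?permKV //; last by lia.
  by apply/eqP => e; have := permKV u (w b); rewrite -e => e'; rewrite e' ltnn in hb3.
have := hmin _ hD; move: hD; rewrite /D permKV => /and4P[_ _ _]; lia.
Qed.

(** Among the pairs of [crit_pair] take one whose values under u are closest.  A
    value in between, or a failure of the third condition after the exchange,
    would give a closer pair. *)
Lemma crit_cover u w : crit u w -> u <> w ->
  exists2 v, k_covered_by k u v & crit v w.
Proof.
move=> hc hne; have [a0 [b0 hab0]] := crit_pair hc hne; have [h1 h2 h3] := hc.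
pose C (p : 'I_n * 'I_n) := [&& (p.1 < k <= p.2)%N, (w p.2 <= u p.1)%N,
   (u p.1 < u p.2)%N & (u p.2 <= w p.1)%N].
have hC0 : C (a0, b0) by rewrite /C /=; case: hab0 => -> -> -> ->.
have [[a b] /and4P[/= hk hw hu huw] hmin] := arg_minnP (P := C)
  (fun p => (u p.2 - u p.1)%N) hC0.
have {}hmin x y : C (x, y) -> (u b - u a <= u y - u x)%N by move=> h; apply: (hmin (x, y)).
rewrite /C /= in hmin.
have nb : no_between u a b.
  move=> m ham hmb; apply/negP => /andP[um1 um2].
  have [hm|hm] := ltnP m k.
    have hwm : (w a < w m)%N by apply: h3 => //; lia.
    by have := hmin m b; lia.
  have hwm : (w m < w b)%N.
    rewrite ltnNge leq_eqVlt negb_or; apply/andP; split; last first.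
      by apply/negP => h; have := hmin a m; have := h3 m b hmb; lia.
    by apply/negP => /eqP/val_inj/perm_inj e; subst m; lia.
  by have := hmin a m; lia.
exists (tperm a b * u); first by apply/k_coverP; exists a, b.
split=> [x hx|x hx|x y hxy hs].
- have [e|xa] := eqVneq x a; first by subst x; rewrite swapL.
  by rewrite swapD //; [apply: h1|apply/eqP => e; subst x; lia].
- have [e|xb] := eqVneq x b; first by subst x; rewrite swapR.
  by rewrite swapD //; [apply: h2|apply/eqP => e; subst x; lia].
have [e|xa] := eqVneq x a.
  subst x; rewrite swapL swapD; [|by apply/eqP => e; subst y; lia..].
  by move=> h; apply: h3 => //; lia.
have [e|ya] := eqVneq y a.
  subst y; rewrite swapL swapD //; last by apply/eqP => e; subst x; lia.
  move=> hxb; have [hxa|hxa] := ltnP (u x) (u a); first exact: h3.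
  have hxa' : (u a < u x)%N.
    rewrite ltn_neqAle hxa andbT; apply/eqP => /val_inj/perm_inj e.
    by rewrite e eqxx in xa.
  rewrite ltnNge; apply/negP => hwx.
  by have := hmin x b; have := h1 x; lia.
have [e|xb] := eqVneq x b.
  subst x; rewrite swapR swapD //; last by apply/eqP => e; subst y; lia.
  move=> hay; have [hby|hby] := ltnP (u b) (u y); first exact: h3.
  have hby' : (u y < u b)%N.
    rewrite ltn_neqAle hby andbT; apply/eqP => /val_inj/perm_inj e.
    by subst y; rewrite ltnn in hxy.
  rewrite ltnNge; apply/negP => hwx.
  by have := hmin a y; have := h2 y; lia.
have [e|yb] := eqVneq y b.
  subst y; rewrite swapR swapD // => hxa.
  by apply: h3 => //; lia.
by rewrite !swapD //; apply: h3.
Qed.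

Lemma crit_k_bruhat u w : crit u w -> k_bruhat k u w.
Proof.
have [d] := ubnP (\sum_(x < n | (x < k)%N) (w x - u x))%N.
elim: d u => // d IH u hd hc.
case: (pselect (u = w)) => [->|hne]; first exact: connect0.
have [v hv hvw] := crit_cover hc hne.
apply: connect_trans (connect1 hv) (IH v _ hvw).
move: hd; rewrite ltnS; apply: leq_trans.
move/k_coverP: hv => [i [j [hk hu _ ev]]].
have hi : (i < k)%N by lia.
rewrite (bigD1 i) //= [X in (_ < X)%N](bigD1 i) //= -addSn; apply: leq_add.
  have [h1 _ _] := hvw; have := h1 i hi; rewrite ev swapL; lia.
apply: leq_sum => x /andP[hx xi]; rewrite ev swapD //.
by apply/eqP => e; subst x; lia.
Qed.

Lemma k_bruhatP u w : k_bruhat k u w <-> crit u w.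
Proof. by split; [apply: k_bruhat_crit|apply: crit_k_bruhat]. Qed.

Lemma k_bruhat_bruhat u w : k_bruhat k u w -> bruhat u w.
Proof.
move=> /connectP[p]; elim: p u => [|v p IH] u /=; first by move=> _ ->; apply: bruhat_refl.
by move=> /andP[/andP[/and3P[h _ _] _] hp] ew; apply: bruhat_trans h (IH v hp ew).
Qed.

End KBruhat.

(** * Bounded permutations from pairs *)

Section Pairs.
Local Open Scope ring_scope.

Variables (k n : nat).
Hypothesis n_gt0 : (0 < n)%N.
Hypothesis hkn : (k <= n)%N.

Local Notation bnd := (bounded_perm k n).
Local Notation rk := (rk n).
Local Notation rkle := (rkle n).
Local Notation crit := (@crit k n).

Implicit Types (u v w z : 'S_n) (i j x y : 'I_n).

Definition high_part (x : nat) : int := if (x < k)%N then n%:Z else 0.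
Local Notation hi := high_part.

(** The permutation u t w^-1, where t translates the first k positions by n; the
    translation amount is [high_part]. *)
Definition fpair u w (x : int) : int :=
  if [pick i | cong n (w i)%:Z x] is Some i then x - (w i)%:Z + (u i)%:Z + hi i
  else x.

Lemma ord_cong i j : cong n i%:Z j%:Z -> i = j.
Proof.
move=> /cong_near h; apply: val_inj => /=; have := ltn_ord i; have := ltn_ord j.
by lia.
Qed.

Lemma fpairM u w i (l : int) : fpair u w ((w i)%:Z + l * n%:Z) = (u i)%:Z + hi i + l * n%:Z.
Proof.
rewrite /fpair; case: pickP => [j hj|/(_ i)]; last first.
  by rewrite cong_sym cong_addM.
have e : j = i.
  apply: (@perm_inj _ w); apply: ord_cong; apply: cong_trans hj _; exact: cong_addM.
by subst j; lia.
Qed.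

Lemma fpairE u w i : fpair u w (w i)%:Z = (u i)%:Z + hi i.
Proof. by have := fpairM u w i 0; rewrite !mul0r !addr0. Qed.

Lemma perm_rep w (x : int) : exists i (l : int), x = (w i)%:Z + l * n%:Z.
Proof.
have [d [hd /congP[l hl]]] := win_rep n_gt0 0 x.
by exists (w^-1%g (Ordinal hd)), (- l); rewrite permKV /=; lia.
Qed.

Lemma fpair_periodic u w : periodic n (fpair u w).
Proof.
move=> x; have [i [l ->]] := perm_rep w x.
have -> : (w i)%:Z + l * n%:Z + n%:Z = (w i)%:Z + (l + 1) * n%:Z by lia.
by rewrite !fpairM; lia.
Qed.

Lemma periodic_ext w f g : periodic n f -> periodic n g ->
  (forall i, f (w i)%:Z = g (w i)%:Z) -> f = g.
Proof.
move=> pf pg h; apply/funext => x; have [i [l ->]] := perm_rep w x.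
by rewrite !periodicM // h.
Qed.

Lemma sum_ord_perm w : \sum_(i < n) (w i)%:Z = \sum_(i < n) (i : nat)%:Z :> int.
Proof. by rewrite [RHS](reindex_inj (@perm_inj _ w)). Qed.

Lemma sum_hi : \sum_(i < n) hi i = k%:Z * n%:Z.
Proof.
rewrite -big_mkcond /= -(big_ord_widen n (fun => n%:Z) hkn).
by rewrite big_const_ord iter_addr_0 -mulr_natl natz.
Qed.

Lemma fpair_bnd u w : (forall i, (i < k)%N -> (u i <= w i)%N) ->
  (forall i, (k <= i)%N -> (w i <= u i)%N) -> bnd (fpair u w).
Proof.
move=> h1 h2; split; [split; [split|]|].
- have inf : injective (fpair u w).
    move=> x y; have [i [l ->]] := perm_rep w x; have [j [l' ->]] := perm_rep w y.
    rewrite !fpairM => e.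
    have eij : i = j.
      apply: (@perm_inj _ u); apply: ord_cong; move: e; rewrite /high_part.
      by case: ifP => _; case: ifP => _ e; apply/congP;
        [exists (l' - l)|exists (l' - l - 1)|exists (l' - l + 1)|exists (l' - l)]; lia.
    by subst j; lia.
  have sur (y : int) : exists x : int, fpair u w x = y.
    have [i [l ->]] := perm_rep u y.
    exists ((w i)%:Z + (l - (if (i < k)%N then 1 else 0)) * n%:Z).
    by rewrite fpairM /high_part; case: ifP => _; lia.
  have [g hg] := boolp.choice sur.
  by exists g => // x; apply: inf; rewrite hg.
- exact: fpair_periodic.
- rewrite (sum_window n (fun r : int => fpair u w r - r)).
  rewrite (@sum_shift n n_gt0 (fun r : int => fpair u w r - r) 1 0); last first.
    by move=> x; rewrite fpair_periodic; lia.
  rewrite big_mkord (reindex_inj (@perm_inj _ w)) /=.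
  transitivity (\sum_(i < n) ((u i)%:Z + hi i - (w i)%:Z)).
    by apply: eq_bigr => i _; rewrite add0r fpairE.
  by rewrite sumrB big_split /= !sum_ord_perm sum_hi; lia.
move=> x; have [i [l ->]] := perm_rep w x; rewrite fpairM /high_part.
have := ltn_ord (u i); have := ltn_ord (w i).
by case: ifP => hi; [have := h1 i hi|have := h2 i; rewrite leqNgt hi => /(_ isT)]; lia.
Qed.

Lemma crit_bnd u w : crit u w -> bnd (fpair u w).
Proof. by move=> [h1 h2 _]; apply: fpair_bnd. Qed.

(** The Grassmannian permutations, increasing on both blocks. *)
Definition grass w := forall i j, (i < j)%N -> (i < k)%N = (j < k)%N -> (w i < w j)%N.

Lemma bnd_crit12 u w : bnd (fpair u w) ->
  (forall i, (i < k)%N -> (u i <= w i)%N) /\ (forall i, (k <= i)%N -> (w i <= u i)%N).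
Proof.
move=> h; split=> i hik.
  by have := bnd_le (w i)%:Z h; rewrite fpairE /high_part hik; lia.
have := bnd_ge (w i)%:Z h; rewrite fpairE /high_part ltnNge hik /=; lia.
Qed.

Lemma bnd_grass_crit u w : grass w -> bnd (fpair u w) -> crit u w.
Proof. by move=> hw /bnd_crit12[h1 h2]; split=> // i j hij hs _; apply: hw. Qed.

(** * Exchanges of values in terms of pairs *)

Lemma fpair_swapu u w i j : (i < k)%N = (j < k)%N -> i != j ->
  fpair (tperm i j * u)%g w = fpair u w \o swp n (w i)%:Z (w j)%:Z.
Proof.
move=> hs hij; have hc : ~~ cong n (w i)%:Z (w j)%:Z.
  by apply: contra hij => /ord_cong/perm_inj ->.
apply: (@periodic_ext w); first exact: fpair_periodic.
  by move=> x /=; rewrite swp_periodic fpair_periodic.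
move=> x /=; rewrite fpairE.
have [e|xi] := eqVneq x i; first by subst x; rewrite swapL swpL fpairE /high_part hs.
have [e|xj] := eqVneq x j; first by subst x; rewrite swapR swpR // fpairE /high_part hs.
by rewrite swapD // swp_id ?fpairE //; [move: xi|move: xj];
  apply: contra => /ord_cong/perm_inj ->.
Qed.

Lemma fpair_swapu_far u w i j : (i < k <= j)%N ->
  fpair (tperm i j * u)%g w = fpair u w \o swp n (w i)%:Z ((w j)%:Z + n%:Z).
Proof.
move=> hk; have hij : i != j by apply/eqP => e; subst j; lia.
have hw : (w i)%:Z <> (w j)%:Z by case=> /val_inj/perm_inj e; subst j; lia.
have hc : ~~ cong n (w i)%:Z ((w j)%:Z + n%:Z).
  rewrite cong_sym (cong_congl _ (cong_add n _)) cong_sym.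
  by apply: contra hij => /ord_cong/perm_inj ->.
have hi1 : hi i = n%:Z by rewrite /high_part; case: ifP; lia.
have hj1 : hi j = 0 by rewrite /high_part; case: ifP; lia.
apply: (@periodic_ext w); first exact: fpair_periodic.
  by move=> x /=; rewrite swp_periodic fpair_periodic.
move=> x /=; rewrite fpairE.
have [e|xi] := eqVneq x i.
  by subst x; rewrite swapL swpL fpair_periodic fpairE hi1 hj1; lia.
have [e|xj] := eqVneq x j.
  subst x; rewrite swapR swpRc //; last by rewrite cong_sym cong_add.
  have -> : (w j)%:Z - ((w j)%:Z + n%:Z - (w i)%:Z) = (w i)%:Z + (-1) * n%:Z by lia.
  by rewrite fpairM hi1 hj1; lia.
rewrite swapD // swp_id ?fpairE //; first by move: xi; apply: contra => /ord_cong/perm_inj ->.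
rewrite cong_sym (cong_congl _ (cong_add n _)) cong_sym.
by move: xj; apply: contra => /ord_cong/perm_inj ->.
Qed.

Lemma fpair_swapw u w i j : (i < k <= j)%N ->
  fpair u (tperm i j * w)%g = fpair u w \o swp n (w i)%:Z (w j)%:Z.
Proof.
move=> hk; have hij : i != j by apply/eqP => e; subst j; lia.
have hc : ~~ cong n (w i)%:Z (w j)%:Z.
  by apply: contra hij => /ord_cong/perm_inj ->.
apply: (@periodic_ext w); first exact: fpair_periodic.
  by move=> x /=; rewrite swp_periodic fpair_periodic.
move=> x /=; have [e|xi] := eqVneq x i.
  by subst x; rewrite swpL -{1}(swapR w i j) !fpairE.
have [e|xj] := eqVneq x j.
  by subst x; rewrite swpR // -{1}(swapL w i j) !fpairE.
rewrite -{1}(swapD w xi xj) fpairE swp_id ?fpairE //; [move: xi|move: xj];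
  by apply: contra => /ord_cong/perm_inj ->.
Qed.

Lemma fpair_young u w z : (forall x, (z x < k)%N = (x < k)%N) ->
  fpair (z * u)%g (z * w)%g = fpair u w.
Proof.
move=> hz; apply: (@periodic_ext (z * w)%g); [exact: fpair_periodic..|].
by move=> x; rewrite fpairE !permM fpairE /high_part hz.
Qed.

(** * Sorting a pair *)

Lemma tperm_young i j x : (i < k)%N = (j < k)%N -> (tperm i j x < k)%N = (x < k)%N.
Proof. by move=> h; case: tpermP => [->|->|]. Qed.

Lemma crit_swap u w i i' : crit u w -> (i' : nat) = i.+1 -> (i < k)%N = (i' < k)%N ->
  (u i < u i')%N || (w i' < w i)%N -> crit (tperm i i' * u)%g (tperm i i' * w)%g.
Proof.
move=> [h1 h2 h3] hi hs hor; split=> [x hx|x hx|x y hxy hsxy].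
- by rewrite !permM; apply: h1; rewrite tperm_young.
- by rewrite !permM; apply: h2; rewrite leqNgt tperm_young // -leqNgt.
rewrite !permM; have [e|hne] := boolP ((x == i) && (y == i')).
  case/andP: e => /eqP-> /eqP->; rewrite tpermL tpermR.
  by move: hor; lia.
apply: h3; last by rewrite !tperm_young.
move: hne; case: (tpermP i i' x) => [e|e|/eqP/ord_neq e1 /eqP/ord_neq e2];
case: (tpermP i i' y) => [e'|e'|/eqP/ord_neq e1' /eqP/ord_neq e2']; try subst x; try subst y;
  by rewrite ?eqxx //=; lia.
Qed.

Lemma grass_adj w : (forall i i', (i' : nat) = i.+1 -> (i < k)%N = (i' < k)%N -> (w i < w i')%N) ->
  grass w.
Proof.
move=> h i j; have [d] := ubnP (j - i)%N; elim: d j => // d IH j hd hij hs.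
have [e|hne] := eqVneq (j : nat) i.+1; first exact: h.
have hj : (j.-1 < n)%N by have := ltn_ord j; lia.
have hs' : (i < k)%N = (Ordinal hj < k)%N by move: hs => /=; lia.
apply: ltn_trans (IH (Ordinal hj) _ _ hs') _ => /=; [lia|lia|].
by apply: h => /=; [lia|rewrite -hs' hs].
Qed.

(** A descent of w inside a block is also a descent of u, by the third condition,
    and removing both at once leads to a pair of the same kind. *)
Lemma crit_sort (P : 'S_n -> 'S_n -> Prop) :
  (forall u w, crit u w -> grass w -> P u w) ->
  (forall u w i i', (i' : nat) = i.+1 -> (i < k)%N = (i' < k)%N -> crit u w ->
     (w i' < w i)%N -> (u i' < u i)%N -> crit (tperm i i' * u)%g (tperm i i' * w)%g ->
     P (tperm i i' * u)%g (tperm i i' * w)%g -> P u w) ->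
  forall u w, crit u w -> P u w.
Proof.
move=> h0 hS u w; have [d] := ubnP (inversions w); elim: d u w => // d IH u w hd hc.
case: (pselect (grass w)) => [|hn]; first exact: h0.
have [i [i' [hi hs hw]]] : exists i i', [/\ (i' : nat) = i.+1, (i < k)%N = (i' < k)%N &
    (w i' < w i)%N].
  apply: contrapT => hx; apply: hn; apply: grass_adj => i i' hi hs.
  rewrite ltnNge leq_eqVlt; apply/negP => /orP[/eqP/val_inj/perm_inj e|h].
    by subst i'; lia.
  by apply: hx; exists i, i'.
have hu : (u i' < u i)%N.
  have [_ _ h3] := hc.
  rewrite ltnNge leq_eqVlt; apply/negP => /orP[/eqP/val_inj/perm_inj e|h].
    by subst i'; lia.
  by have := h3 i i' _ hs h; lia.
have hc' : crit (tperm i i' * u)%g (tperm i i' * w)%g by apply: crit_swap; rewrite ?hw ?orbT.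
apply: (hS u w i i') => //; apply: IH => //.
have hii : (i < i')%N by lia.
have : ((tperm i i' * w)%g i < (tperm i i' * w)%g i')%N by rewrite swapL swapR.
by move=> /(inversions_lt hii); rewrite swapK; lia.
Qed.

Lemma adj_no_between u i i' : (i' : nat) = i.+1 -> no_between u i i'.
Proof. by move=> hi m; lia. Qed.

Lemma adj_inversions u i i' : (i' : nat) = i.+1 -> (u i' < u i)%N ->
  inversions u = (inversions (tperm i i' * u)%g).+1.
Proof.
move=> hi hu; rewrite -{1}(swapK u i i') inversions_cover //; first by lia.
  by rewrite swapL swapR.
exact: adj_no_between.
Qed.

Lemma perm_sorted_id z : (forall x, (z x < k)%N = (x < k)%N) ->
  (forall i j, (i < j)%N -> (i < k)%N = (j < k)%N -> (z i < z j)%N) -> z = 1%g.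
Proof.
move=> hz hm; apply: contrapT => hne.
have [i0 hi0] : exists i, z i != i.
  apply: contrapT => /forallNP h; apply: hne; apply/permP => x.
  by rewrite perm1; have /negP := h x; rewrite negbK => /eqP.
have [i hi hmin] := arg_minnP (P := fun i => z i != i) (fun i => i : nat) hi0.
pose j := z^-1%g i; have ej : z j = i by rewrite permKV.
have ji : j != i by apply: contra hi => /eqP e; rewrite -{2}ej e.
have ij : (i < j)%N.
  rewrite ltn_neqAle eq_sym -val_eqE /= in ji *; rewrite ji /=; apply: hmin.
  by rewrite ej.
have := hm i j ij; rewrite -(hz j) ej => /(_ erefl) hlt.
have : z (z i) == z i.
  apply: contraT => h; have := hmin _ h; lia.
by move=> /eqP/perm_inj e; rewrite e eqxx in hi.
Qed.

(** The set of high positions of [fpair u w] modulo n is w [k], which determines a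
    Grassmannian w; u is then read off from the values. *)
Lemma grass_unique u w u' w' : grass w -> grass w' -> fpair u w = fpair u' w' ->
  u = u' /\ w = w'.
Proof.
move=> hw hw' e.
have side v v' i : (n%:Z <= fpair v v' (v' i)%:Z) = (i < k)%N.
  by rewrite fpairE /high_part; have := ltn_ord (v i); case: ifP => _; lia.
pose z := (w * w'^-1)%g.
have ez x : w' (z x) = w x by rewrite /z permM permKV.
have hz x : (z x < k)%N = (x < k)%N.
  by rewrite -(side u' w' (z x)) ez -e side.
have z1 : z = 1%g.
  apply: perm_sorted_id => // i j hij hs.
  rewrite ltnNge leq_eqVlt; apply/negP => /orP[/eqP/val_inj/perm_inj ee|h].
    by subst j; lia.
  have := hw' _ _ h; rewrite !hz hs !ez => /(_ erefl).
  by have := hw _ _ hij hs; lia.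
have eww : w = w' by rewrite -[w](mulgKV w') -/z z1 mul1g.
rewrite -eww in e; split=> //; apply/permP => x; apply: val_inj => /=.
by have := congr1 (fun h => h (w x)%:Z) e => /=; rewrite !fpairE; lia.
Qed.

(** Each sorting step removes one inversion from u and one from w. *)
Lemma crit_rank_grass u w : crit u w -> exists u0 w0, [/\ crit u0 w0, grass w0,
  fpair u0 w0 = fpair u w &
  (inversions u0)%:Z - (inversions w0)%:Z = (inversions u)%:Z - (inversions w)%:Z].
Proof.
move=> hc; pattern u, w; apply: (crit_sort _ _ hc) => {u w hc} [u w hc hw|].
  by exists u, w.
move=> u w i i' hi hs _ hw hu _ [u0 [w0 [h1 h2 h3 h4]]]; exists u0, w0; split => //.
  by rewrite h3 fpair_young // => x; apply: tperm_young.
by rewrite h4 (adj_inversions hi hw) (adj_inversions hi hu); lia.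
Qed.

(** The rank of f, read off from any pair that represents it; [brankE] shows that
    the choice does not matter. *)
Definition brank (f : int -> int) : int :=
  let p := xget (1%g, 1%g) [set p : 'S_n * 'S_n | crit p.1 p.2 /\ fpair p.1 p.2 = f]%classic in
  (inversions p.1)%:Z - (inversions p.2)%:Z.

Lemma brankE u w : crit u w -> brank (fpair u w) = (inversions u)%:Z - (inversions w)%:Z.
Proof.
move=> hc; rewrite /brank; case: xgetP => [[u' w'] _ /= [hc' e]|h]; last first.
  by case: (h (u, w)).
have [u0 [w0 [h1 h2 h3 <-]]] := crit_rank_grass hc.
have [u1 [w1 [h1' h2' h3' <-]]] := crit_rank_grass hc'.
have e' : fpair u0 w0 = fpair u1 w1 by rewrite h3 h3' e.
by have [-> ->] := grass_unique h2 h2' e'.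
Qed.

End Pairs.

Section Pairs2.
Local Open Scope ring_scope.

Variables (k n : nat).
Hypothesis n_gt0 : (0 < n)%N.
Hypothesis hkn : (k <= n)%N.

Local Notation bnd := (bounded_perm k n).
Local Notation rk := (rk n).
Local Notation rkle := (rkle n).
Local Notation crit := (@crit k n).
Local Notation fpair := (@fpair k n).
Local Notation grass := (@grass k n).
Local Notation hi := (high_part k n).

Implicit Types (u v w z : 'S_n) (i j x y : 'I_n).

(** * Every bounded permutation comes from a pair *)

Lemma sorted_enum_ord (A : {set 'I_n}) : sorted ltn [seq val i | i <- enum A].
Proof.
have tr : transitive (relpre val ltn : rel 'I_n) by move=> a b c; apply: ltn_trans.
rewrite sorted_map; have hs : sorted (relpre val ltn) (enum 'I_n).
  by rewrite -sorted_map val_enum_ord iota_ltn_sorted.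
apply: (subseq_sorted tr _ hs).
by rewrite [enum A]/enum_mem -enumT; apply: filter_subseq.
Qed.

Lemma grass_exists (A : {set 'I_n}) : #|A| = k ->
  exists2 w, grass w & forall i, (w i \in A) = (i < k)%N.
Proof.
move=> hA; pose s := enum A ++ enum (~: A).
have ss : size s = n.
  by rewrite size_cat -!cardE cardsC card_ord.
have us : uniq s.
  rewrite cat_uniq !enum_uniq /= andbT; apply/hasPn => x; rewrite !mem_enum inE.
  by move=> /negP h; apply/negP.
have inj_s : injective (fun i => nth i s i).
  move=> i j; rewrite (set_nth_default j) ?ss ?ltn_ord //.
  by move=> /eqP; rewrite nth_uniq ?ss ?ltn_ord // => /eqP/val_inj.
have eA : size (enum A) = k by rewrite -cardE.
have wE i : perm inj_s i = if (i < k)%N then nth i (enum A) i else nth i (enum (~: A)) (i - k).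
  by rewrite permE nth_cat eA.
have eB : size (enum (~: A)) = (n - k)%N.
  by have := ss; rewrite size_cat eA; lia.
have nthlt (B : {set 'I_n}) a b (x0 : 'I_n) : (a < b)%N -> (b < size (enum B))%N ->
    (nth x0 (enum B) a < nth x0 (enum B) b)%N.
  move=> hab hb; have := sorted_enum_ord B; rewrite sorted_map => hs.
  have tr : transitive (relpre val ltn : rel 'I_n) by move=> y z t; apply: ltn_trans.
  by have := sorted_ltn_nth tr x0 hs; apply; rewrite ?inE //; apply: ltn_trans hb.
exists (perm inj_s) => [i j hij hs|i].
  rewrite !wE -hs; case: ifP => hik.
    rewrite (set_nth_default j) ?eA //; apply: nthlt => //; rewrite eA; lia.
  rewrite (set_nth_default j) ?eB; last by have := ltn_ord i; lia.
  by apply: nthlt; rewrite ?eB; have := ltn_ord j; lia.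
rewrite wE; case: ifP => h.
  by rewrite -mem_enum mem_nth // eA.
have : nth i (enum (~: A)) (i - k) \in enum (~: A).
  by rewrite mem_nth // eB; have := ltn_ord i; lia.
by rewrite mem_enum inE => /negbTE.
Qed.

Lemma high_card f : bnd f -> #|[set r : 'I_n | n%:Z <= f (r : nat)%:Z]| = k.
Proof.
move=> hf; rewrite -[RHS](rk_ball n_gt0 n%:Z hf) /rk big_mkord (reindex_inj rev_ord_inj) /=.
rewrite -sum1dep_card big_mkcond /=; apply: eq_bigr => i _.
have -> : n%:Z - 1 - (n - i.+1)%N%:Z = (i : nat)%:Z by have := ltn_ord i; lia.
by case: (_ <= _).
Qed.

(** Let w send the first block increasingly to the high positions, those with
    f r >= n; the remainders of the values of f then define u. *)
Lemma pair_exists f : bnd f -> exists u w, [/\ crit u w, grass w & fpair u w = f].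
Proof.
move=> hf; have [w hw hwk] := grass_exists (high_card hf).
have hwk' i : (n%:Z <= f (w i)%:Z) = (i < k)%N by rewrite -hwk inE.
have bd i : 0 <= f (w i)%:Z - hi i < n%:Z.
  rewrite /high_part; have := hwk' i; have := bnd_le (w i)%:Z hf; have := bnd_ge (w i)%:Z hf.
  by have := ltn_ord (w i); case: ifP => _; lia.
have bd' i : (absz (f (w i)%:Z - hi i)%R < n)%N by have := bd i; lia.
pose h i : 'I_n := Ordinal (bd' i).
have he i : (h i : nat)%:Z = f (w i)%:Z - hi i by rewrite /h /=; have := bd i; lia.
have ih : injective h.
  move=> i j /(congr1 (fun x => (x : nat)%:Z)); rewrite !he => e.
  have hc : cong n (f (w i)%:Z) (f (w j)%:Z).
    apply/congP; move: e; rewrite /high_part; case: ifP => _; case: ifP => _ e.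
    - by exists 0; lia.
    - by exists 1; lia.
    - by exists (-1); lia.
    - by exists 0; lia.
  rewrite (cong_inj _ _ (bnd_per hf) (bnd_inj hf)) in hc.
  by apply: (@perm_inj _ w); apply: (ord_cong n_gt0 hkn hc).
exists (perm ih), w.
have e : fpair (perm ih) w = f.
  apply: (periodic_ext n_gt0 hkn (w := w)); [exact: (fpair_periodic n_gt0 hkn)|exact: (bnd_per hf)|].
  move=> i; rewrite (fpairE n_gt0 hkn).
  by rewrite (permE ih) he subrK.
by split=> //; apply: bnd_grass_crit => //; rewrite e.
Qed.

(** * Containment of intervals *)

(** Some interval that represents f lies inside [u, w]. *)
Definition contains u w (f : int -> int) := exists u' w',
  [/\ crit u' w', fpair u' w' = f, bruhat u u' & bruhat w' w].

Lemma swap_low u i i' : (i' : nat) = i.+1 -> (u i' < u i)%N -> bruhat (tperm i i' * u)%g u.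
Proof.
move=> hi hu; rewrite -{2}(swapK u i i'); apply: bruhat_up; first by lia.
by rewrite swapL swapR.
Qed.

Lemma swap_high u i i' : (i' : nat) = i.+1 -> (u i < u i')%N -> bruhat u (tperm i i' * u)%g.
Proof. by move=> hi hu; apply: bruhat_up => //; lia. Qed.

Lemma perm_ltP u i j : i != j -> (u i < u j)%N \/ (u j < u i)%N.
Proof.
move=> hij; case: (ltngtP (u i) (u j)) => h; [by left|by right|].
by move/val_inj/perm_inj: h hij => ->; rewrite eqxx.
Qed.

(** If the smaller interval is not already in place after the exchange, moving it
    along with [u, w] makes it so: by the third condition an ascent of its lower
    end is an ascent of its upper end, and lifting compares the four ends. *)
Lemma contains_swap u w f i i' : (i' : nat) = i.+1 -> (i < k)%N = (i' < k)%N ->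
  (w i' < w i)%N -> (u i' < u i)%N ->
  contains u w f <-> contains (tperm i i' * u)%g (tperm i i' * w)%g f.
Proof.
move=> hii hs hw hu; set s := tperm i i'.
have hne : i != i' by apply/eqP => e; subst i'; lia.
have lii : (i < i')%N by lia.
have su := swap_low hii hu; have sw := swap_low hii hw.
have yz (x : 'I_n) : (s x < k)%N = (x < k)%N by apply: tperm_young.
split=> -[u' [w' [hc e h1 h2]]]; have [_ _ h3] := hc.
- have [aw|dw] := perm_ltP w' hne.
    exists u', w'; split=> //; first exact: bruhat_trans su h1.
    case: (lift_up hii h2) => // h; apply: bruhat_trans h; exact: swap_high.
  have du : (u' i' < u' i)%N.
    by case: (perm_ltP u' hne) => // h; have := h3 i i' lii hs h; lia.
  exists (s * u')%g, (s * w')%g; split.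
  + by apply: crit_swap; rewrite ?dw ?orbT.
  + by rewrite -e; apply: (fpair_young n_gt0 hkn).
  + have h : bruhat (s * u)%g u' := bruhat_trans su h1.
    case: (lift_up hii h) => //; rewrite swapK => h'; exact: bruhat_trans su h'.
  + have h : bruhat (s * w')%g w := bruhat_trans (swap_low hii dw) h2.
    case: (lift_up hii h) => //; rewrite swapK => h'.
    exact: bruhat_trans (swap_low hii dw) h'.
- have [au|du] := perm_ltP u' hne.
    have aw : (w' i < w' i')%N := h3 i i' lii hs au.
    exists (s * u')%g, (s * w')%g; split.
    + by apply: crit_swap; rewrite ?au.
    + by rewrite -e; apply: (fpair_young n_gt0 hkn).
    + have h : bruhat (s * u)%g (s * u')%g := bruhat_trans h1 (swap_high hii au).
      case: (lift_down hii h); rewrite !swapK // => h'.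
      exact: bruhat_trans h' (swap_high hii au).
    + case: (lift_down hii h2) => h; first exact: bruhat_trans h sw.
      by rewrite swapK in h.
  exists u', w'; split=> //; last exact: bruhat_trans h2 sw.
  case: (lift_down hii h1) => h; rewrite swapK // in h.
  exact: bruhat_trans h (swap_low hii du).
Qed.

Lemma contains_grass u w f u0 w0 : crit u w -> crit u0 w0 -> grass w0 ->
  fpair u0 w0 = fpair u w -> contains u w f <-> contains u0 w0 f.
Proof.
move=> hc hc0 hg0; pattern u, w; apply: (crit_sort n_gt0 hkn _ _ hc) => {u w hc} [u w hc hw e|].
  by have [-> ->] := grass_unique n_gt0 hkn hg0 hw e.
move=> u w i i' hi hs hc hw hu hc' IH e.
apply: (iff_trans (contains_swap f hi hs hw hu)); apply: IH.
by rewrite e (fpair_young n_gt0 hkn) // => x; apply: tperm_young.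
Qed.

Lemma contains_indep u w u' w' f : crit u w -> crit u' w' -> fpair u w = fpair u' w' ->
  contains u w f <-> contains u' w' f.
Proof.
move=> hc hc' e; have [u0 [w0 [h1 h2 h3 _]]] := crit_rank_grass n_gt0 hkn hc.
rewrite (contains_grass f hc h1 h2 h3).
by rewrite (contains_grass f hc' h1 h2 (etrans h3 e)).
Qed.

(** By [contains_indep] the middle interval can be represented by the same pair. *)
Lemma contains_trans u w u' w' f : contains u w (fpair u' w') -> crit u' w' ->
  contains u' w' f -> contains u w f.
Proof.
move=> [u1 [w1 [hc e h1 h2]]] hc'.
rewrite -(contains_indep f hc hc' e) => -[u2 [w2 [hc2 e2 h3 h4]]].
exists u2, w2; split=> //; first exact: bruhat_trans h1 h3.
exact: bruhat_trans h4 h2.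
Qed.

(** * Containment implies the rank order *)

Lemma rk_ord (f : int -> int) (a b : int) : 0 <= a < n%:Z ->
  rk f a b = (\sum_(r < n) (b <= f (if (r : nat)%:Z <= a then (r : nat)%:Z else (r : nat)%:Z - n%:Z))%R)%N.
Proof.
move=> ha; rewrite -[LHS]/(\sum_(0 <= d < n) (b <= f (a - d%:Z)%R)%R)%N big_mkord.
have hd (d : 'I_n) : (absz (if (d : nat)%:Z <= a then a - (d : nat)%:Z else a - (d : nat)%:Z + n%:Z)%R < n)%N.
  by have := ltn_ord d; case: ifP; lia.
pose h (d : 'I_n) : 'I_n := Ordinal (hd d).
have ih : injective h.
  move=> d e /(congr1 val) /=; have := ltn_ord d; have := ltn_ord e => h1 h2 h3.
  by apply: val_inj => /=; move: h3; case: ifP => ?; case: ifP => ?; lia.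
rewrite [RHS](reindex_inj ih); apply: eq_bigr => d _ /=.
congr (nat_of_bool (b <= f _)); have := ltn_ord d.
by case: (leP (d : nat)%:Z a) => ?; case: ifP => ?; lia.
Qed.

Lemma rk_fpair u w (a b : int) : 0 <= a < n%:Z ->
  rk (fpair u w) a b =
  (\sum_(x < n) (b <= (u x)%:Z + hi x - (if (w x)%:Z <= a then 0 else n%:Z))%R)%N.
Proof.
move=> ha; rewrite rk_ord // (reindex_inj (@perm_inj _ w)) /=; apply: eq_bigr => x _.
congr (nat_of_bool (b <= _)); case: ifP => _; first by rewrite (fpairE n_gt0 hkn) subr0.
have -> : (w x)%:Z - n%:Z = (w x)%:Z + (-1) * n%:Z by lia.
by rewrite (fpairM n_gt0 hkn); lia.
Qed.

Lemma cntgeE u (m j : nat) : cntge u m j = (\sum_(x < n) ((x < m)%N && (j <= u x)%N))%N.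
Proof.
by rewrite /cntge -sum1dep_card big_mkcond /=; apply: eq_bigr => x _; case: (_ && _).
Qed.

Lemma ord_cut (P : pred 'I_n) (lo up : nat) : (lo <= up)%N ->
  (forall x y, (lo <= x)%N -> (x < y)%N -> (y < up)%N -> P y -> P x) ->
  exists2 m, (lo <= m <= up)%N & forall x, (lo <= x < up)%N -> P x = (x < m)%N.
Proof.
move=> hlu hP.
pose Q m := (lo <= m)%N && ((up <= m)%N || [exists x : 'I_n, ((x : nat) == m) && ~~ P x]).
have exQ : exists m, Q m by exists up; rewrite /Q hlu leqnn.
have [m /andP[h1 h2] hmin] := ex_minnP exQ.
exists m; first by rewrite h1 hmin // /Q hlu leqnn.
move=> x hx; apply/idP/idP => [px|hxm].
  rewrite ltnNge; apply/negP => hmx; case/orP: h2 => [h|/existsP[y /andP[/eqP ey /negP]]].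
    by lia.
  apply; have [e|hne] := eqVneq y x; first by rewrite e.
  by apply: (hP y x) => //; have := ord_neq hne; lia.
apply: contraT => hn; have := hmin x; rewrite /Q; case/andP: hx => -> _ /=.
have -> : [exists x0 : 'I_n, ((x0 : nat) == x) && ~~ P x0].
  by apply/existsP; exists x; rewrite eqxx.
by rewrite orbT => /(_ isT); lia.
Qed.

(** With w Grassmannian the positions x with w x <= a form two initial
    segments, one on each side of k, so every count that occurs in the rank of
    the pair (u, w) is a count over an initial segment of positions; such counts
    are controlled by the Bruhat order on either component. *)
Lemma contains_rkle u w f : crit u w -> grass w -> contains u w f -> rkle (fpair u w) f.
Proof.
move=> hc hg [u' [w' [hc' <- hu hw]]] a0 b0 hab0.
have hb : bnd (fpair u w) := crit_bnd n_gt0 hkn hc.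
have hb' : bnd (fpair u' w') := crit_bnd n_gt0 hkn hc'.
have [d [hd /congP[l hl]]] := win_rep n_gt0 0 a0.
rewrite -(rk_shift n_gt0 a0 b0 l hb) -(rk_shift n_gt0 a0 b0 l hb').
have : 0 <= a0 + l * n%:Z < n%:Z by lia.
have : a0 + l * n%:Z < b0 + l * n%:Z by lia.
move: (a0 + l * n%:Z) (b0 + l * n%:Z) => a b {a0 b0 hab0 d hd l hl} hab ha.
rewrite !rk_fpair //.
have [h1 h2 _] := hc; have [h1' h2' _] := hc'.
have ea : a = (absz a)%:Z by lia.
pose P x := (w x <= absz a)%N.
(* for b >= n only positions of the first block are counted *)
have [hbn|hbn] := leP n%:Z b.
  have [x y _ hxy hyk|m hm hP] := @ord_cut P 0 k (leq0n k).
    by rewrite /P; have := hg x y hxy; lia.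
  have hw' x : (x < m)%N -> (w' x <= absz a)%N.
    move=> hx; rewrite leqNgt; apply/negP => hlt.
    have := bruhat_cntge m (absz a).+1 hw; rewrite [cntge w _ _]cntgeE big1.
      rewrite leqn0 cards_eq0 => /eqP/setP/(_ x); rewrite !inE; lia.
    by move=> y _; have := hP y; rewrite /P; lia.
  apply: leq_trans (leq_trans (bruhat_cntge m (absz (b - n%:Z)%R) hu) _).
    rewrite cntgeE; apply: leq_sum => x _; rewrite /high_part.
    have := ltn_ord (u x); have := hP x; rewrite /P.
    by case: (leP (w x)%:Z a) => ?; case: ifP => ?; lia.
  rewrite cntgeE; apply: leq_sum => x _; rewrite /high_part; have := hw' x.
  by case: (leP (w' x)%:Z a) => ?; case: ifP => ?; lia.
have [x y hkx hxy _|m hm hP] := @ord_cut P k n hkn.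
  by rewrite /P; have := hg x y hxy; lia.
(* for b < n every x contributes [x < k] + [x < m, b <= u x] - [x < m, a < w x] *)
have E : (\sum_(x < n) (b <= (u x)%:Z + hi x - (if (w x)%:Z <= a then 0 else n%:Z))%R
    + cntge w m (absz a).+1 =
   \sum_(x < n) (x < k)%N + cntge u m (absz b))%N.
  rewrite !cntgeE -!big_split /=; apply: eq_bigr => x _.
  have := ltn_ord (u x); have := hP x; have := h1 x; rewrite /P /high_part => ? ? ?.
  have := ltn_ord x => ?.
  by case: (leP (w x)%:Z a) => ?; case: ifP => ?; lia.
have E' : (\sum_(x < n) (x < k)%N + cntge u' m (absz b) <=
    \sum_(x < n) (b <= (u' x)%:Z + hi x - (if (w' x)%:Z <= a then 0 else n%:Z))%R
    + cntge w' m (absz a).+1)%N.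
  rewrite !cntgeE -!big_split /=; apply: leq_sum => x _.
  have := ltn_ord (u' x); have := h1' x; rewrite /high_part => ? ?.
  have := ltn_ord x => ?.
  by case: (leP (w' x)%:Z a) => ?; case: ifP => ?; lia.
rewrite -(leq_add2r (cntge w m (absz a).+1)) E.
apply: leq_trans (leq_trans (leq_add (leqnn _) (bruhat_cntge m (absz b) hu)) E') _.
by rewrite leq_add2l bruhat_cntge.
Qed.

(** * Covers in terms of pairs *)

Definition no_inside (f : int -> int) (p q : int) :=
  forall m, p < m -> m < q -> ~~ (f p < f m < f q).

(** A bounded exchange that jumps over no value is, in terms of a Grassmannian
    pair, a Bruhat cover in one of the two components. *)
Lemma cover_pair f (p q : int) : bnd f -> p < q -> q < p + n%:Z -> f p < f q -> no_inside f p q ->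
  bnd (f \o swp n p q) -> exists u w u' w',
  [/\ crit u w, grass w, fpair u w = f, crit u' w' & fpair u' w' = f \o swp n p q] /\
  (w' = w /\ (exists i j, [/\ (i < j)%N, (u i < u j)%N, no_between u i j &
      u' = (tperm i j * u)%g]) \/
   u' = u /\ (exists i j, [/\ (i < j)%N, (w' i < w' j)%N, no_between w' i j &
      w = (tperm i j * w')%g])).
Proof.
move=> hf lpq lqp lf hn hg.
have [u [w [hc hw e]]] := pair_exists hf.
have [i [l hp]] := perm_rep n_gt0 hkn w p.
have ltw x := ltn_ord (w x); have ltu x := ltn_ord (u x).
(* translate so that p becomes the representative w i in [0, n) *)
pose q0 := q - l * n%:Z.
have es : swp n p q = swp n (w i)%:Z q0.
  by rewrite -(swp_shift n (w i)%:Z q0 l) hp /q0; congr swp; lia.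
have pf := bnd_per hf.
have fp : f p = f (w i)%:Z + l * n%:Z by rewrite hp periodicM.
have fq : f q = f q0 + l * n%:Z by rewrite -periodicM // /q0 subrK.
have {}hn : no_inside f (w i)%:Z q0.
  move=> m h1 h2; have := hn (m + l * n%:Z); rewrite periodicM // fp fq.
  have -> : p < m + l * n%:Z by lia.
  have -> : m + l * n%:Z < q by rewrite /q0 in h2; lia.
  by move=> /(_ isT isT); lia.
have lpq0 : (w i)%:Z < q0 by rewrite /q0; lia.
have lqp0 : q0 < (w i)%:Z + n%:Z by rewrite /q0; lia.
have lf0 : f (w i)%:Z < f q0 by lia.
rewrite es in hg *.
clearbody q0; clear es fp fq hp lpq lqp lf p q l.
move: q0 lpq0 lqp0 lf0 hn hg => q lpq lqp lf hn hg.
have fE x : f (w x)%:Z = (u x)%:Z + hi x by rewrite -e (fpairE n_gt0 hkn).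
have [h1 h2 h3] := hc.
have mono x y : (x < y)%N -> (x < k)%N = (y < k)%N -> (w x < w y)%N by apply: hw.
have winj x y : (w x : nat) = w y -> x = y by move/val_inj/perm_inj.
have uinj x y : (u x : nat) = u y -> x = y by move/val_inj/perm_inj.
have [hqn|hqn] := ltP q n%:Z.
  have [j ej] : exists j, (w j)%:Z = q.
    have hq' : (absz q < n)%N by lia.
    by exists (w^-1%g (Ordinal hq')); rewrite permKV /=; lia.
  subst q; have lij : (w i < w j)%N by lia.
  have ij : i != j by apply/eqP => eij; subst j; lia.
  have := lf; rewrite !fE /high_part => lf'.
  have [hs|hs] := eqVneq (i < k)%N (j < k)%N.
    have hij : (i < j)%N.
      rewrite ltnNge leq_eqVlt eq_sym; apply/negP => /orP[|h].
        by rewrite val_eqE (negbTE ij).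
      by have := mono _ _ h (esym hs); lia.
    have eg : fpair (tperm i j * u)%g w = f \o swp n (w i)%:Z (w j)%:Z.
      by rewrite -e; apply: (fpair_swapu n_gt0 hkn).
    exists u, w, (tperm i j * u)%g, w; split.
      by split=> //; apply: (bnd_grass_crit n_gt0 hkn) => //; rewrite eg.
    left; split=> //; exists i, j; split=> //.
      by move: lf'; rewrite hs; case: ifP => _; lia.
    move=> m him hmj; apply/negP => hm; have hms : (i < k)%N = (m < k)%N by lia.
    have hms' : (m < k)%N = (j < k)%N by lia.
    have := hn (w m)%:Z; have := mono _ _ him hms; have := mono _ _ hmj hms'.
    by rewrite !fE /high_part hms -hs hms; case: ifP => _; lia.
  (* a low position to the left of a high one: the set of high positions moves *)
  have hik : (k <= i)%N.
    rewrite leqNgt; apply/negP => hik; move: lf' hs; rewrite hik => lf' hs.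
    have hjk : (j < k)%N = false by case: (j < k)%N hs.
    by move: lf'; rewrite hjk; have := ltu j; lia.
  have hjk : (j < k)%N by apply: contraNT hs => hjk; rewrite ltnNge hik (negbTE hjk).
  have hji : (j < k <= i)%N by rewrite hjk.
  have eg : fpair u (tperm j i * w)%g = f \o swp n (w i)%:Z (w j)%:Z.
    rewrite (fpair_swapw n_gt0 hkn u w hji) e swpC //.
    by rewrite cong_sym; apply: not_cong_near; have := ltw j; lia.
  have hjif : (j < i)%N by lia.
  set w' := (tperm j i * w)%g in eg.
  have w'j : w' j = w i by rewrite /w' swapL.
  have w'i : w' i = w j by rewrite /w' swapR.
  have w'D x : x != j -> x != i -> w' x = w x by move=> ? ?; rewrite /w' swapD.
  have hin x : (w i < w x)%N -> (w x < w j)%N -> ~~ (f (w i)%:Z < f (w x)%:Z < f (w j)%:Z).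
    by move=> ? ?; apply: hn; lia.
  have hci : hi i = 0 by rewrite /high_part ltnNge hik.
  have hcj : hi j = n%:Z by rewrite /high_part hjk.
  exists u, w, u, w'; split; last first.
    right; split => //; exists j, i; split=> //.
    - by rewrite w'j w'i.
    - move=> m hjm hmi; rewrite w'j w'i w'D; [|by apply/eqP => em; subst m; lia..].
      have [hmk|hmk] := ltnP m k.
        by have := mono _ _ hjm; rewrite hjk hmk => /(_ erefl); lia.
      by have := mono _ _ hmi; rewrite !ltnNge hik hmk => /(_ erefl); lia.
    - by rewrite /w' swapK.
  have hbg : bnd (fpair u w') by rewrite eg.
  have [h1' h2'] := bnd_crit12 n_gt0 hkn hbg.
  split=> //; split=> // x y hxy hs' huxy.
  have := ltu x; have := ltu y => uy ux.
  have [ex|xj] := eqVneq x j.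
    subst x; have yi : y != i by apply/eqP => ey; subst y; lia.
    rewrite w'j w'D //; last by apply/eqP => ey; subst y; lia.
    by have := mono _ _ hxy hs'; lia.
  have [ex|xi] := eqVneq x i.
    subst x; rewrite w'i w'D; [|by apply/eqP => ey; subst y; lia..].
    have := mono _ _ hxy hs'; have := hin y; rewrite !fE hci hcj /high_part.
    have -> : (y < k)%N = false by lia.
    have : (w y : nat) <> w j by move=> /winj ey; subst y; lia.
    by lia.
  rewrite (w'D x) //; have [ey|yj] := eqVneq y j.
    subst y; rewrite w'j; have := mono _ _ hxy hs'; have := hin x.
    rewrite !fE hci hcj /high_part; have -> : (x < k)%N by lia.
    have : (w x : nat) <> w i by move=> /winj ex; subst x; lia.
    by have := ltu i; lia.
  have [ey|yi] := eqVneq y i; last by rewrite w'D //; apply: mono.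
  by subst y; rewrite w'i; have := mono _ _ hxy hs'; lia.
(* the exchange wraps around the end of the window *)
have [j ej] : exists j, q = (w j)%:Z + n%:Z.
  have hq' : (absz (q - n%:Z)%R < n)%N by have := ltw i; lia.
  by exists (w^-1%g (Ordinal hq')); rewrite permKV /=; lia.
subst q.
have fqE : f ((w j)%:Z + n%:Z) = (u j)%:Z + hi j + n%:Z by rewrite pf fE.
have hcg : ~~ cong n (w i)%:Z ((w j)%:Z + n%:Z) by apply: not_cong_near.
have gp : f ((w j)%:Z + n%:Z) <= (w i)%:Z + n%:Z.
  by have := bnd_le (w i)%:Z hg; rewrite /= swpL.
have gq : (w j)%:Z + n%:Z <= f (w i)%:Z.
  by have := bnd_ge ((w j)%:Z + n%:Z) hg; rewrite /= swpR.
have hjk : (k <= j)%N.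
  by rewrite leqNgt; apply/negP => h; move: gp; rewrite fqE /high_part h; have := ltw i; lia.
have hik : (i < k)%N.
  by apply: contraT => h; move: gq; rewrite fE /high_part (negbTE h); have := ltu i; lia.
have hij : (i < k <= j)%N by rewrite hik.
have hci : hi i = n%:Z by rewrite /high_part hik.
have hcj : hi j = 0 by rewrite /high_part ltnNge hjk.
have eg : fpair (tperm i j * u)%g w = f \o swp n (w i)%:Z ((w j)%:Z + n%:Z).
  by rewrite -e; apply: (fpair_swapu_far n_gt0 hkn).
exists u, w, (tperm i j * u)%g, w; split.
  by split=> //; apply: (bnd_grass_crit n_gt0 hkn) => //; rewrite eg.
left; split=> //; exists i, j; split=> //; first by lia.
  by move: lf; rewrite fqE fE hci hcj; lia.
move=> m him hmj; apply/negP => hm; have [hmk|hmk] := ltnP m k.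
  have hcm : hi m = n%:Z by rewrite /high_part hmk.
  have hs1 : (i < k)%N = (m < k)%N by lia.
  have h := mono _ _ him hs1; have := hn (w m)%:Z.
  by rewrite fqE !fE hci hcj hcm; have := ltw m; lia.
have hcm : hi m = 0 by rewrite /high_part ltnNge hmk.
have hs1 : (m < k)%N = (j < k)%N by lia.
have h := mono _ _ hmj hs1; have := hn ((w m)%:Z + n%:Z).
by rewrite fqE pf !fE hci hcj hcm; have := ltw i; have := ltw m; lia.
Qed.

End Pairs2.

(** * Covers of bounded permutations *)

Section Covers.
Local Open Scope ring_scope.

Variables (k n : nat).
Hypothesis n_gt0 : (0 < n)%N.
Hypothesis hkn : (k <= n)%N.

Local Notation bnd := (bounded_perm k n).
Local Notation upath := (upath n).
Local Notation brank := (@brank k n).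

(** By [bcov_rank] these are the covers, provided that the exchange is bounded. *)
Definition bcov (f : int -> int) (p q : int) : Prop :=
  [/\ p < q, q < p + n%:Z, f p < f q & no_inside f p q].

Lemma bcov_ncong f p q : bcov f p q -> ~~ cong n p q.
Proof. by case=> h1 h2 _ _; apply: not_cong_near. Qed.

Lemma bcov_rank f p q : bnd f -> bnd (f \o swp n p q) -> bcov f p q ->
  brank (f \o swp n p q) = brank f + 1.
Proof.
move=> hf hg [h1 h2 h3 h4].
have [u [w [u' [w' [[hc hw <- hc' e] h]]]]] := cover_pair n_gt0 hkn hf h1 h2 h3 h4 hg.
rewrite -{1}e !(brankE n_gt0 hkn) //.
case: h => [[-> [i [j [hij hu hn ->]]]]|[-> [i [j [hij hu hn ->]]]]].
  by rewrite (inversions_cover hij hu hn); lia.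
by rewrite (inversions_cover hij hu hn); lia.
Qed.

Lemma swp3 (p m q : int) : ~~ cong n p m -> ~~ cong n p q -> ~~ cong n m q ->
  swp n p m \o swp n m q \o swp n p m = swp n p q.
Proof.
move=> h1 h2 h3; apply/funext => x /=.
rewrite (swp_conj _ _ _ (@swp_periodic n p m) (swp_inj h1)) swpK // swpR //.
by have -> : swp n p m q = q by apply: swp_id; rewrite cong_sym.
Qed.

Lemma upath_ustep f p q : p < q -> q < p + n%:Z -> f p < f q -> upath f (f \o swp n p q).
Proof.
by move=> h1 h2 h3; apply: rt_step; exists p, q; split=> //; apply: not_cong_near.
Qed.

(** An exchange that jumps over a value factors through exchanges of closer
    positions, so every exchange starts with a cover. *)
Lemma step_cover f p q : bnd f -> p < q -> q < p + n%:Z -> f p < f q ->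
  bnd (f \o swp n p q) ->
  exists p' q', [/\ bcov f p' q', bnd (f \o swp n p' q') &
    upath (f \o swp n p' q') (f \o swp n p q)].
Proof.
move=> hf; have [d] := ubnP (absz (q - p)%R).
elim: d q => // d IH q hd h1 h2 h3 hg.
case: (pselect (no_inside f p q)) => [hn|/existsNP[m]].
  by exists p, q; split=> //; apply: rt_refl.
move=> /not_implyP[hpm /not_implyP[hmq /negP]]; rewrite negbK => /andP[f1 f2].
have c1 : ~~ cong n p m by apply: not_cong_near; lia.
have c2 : ~~ cong n p q by apply: not_cong_near; lia.
have c3 : ~~ cong n m q by apply: not_cong_near; lia.
have hqid : swp n p m q = q by apply: swp_id; rewrite cong_sym.
have hpid : swp n m q p = p by apply: swp_id.
have hp : upath (f \o swp n p m) (f \o swp n p q).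
  rewrite -(swp3 c1 c2 c3).
  apply: (@rt_trans _ _ _ ((f \o swp n p m) \o swp n m q)).
    by apply: upath_ustep; rewrite /= ?swpR ?hqid //; lia.
  apply: (@upath_ustep ((f \o swp n p m) \o swp n m q)); rewrite /= ?hpid ?swpL ?hqid //; lia.
have hb : bnd (f \o swp n p m).
  by apply: (upath_bnd n_gt0 hp) => //; apply: avg_swp => //; exact: hf.1.
have hd' : (absz (m - p)%R < d)%N by lia.
have hm : m < p + n%:Z by lia.
have [p' [q' [h4 h5 h6]]] := IH m hd' hpm hm f1 hb.
by exists p', q'; split=> //; apply: rt_trans h6 hp.
Qed.

Lemma upath_cover f g : bnd f -> bnd g -> upath f g -> f <> g ->
  exists p q, [/\ bcov f p q, bnd (f \o swp n p q) & upath (f \o swp n p q) g].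
Proof.
move=> hf hg hu hne; have h := clos_rt_rt1n _ _ _ _ hu.
have H x z : clos_refl_trans_1n _ (ustep n) x z -> x = z \/ exists2 y, ustep n x y & upath y z.
  case=> [|y z' h1 h2]; [by left|right; exists y => //].
  exact: (clos_rt1n_rt _ _ _ _ h2).
have [//|[y [p [q [h1 h2 h3 ->]]] hp]] := H _ _ h.
have hb : bnd (f \o swp n p q).
  by apply: (upath_bnd n_gt0 hp) => //; apply: avg_swp => //; exact: hf.1.
have [_ h4] := bnd_down n_gt0 hf.1 h1 h2 h3 hb.
have [p' [q' [h5 h6 h7]]] := step_cover hf h1 h4 h3 hb.
by exists p', q'; split=> //; apply: rt_trans h7 hp.
Qed.

Lemma bcov_upath f p q : bcov f p q -> upath f (f \o swp n p q).
Proof. by case=> h1 h2 h3 _; apply: upath_ustep. Qed.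

Lemma bcov_neq f p q : bcov f p q -> f <> f \o swp n p q.
Proof.
by case=> _ _ h _ e; have := congr1 (fun h => h p) e => /=; rewrite swpL; lia.
Qed.

Lemma bcov_rktot f p q : bnd f -> bnd (f \o swp n p q) -> bcov f p q ->
  (rktot n f < rktot n (f \o swp n p q))%N.
Proof.
move=> hf hg hc; apply: (rktot_lt n_gt0 hf hg); last exact: bcov_neq.
by apply: (upath_rkle n_gt0 (bcov_upath hc) hf.1 hg).
Qed.

Lemma upath_cover_ind g (P : (int -> int) -> Prop) : bnd g -> P g ->
  (forall f p q, bnd f -> bcov f p q -> bnd (f \o swp n p q) -> upath (f \o swp n p q) g ->
     P (f \o swp n p q) -> P f) ->
  forall f, bnd f -> upath f g -> P f.
Proof.
move=> hg h0 hS f; have [d] := ubnP (rktot n g - rktot n f)%N.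
elim: d f => // d IH f hd hf hp.
case: (pselect (f = g)) => [->//|hne].
have [p [q [h1 h2 h3]]] := upath_cover hf hg hp hne.
apply: (hS f p q) => //; apply: IH => //.
have := bcov_rktot hf h2 h1.
have := rktot_le n_gt0 (upath_rkle n_gt0 h3 h2.1 hg); lia.
Qed.

Lemma upath_brank f g : bnd f -> bnd g -> upath f g -> f = g \/ brank f < brank g.
Proof.
move=> hf hg hp; pattern f; apply: (upath_cover_ind hg _ _ hf hp); first by left.
move=> {f hf hp} f p q hf hc hb hp [e|h]; right.
  by rewrite -e (bcov_rank hf hb hc); lia.
by apply: lt_trans h; rewrite (bcov_rank hf hb hc); lia.
Qed.

Lemma upath_cocover f g : bnd f -> bnd g -> upath f g -> f <> g ->
  exists h p q, [/\ bnd h, bcov h p q, h \o swp n p q = g & upath f h].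
Proof.
move=> hf hg hp; pattern f; apply: (upath_cover_ind hg _ _ hf hp); first by [].
move=> {f hf hp} f p q hf hc hb hp IH _.
case: (pselect (f \o swp n p q = g)) => [e|hne].
  by exists f, p, q; split=> //; apply: rt_refl.
have [h [p' [q' [h1 h2 h3 h4]]]] := IH hne.
exists h, p', q'; split=> //; apply: rt_trans h4; exact: bcov_upath.
Qed.

(** * Labels of covers *)

(** A cover exchanges the values at p and q for a unique pair of positions with
    0 <= p < n and p < q < p + n.  The pairs inside the window come first, in
    lexicographic order; the pairs that wrap around come last, by increasing p
    and then decreasing q. *)
Definition normal_label (l : int * int) := (0 <= l.1 < n%:Z) && (l.1 < l.2 < l.1 + n%:Z).
Local Notation norm_label := normal_label.

Definition inwin (l : int * int) := l.2 < n%:Z.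

Definition label_lt (l l' : int * int) : bool :=
  if inwin l then ~~ inwin l' || ((l.1 < l'.1) || ((l.1 == l'.1) && (l.2 < l'.2)))
  else ~~ inwin l' && ((l.1 < l'.1) || ((l.1 == l'.1) && (l'.2 < l.2))).

Local Notation lablt := label_lt.

Lemma lablt_trans : transitive lablt.
Proof.
move=> [p q] [p' q'] [p'' q'']; rewrite /label_lt /inwin /=.
by case: (ltP q n%:Z) => ?; case: (ltP q' n%:Z) => ?; case: (ltP q'' n%:Z) => ? //=; lia.
Qed.

(** Chains of covers are recorded by their labels. *)
Fixpoint lch (f : int -> int) (ls : seq (int * int)) (g : int -> int) : Prop :=
  if ls is l :: ls' then
    [/\ norm_label l, bnd f, bcov f l.1 l.2, bnd (f \o swp n l.1 l.2) &
      lch (f \o swp n l.1 l.2) ls' g]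
  else f = g.

Lemma lch_cat f ls ls' g : lch f (ls ++ ls') g <-> exists2 h, lch f ls h & lch h ls' g.
Proof.
elim: ls f => [|l ls IH] f /=; first by split=> [h|[h ->]] //; exists f.
split=> [[h1 h2 h3 h4 /IH[h h5 h6]]|[h [h1 h2 h3 h4 h5] h6]]; first by exists h.
by split=> //; apply/IH; exists h.
Qed.

Lemma lch_rcons f ls l g : lch f (rcons ls l) g <-> exists h, [/\ lch f ls h,
  norm_label l, bnd h, bcov h l.1 l.2 & bnd (h \o swp n l.1 l.2) /\ h \o swp n l.1 l.2 = g].
Proof.
rewrite -cats1 lch_cat /=; split=> [[h h0 [h1 h2 h3 h4 h5]]|[h [h0 h1 h2 h3 [h4 h5]]]].
  by exists h.
by exists h.
Qed.

Lemma swp_win (p q i : int) : 0 <= p < n%:Z -> 0 <= q < n%:Z -> 0 <= i < n%:Z ->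
  i != p -> i != q -> swp n p q i = i.
Proof.
by move=> hp hq hi h1 h2; apply: swp_id; apply/negP => /cong_near; lia.
Qed.

(** * Chains inside the window *)

Lemma fin_fix f ls g (i : int) : lch f ls g -> all inwin ls ->
  all (fun l => i < l.1) ls -> 0 <= i -> g i = f i.
Proof.
elim: ls f => [|[p q] ls IH] f /=; first by move=> ->.
move=> [/andP[/= hp hq] _ _ _ h] /andP[hq' hw] /andP[hi hs] h0.
rewrite (IH _ h hw hs h0) /=; congr f; apply: swp_win; rewrite /inwin /= in hq'; lia.
Qed.

Lemma fin_raise f ls g (i : int) : lch f ls g -> all inwin ls ->
  all (fun l => i <= l.1) ls -> 0 <= i -> f i <= g i.
Proof.
elim: ls f => [|[p q] ls IH] f /=; first by move=> ->.
move=> [/andP[/= hp hq] _ [_ _ lf _] _ h] /andP[hq' hw] /andP[hi hs] h0.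
rewrite /inwin /= in hq'.
apply: le_trans (IH _ h hw hs h0); rewrite /=.
have [->|hne] := eqVneq i p; first by rewrite swpL ltW.
by rewrite swp_win //; lia.
Qed.

Lemma sorted_lablt_fst l ls : sorted lablt (l :: ls) -> all inwin (l :: ls) ->
  all (fun l' => l.1 <= l'.1) ls.
Proof.
move=> /= hp /andP[hl hw]; have := order_path_min lablt_trans hp.
move=> /allP h; apply/allP => l' hl'; have := h l' hl'; have := allP hw l' hl'.
by rewrite /label_lt hl => ->; lia.
Qed.

(** While p is being raised to its final value, no position l between p and the
    next partner q may hold a value that p has to pass. *)
Lemma fin_first f (p q : int) ls g (l : int) : lch f ((p, q) :: ls) g -> sorted lablt ((p, q) :: ls) ->
  all inwin ((p, q) :: ls) -> p < l -> l < q -> ~~ (f p < f l <= g p).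
Proof.
elim: ls f q => [|[p2 q2] ls IH] f q /=.
  move=> [_ hf [_ _ lf hn] _ <-] _ _ hpl hlq /=; rewrite swpL.
  have := hn l hpl hlq; have : f l != f q by apply/eqP => /(bnd_inj hf); lia.
  by lia.
move=> [/andP[/= hp hq] hf [_ _ lf hn] hb hch] /andP[hlt hs] /andP[hq' hw] hpl hlq.
have := hn l hpl hlq; have : f l != f q by apply/eqP => /(bnd_inj hf); lia.
rewrite /inwin /= in hq'; have hw2 := hw; move/andP: hw2 => [hq2 _].
rewrite /inwin /= in hq2.
have [e|hne] := eqVneq p2 p.
  subst p2; have hq2' : q < q2 by move: hlt; rewrite /label_lt /inwin /= hq' hq2; lia.
  have := IH _ q2 hch hs hw hpl _; rewrite /= swpL.
  by rewrite swp_win //; lia.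
have hlt' : p < p2 by move: hlt; rewrite /label_lt /inwin /= hq' hq2; lia.
have -> : g p = f q.
  rewrite (@fin_fix _ ((p2, q2) :: ls) _ p hch hw) /= ?swpL //; last by lia.
  have := @sorted_lablt_fst (p2, q2) ls hs hw => /allP h.
  by rewrite hlt' /=; apply/allP => l' /h /=; lia.
by lia.
Qed.

(** The first label (p, q) is determined: p is the first position at which f and
    g differ, and two possible partners would contradict [fin_first]. *)
Lemma fin_unique f ls ls' g : lch f ls g -> lch f ls' g -> sorted lablt ls ->
  sorted lablt ls' -> all inwin ls -> all inwin ls' -> ls = ls'.
Proof.
have first_lt h p q l g' : lch h ((p, q) :: l) g' -> sorted lablt ((p, q) :: l) ->
    all inwin ((p, q) :: l) -> [/\ 0 <= p, h p < h q & h q <= g' p].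
  move=> hch hs hw; have := sorted_lablt_fst hs hw => hfst.
  move: hch hw => /= [/andP[/= hp hq] _ [_ _ lf _] _ hch] /andP[_ hw]; split=> //; first by lia.
  by have := fin_raise (i := p) hch hw hfst; rewrite /= swpL; apply; lia.
elim: ls f ls' => [|[p q] ls IH] f [|[p' q'] ls'] h h' hs hs' hw hw' //.
- move: h => /= e; subst g; have [_ h1 h2] := first_lt _ _ _ _ _ h' hs' hw'; lia.
- move: h' => /= e; subst g; have [_ h1 h2] := first_lt _ _ _ _ _ h hs hw; lia.
have [p0 h1 h2] := first_lt _ _ _ _ _ h hs hw.
have [p0' h1' h2'] := first_lt _ _ _ _ _ h' hs' hw'.
have fixlt a b a' b' l l' : lch f ((a, b) :: l') g -> sorted lablt ((a, b) :: l') ->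
    all inwin ((a, b) :: l') -> 0 <= a' -> f a' < f b' -> f b' <= g a' ->
    lch f ((a', b') :: l) g -> a <= a'.
  move=> hch hss hww ha' e1 e2 _; rewrite leNgt; apply/negP => hlt.
  have := fin_fix (i := a') hch hww _ ha'; rewrite /= hlt /=.
  have -> : all (fun l0 => a' < l0.1) l'.
    have /allP H := sorted_lablt_fst hss hww; apply/allP => y /H /=; lia.
  by move=> /(_ isT); lia.
have ep : p = p'.
  have := fixlt _ _ _ _ _ _ h hs hw p0' h1' h2' h'.
  by have := fixlt _ _ _ _ _ _ h' hs' hw' p0 h1 h2 h; lia.
subst p'.
have [[/andP[/= a1 a2] _ _ _ hch] [/andP[/= b1 b2] _ _ _ hch']] := (h, h').
have eq : q = q'.
  case: (ltgtP q q') => // hq.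
    by have := fin_first (l := q) h' hs' hw'; lia.
  by have := fin_first (l := q') h hs hw; lia.
subst q'; congr (_ :: _).
move: hw hw' => /= /andP[_ hw] /andP[_ hw'].
by apply: IH hch hch' (path_sorted hs) (path_sorted hs') hw hw'.
Qed.

(** * Chains around the end of the window *)

Definition wrapl (l : int * int) := ~~ inwin l.

(** Boundedness forces the earlier position p to be high and q - n to be low; in
    the window, p receives the value at q - n increased by n. *)
Lemma wrap_step f (p q : int) : norm_label (p, q) -> wrapl (p, q) -> bnd f -> bcov f p q ->
  bnd (f \o swp n p q) -> let g := f \o swp n p q in
  [/\ 0 <= q - n%:Z < p, q <= f p, f (q - n%:Z) <= p,
      g p = f (q - n%:Z) + n%:Z /\ g (q - n%:Z) = f p - n%:Z &
      forall i, 0 <= i < n%:Z -> i != p -> i != q - n%:Z -> g i = f i].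
Proof.
rewrite /normal_label /wrapl /inwin /= => /andP[hp hq] hw hf [_ _ lf hn] hg.
have pf := bnd_per hf.
have c : ~~ cong n p q by apply: not_cong_near; lia.
have e : f q = f (q - n%:Z) + n%:Z by rewrite -pf subrK.
have g1 : f q <= p + n%:Z by have := bnd_le p hg; rewrite /= swpL.
have g2 : q <= f p by have := bnd_ge q hg; rewrite /= swpR.
split=> //; try by lia.
  split; first by rewrite swpL.
  rewrite swpRc //; last by apply/congP; exists (-1); lia.
  have -> : q - n%:Z - (q - p) = p - n%:Z by lia.
  by have := pf (p - n%:Z); rewrite subrK => ->; lia.
move=> i hi h1 h2; rewrite swp_id //; apply/negP; first by move=> /cong_near; lia.
move=> h; have h' : cong n i (q - n%:Z).
  by apply: cong_trans h _; apply/congP; exists 1; lia.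
by have := cong_near h'; lia.
Qed.

Definition highat (f : int -> int) (i : int) := n%:Z <= f i.

Lemma wrap_high f ls g (i : int) : lch f ls g -> all wrapl ls -> 0 <= i < n%:Z ->
  highat g i = highat f i.
Proof.
elim: ls f => [|[p q] ls IH] f /=; first by move=> ->.
move=> [hn hf hc hb hch] /andP[hl hw] hi; rewrite (IH _ hch hw hi) /highat.
have [/= h1 h2 h3 [h4 h5] h6] := wrap_step hn hl hf hc hb.
rewrite /normal_label /= in hn; rewrite /wrapl /inwin /= in hl.
have [e|hne] := eqVneq i p; first by subst i; have := bnd_ge (q - n%:Z) hf; lia.
have [e|hne'] := eqVneq i (q - n%:Z); last by rewrite h6.
by subst i; have := bnd_le p hf; lia.
Qed.

Lemma wrap_raise f ls g (i : int) : lch f ls g -> all wrapl ls -> 0 <= i < n%:Z ->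
  highat f i -> f i <= g i /\ (all (fun l => l.1 != i) ls -> g i = f i).
Proof.
elim: ls f => [|[p q] ls IH] f /=; first by move=> ->.
move=> [hn hf hc hb hch] /andP[hl hw] hi hh.
have hh' : highat (f \o swp n p q) i.
  by rewrite (@wrap_high f [:: (p, q)] (f \o swp n p q) i) /= ?hl.
have [IH1 IH2] := IH _ hch hw hi hh'.
have [/= h1 h2 h3 [h4 h5] h6] := wrap_step hn hl hf hc hb.
rewrite /normal_label /= in hn; rewrite /wrapl /inwin /= in hl.
have hq : i != q - n%:Z by apply/eqP => e; subst i; move: hh; rewrite /highat; lia.
split.
  apply: le_trans IH1; rewrite /=; have [e|hne] := eqVneq i p; last by rewrite h6.
  by subst i; case: hc => _ _ lf _; rewrite swpL ltW.
by move=> /andP[hne ha]; rewrite IH2 //= h6 // eq_sym.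
Qed.

Lemma wrap_last_fst ls l : sorted lablt (rcons ls l) -> all wrapl (rcons ls l) ->
  all (fun l' => l'.1 <= l.1) (rcons ls l).
Proof.
rewrite !all_rcons lexx /=; elim: ls => [|a ls IH] //= hp /andP[hl /andP[ha hw]].
rewrite IH ?hl ?hw //; last exact: path_sorted hp.
rewrite andbT; have /allP := order_path_min lablt_trans hp.
move=> /(_ l); rewrite mem_rcons inE eqxx => /(_ isT).
by move: hl ha; rewrite /label_lt /wrapl => /negbTE-> /negbTE->; lia.
Qed.

Lemma sorted_rcons_l ls (l : int * int) : sorted lablt (rcons ls l) -> sorted lablt ls.
Proof. by case: ls => //= a ls; rewrite rcons_path => /andP[]. Qed.

(** Position p reaches its final value before the later high position p2 moves,
    so p never passes the initial value at p2. *)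
Lemma wrap_high_gap f ls g (p p2 : int) : lch f ls g -> sorted lablt ls -> all wrapl ls ->
  0 <= p -> p < p2 -> p2 < n%:Z -> highat f p -> highat f p2 -> bnd f ->
  ~~ (f p <= f p2 <= g p).
Proof.
move=> + + + hp0 hpp hp2 hh hh2 hf.
elim/last_ind: ls g => [|ls [a b] IH] g.
  move=> /= <- _ _; have : f p != f p2 by apply/eqP => /(bnd_inj hf); lia.
  by lia.
move=> /lch_rcons[h [/= hch hn hb hc [hb' eg]]] hs hw.
have hs' := sorted_rcons_l hs; have := hw; rewrite all_rcons => /andP[hl hw'].
have IH' := IH h hch hs' hw'.
have [/= h1 h2 h3 [h4 h5] h6] := wrap_step hn hl hb hc hb'.
have hhp : highat h p by rewrite (wrap_high hch) //; lia.
have hhp2 : highat h p2 by rewrite (wrap_high hch) //; lia.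
rewrite /normal_label /= in hn; rewrite /wrapl /inwin /= in hl.
have hpb : p != b - n%:Z by apply/eqP => e; move: hhp; rewrite /highat e; lia.
rewrite -eg; have [e|hne] := eqVneq p a; last first.
  by rewrite /= h6 //; lia.
subst a.
have e2 : h p2 = f p2.
  have [_ hfix] := wrap_raise hch hw' (i := p2) (ltac:(lia)) hh2; apply: hfix.
  have := wrap_last_fst hs hw; rewrite all_rcons => /andP[_ /allP hle].
  by apply/allP => l /hle /=; lia.
rewrite -e2 in IH' *; case: hc => hpb' hbp lf hni; rewrite /= swpL.
have := hni p2 hpp; have : h p2 != h b by apply/eqP => /(bnd_inj hb); lia.
have : h p2 != h p by apply/eqP => /(bnd_inj hb); lia.
by lia.
Qed.

(** The last partner of p is the leftmost low position whose value p passes. *)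
Lemma wrap_last f ls (p q : int) g (l : int) : lch f (rcons ls (p, q)) g -> sorted lablt (rcons ls (p, q)) ->
  all wrapl (rcons ls (p, q)) -> 0 <= l -> l + n%:Z < q -> ~~ highat g l ->
  highat f p -> ~~ (f p <= g l + n%:Z < g p).
Proof.
elim/last_ind: ls q g => [|ls [a b] IH] q g.
  move=> /= [hn hf hc hb <-] _ /andP[hl _] hl0 hlq hlow hh.
  have [/= h1 h2 h3 [h4 h5] h6] := wrap_step hn hl hf hc hb.
  have hlp : l != p by apply/eqP => e; subst l; move: hn; rewrite /normal_label /=; lia.
  rewrite /normal_label /= in hn.
  rewrite h6 ?swpL //; [|by lia|by lia].
  have pf := bnd_per hf; rewrite -pf.
  case: hc => _ _ lf hni; have := hni (l + n%:Z).
  have : f (l + n%:Z) != f p by apply/eqP => /(bnd_inj hf); lia.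
  by lia.
move=> /lch_rcons[h [/= hch hn hb hc [hb' eg]]] hs hw hl0 hlq hlow hh.
have hs' := sorted_rcons_l hs; have := hw; rewrite all_rcons => /andP[hl hw'].
have [/= h1 h2 h3 [h4 h5] h6] := wrap_step hn hl hb hc hb'.
rewrite /normal_label /= in hn; rewrite /wrapl /inwin /= in hl.
have hlp : l != p by apply/eqP => e; subst l; lia.
have egl : g l = h l by rewrite -eg /= h6 //; lia.
have eab := wrap_last_fst hs hw; rewrite !all_rcons /= in eab; case/and3P: eab => _ hap hall.
have hph : f p <= h p -> ~~ (f p <= h l + n%:Z < h p) -> ~~ (f p <= g l + n%:Z < g p).
  move=> e1 e2; rewrite egl -eg /= swpL; have pf := bnd_per hb; rewrite -pf in e2 *.
  case: hc => _ _ lf hni; have := hni (l + n%:Z).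
  have : h (l + n%:Z) != h p by apply/eqP => /(bnd_inj hb); lia.
  by lia.
have hin : 0 <= p < n%:Z by lia.
have [hr hfix] := wrap_raise hch hw' hin hh.
apply: hph => //; have [e|hne] := eqVneq a p.
  subst a; apply: (IH b h) => //; last by rewrite /highat -egl.
  have hwb : wrapl (p, b) by move: hw'; rewrite all_rcons => /andP[].
  have : lablt (p, b) (p, q).
    by move: hs; rewrite -!cats1 -catA; case: (ls) => [|x s] /=;
      rewrite ?andbT // cat_path /= => /andP[_ /and3P[]].
  by rewrite /label_lt (negbTE hwb) /inwin /=; lia.
rewrite hfix; first by lia.
rewrite all_rcons /= hne /=.
have hs2 := sorted_rcons_l hs.
have := wrap_last_fst hs2 hw'; rewrite all_rcons /= => /andP[_ /allP hle].
by apply/allP => x /hle /=; lia.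
Qed.

(** Read from the end: p of the last label is the last high position at which f
    and g differ, and two possible partners would contradict [wrap_last].  The
    hypothesis on high positions is needed because g does not determine f. *)
Lemma wrap_unique f f' ls ls' g : lch f ls g -> lch f' ls' g -> sorted lablt ls ->
  sorted lablt ls' -> all wrapl ls -> all wrapl ls' ->
  (forall i, 0 <= i < n%:Z -> highat g i -> f i = f' i) -> f = f' /\ ls = ls'.
Proof.
have last_lt h p q l g' : lch h (rcons l (p, q)) g' -> all wrapl (rcons l (p, q)) ->
    [/\ 0 <= p < n%:Z, highat g' p, h p < g' p & 0 <= q - n%:Z < p /\
      (h p <= g' (q - n%:Z) + n%:Z < g' p) /\ ~~ highat g' (q - n%:Z)].
  move=> /lch_rcons[h0 [/= hch hn hb hc [hb' eg]]]; rewrite all_rcons => /andP[hl hw].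
  have [/= h1 h2 h3 [h4 h5] h6] := wrap_step hn hl hb hc hb'.
  rewrite /normal_label /= in hn; rewrite /wrapl /inwin /= in hl.
  have hh0 : highat h0 p by rewrite /highat; lia.
  have hin : 0 <= p < n%:Z by lia.
  have hh : highat h p by rewrite -(wrap_high hch hw hin).
  have [hr _] := wrap_raise hch hw hin hh.
  case: hc => _ _ lf _; have e1 : g' p = h0 q by rewrite -eg /= swpL.
  have e2 : g' (q - n%:Z) = h0 p - n%:Z by rewrite -eg.
  split=> //; first by rewrite /highat e1; move: hh0; rewrite /highat; lia.
    by rewrite e1; lia.
  split=> //; split; first by rewrite e1 e2; lia.
  by rewrite /highat e2; have := bnd_le p hb; lia.
elim/last_ind: ls g ls' => [|ls [p q] IH] g ls'; case/lastP: ls' => [|ls' [p' q']] h h' hs hs' hw hw' he.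
- by split=> //; move: h h' => /= -> ->.
- have [h1 h2 h3 _] := last_lt _ _ _ _ _ h' hw'; move: h => /= e; subst g.
  by have := he _ h1 h2; lia.
- have [h1 h2 h3 _] := last_lt _ _ _ _ _ h hw; move: h' => /= e; subst g.
  by have := he _ h1 h2; lia.
have [a1 a2 a3 [a4 [a5 a6]]] := last_lt _ _ _ _ _ h hw.
have [b1 b2 b3 [b4 [b5 b6]]] := last_lt _ _ _ _ _ h' hw'.
have fixgt h0 l a b i : lch h0 (rcons l (a, b)) g -> sorted lablt (rcons l (a, b)) ->
    all wrapl (rcons l (a, b)) -> 0 <= i < n%:Z -> highat g i -> a < i -> g i = h0 i.
  move=> hch hss hww hi hgi hai.
  have hh : highat h0 i by rewrite -(wrap_high hch hww hi).
  have [_ hfix] := wrap_raise hch hww hi hh; apply: hfix.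
  have /allP hle := wrap_last_fst hss hww; apply/allP => x /hle /= hx.
  by rewrite lt_eqF // (le_lt_trans hx).
have ep : p = p'.
  case: (ltgtP p p') => // hpp.
    by have := fixgt _ _ _ _ _ h hs hw b1 b2 hpp; have := he _ b1 b2; lia.
  by have := fixgt _ _ _ _ _ h' hs' hw' a1 a2 hpp; have := he _ a1 a2; lia.
subst p'.
have hfp : highat f p by rewrite -(wrap_high h hw a1).
have hfp' : highat f' p by rewrite -(wrap_high h' hw' a1).
have efp := he _ a1 a2.
have eq : q = q'.
  case: (ltgtP q q') => // hq.
    have := wrap_last (l := q - n%:Z) h' hs' hw' _ _ a6 hfp'; rewrite subrK -efp.
    by lia.
  have := wrap_last (l := q' - n%:Z) h hs hw _ _ b6 hfp; rewrite subrK efp.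
  by lia.
subst q'.
move: h h' => /lch_rcons[h0 [/= hch hn hb hc [hb' eg]]] /lch_rcons[h0' [/= hch' _ hb0 _ [_ eg']]].
have cpq := bcov_ncong hc.
have e0 : h0' = h0 by rewrite -(swpKf h0 cpq) eg -eg' swpKf.
subst h0'.
have := hw; rewrite all_rcons => /andP[hl hw1].
have := hw'; rewrite all_rcons => /andP[_ hw1'].
have [] := IH h0 ls' hch hch' (sorted_rcons_l hs) (sorted_rcons_l hs') hw1 hw1'.
  move=> i hi hh; apply: he => //.
  rewrite -eg (@wrap_high h0 [:: (p, q)]) //=; last by rewrite hl.
by move=> -> ->.
Qed.

(** * Uniqueness of the increasing chain *)

Definition winval (f : int -> int) (v : int) := exists2 i, 0 <= i < n%:Z & f i = v.

Lemma fin_winval f ls g v : lch f ls g -> all inwin ls -> winval f v <-> winval g v.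
Proof.
elim: ls f => [|[p q] ls IH] f /=; first by move=> ->.
move=> [/andP[/= hp hq] _ hc _ hch] /andP[hl hw]; rewrite -(IH _ hch hw).
have c := bcov_ncong hc; rewrite /inwin /= in hl.
have hst i : 0 <= i < n%:Z -> 0 <= swp n p q i < n%:Z.
  move=> hi; have [e|h1] := eqVneq i p; first by rewrite e swpL; lia.
  have [e|h2] := eqVneq i q; first by rewrite e swpR.
  by rewrite swp_win //; lia.
split=> -[i hi <-]; exists (swp n p q i); rewrite /= ?swpK //; exact: hst.
Qed.

Lemma sorted_split ls : sorted lablt ls ->
  exists l1 l2, [/\ ls = l1 ++ l2, all inwin l1, all wrapl l2, sorted lablt l1 & sorted lablt l2].
Proof.
elim: ls => [|l ls IH] hs; first by exists [::], [::].
have [hl|hl] := boolP (inwin l); last first.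
  exists [::], (l :: ls); split=> //=; apply/andP; split => //.
  have /allP h := order_path_min lablt_trans hs; apply/allP => x /h.
  by rewrite /label_lt (negbTE hl) => /andP[].
have [l1 [l2 [e h1 h2 h3 h4]]] := IH (path_sorted hs).
exists (l :: l1), l2; split=> //=; [by rewrite e|by rewrite hl|].
by move: hs; rewrite e /= cat_path => /andP[].
Qed.

Lemma lch_bnd f ls g : lch f ls g -> bnd f -> bnd g.
Proof. by elim: ls f => [|l ls IH] f /=; [move=> ->|move=> [_ _ _ hb hch] _; apply: IH hch hb]. Qed.

(** A chain with increasing labels first permutes the window, which fixes the
    set of values of the window, and then wraps, which fixes the set of high
    positions.  The middle element m is therefore determined: for high p in
    increasing order, m p is the largest remaining high value that is at most
    g p, by [wrap_high_gap]. *)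
Theorem increasing_unique f ls ls' g : bnd f -> lch f ls g -> lch f ls' g ->
  sorted lablt ls -> sorted lablt ls' -> ls = ls'.
Proof.
move=> hf h h' /sorted_split[l1 [l2 [e hw1 hw2 hs1 hs2]]].
move=> /sorted_split[l1' [l2' [e' hw1' hw2' hs1' hs2']]].
move: h h'; rewrite e e' => /lch_cat[m h1 h2] /lch_cat[m' h1' h2'].
have hm := lch_bnd h1 hf; have hm' := lch_bnd h1' hf.
suff he r : 0 <= r < n%:Z -> highat g r -> m r = m' r.
  have [em el] := wrap_unique h2 h2' hs2 hs2' hw2 hw2' he.
  by subst m' l2'; rewrite (fin_unique h1 h1' hs1 hs1' hw1 hw1').
(* at the first high position where they differ, neither middle element is the smaller *)
have lower a a' la la' i : lch a la g -> lch a' la' g -> sorted lablt la -> all wrapl la ->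
    all wrapl la' -> bnd a -> (forall v, winval a v <-> winval a' v) -> 
    0 <= i < n%:Z -> highat g i ->
    (forall j, 0 <= j < i -> highat g j -> a j = a' j) -> injective a' -> ~~ (a i < a' i).
  move=> ha ha' hsa hwa hwa' hb hv hi hh hIH inj'; apply/negP => hlt.
  have hai : highat a i by rewrite -(wrap_high ha hwa).
  have ha'i : highat a' i by rewrite -(wrap_high ha' hwa').
  have [h3 _] := wrap_raise ha' hwa' hi ha'i.
  have [j hj ej] : winval a (a' i) by apply/hv; exists i.
  have haj : highat a j by rewrite /highat ej.
  have hgj : highat g j by rewrite (wrap_high ha hwa).
  have /andP[hi0 _] := hi; have /andP[hj0 hjn] := hj.
  case: (ltgtP i j) => hij.
  - have := wrap_high_gap ha hsa hwa hi0 hij hjn hai haj hb.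
    by rewrite ej (ltW hlt) h3.
  - have ea : a' j = a' i by rewrite -hIH // hj0.
    by rewrite (inj' _ _ ea) ltxx in hij.
  - by subst j; rewrite ej ltxx in hlt.
have hv v : winval m v <-> winval m' v.
  by rewrite -(fin_winval v h1 hw1) -(fin_winval v h1' hw1').
have hv' v : winval m' v <-> winval m v by rewrite hv.
have [d] := ubnP (absz r); elim: d r => // d IH i hd hi hh.
have IH1 j : 0 <= j < i -> highat g j -> m j = m' j by move=> hj; apply: IH; lia.
have := lower m m' l2 l2' i h2 h2' hs2 hw2 hw2' hm hv hi hh IH1 (bnd_inj hm').
have := lower m' m l2' l2 i h2' h2 hs2' hw2' hw2 hm' hv' hi hh _ (bnd_inj hm).
move=> h3; rewrite -leNgt => h4; apply/eqP; rewrite eq_le h4 andbT leNgt.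
by apply: h3 => j hj hgj; rewrite IH1.
Qed.

End Covers.

(** * Exchanging two successive covers *)

Section Diamond.
Local Open Scope ring_scope.

Variables (k n : nat).
Hypothesis n_gt0 : (0 < n)%N.
Hypothesis hkn : (k <= n)%N.

Local Notation bnd := (bounded_perm k n).
Local Notation upath := (upath n).
Local Notation brank := (@brank k n).
Local Notation bcov := (bcov n).
Local Notation lablt := (label_lt n).
Local Notation norm_label := (normal_label n).

(** An exchange that skips a value is a composite of several raising steps, so it
    raises the rank by more than one. *)
Lemma rank_bcov f (p q : int) : bnd f -> bnd (f \o swp n p q) -> p < q -> q < p + n%:Z ->
  f p < f q -> brank (f \o swp n p q) <= brank f + 1 -> bcov f p q.
Proof.
move=> hf hg h1 h2 h3 hr; split=> // m hpm hmq; apply/negP => /andP[f1 f2].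
have c1 : ~~ cong n p m by apply: not_cong_near; lia.
have c2 : ~~ cong n p q by apply: not_cong_near; lia.
have c3 : ~~ cong n m q by apply: not_cong_near; lia.
have hqid : swp n p m q = q by apply: swp_id; rewrite cong_sym.
have hpid : swp n m q p = p by apply: swp_id.
have hp : upath (f \o swp n p m) (f \o swp n p q).
  rewrite -(swp3 c1 c2 c3).
  apply: (@rt_trans _ _ _ ((f \o swp n p m) \o swp n m q)).
    by apply: upath_ustep; rewrite /= ?swpR ?hqid //; lia.
  apply: (@upath_ustep _ ((f \o swp n p m) \o swp n m q)); rewrite /= ?hpid ?swpL ?hqid //; lia.
have hb : bnd (f \o swp n p m).
  by apply: (upath_bnd n_gt0 hp) => //; apply: avg_swp => //; exact: hf.1.
have hp1 : upath f (f \o swp n p m) by apply: upath_ustep => //; lia.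
have [e|r1] := upath_brank n_gt0 hkn hf hb hp1.
  by have := congr1 (fun h => h p) e => /=; rewrite swpL; lia.
have [e|r2] := upath_brank n_gt0 hkn hb hg hp.
  by have := congr1 (fun h => h p) e => /=; rewrite !swpL; lia.
by lia.
Qed.

(** Normalization of a label that is at most one period away from the window. *)
Definition nlab (a b : int) : int * int :=
  if a < 0 then (a + n%:Z, b + n%:Z) else if n%:Z <= a then (a - n%:Z, b - n%:Z) else (a, b).

Lemma nlab_id l : norm_label l -> nlab l.1 l.2 = l.
Proof.
case: l => p q; rewrite /normal_label /nlab /= => h.
by case: ifP => [|_]; [lia|case: ifP => //; lia].
Qed.

Lemma nlab_norm (a b : int) : - n%:Z <= a < 2%:Z * n%:Z -> a < b -> b < a + n%:Z ->
  norm_label (nlab a b).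
Proof.
by rewrite /normal_label /nlab => h1 h2 h3; case: ifP => ? /=; [|case: ifP => ? /=]; lia.
Qed.

Lemma nlab_shift (a b : int) : exists j : int, (nlab a b).1 = a + j * n%:Z /\ (nlab a b).2 = b + j * n%:Z.
Proof.
rewrite /nlab; case: ifP => _ /=; first by exists 1; lia.
by case: ifP => _ /=; [exists (-1)|exists 0]; lia.
Qed.

Lemma nlab_swp (a b : int) : swp n (nlab a b).1 (nlab a b).2 = swp n a b.
Proof. by have [j [-> ->]] := nlab_shift a b; apply: swp_shift. Qed.

Lemma bcov_shift f (a b j : int) : bnd f -> bcov f a b -> bcov f (a + j * n%:Z) (b + j * n%:Z).
Proof.
move=> hf [h1 h2 h3 h4]; have pf := periodicM (bnd_per hf).
split; rewrite ?pf; try lia.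
move=> m hm1 hm2; have := h4 (m - j * n%:Z).
have := pf (m - j * n%:Z) j; rewrite subrK => ->; rewrite !pf; lia.
Qed.

Lemma nlab_bcov f (a b : int) : bnd f -> bcov f a b -> bcov f (nlab a b).1 (nlab a b).2.
Proof. by have [j [-> ->]] := nlab_shift a b; apply: bcov_shift. Qed.

(** The order of labels is a reflection order: among the three exchanges of
    three positions, the one of the outer two lies between the others. *)
Lemma nlab_between (p1 p2 p3 : int) : - n%:Z <= p1 < n%:Z -> p1 < p2 -> p2 < p3 ->
  p3 < p1 + n%:Z ->
  lablt (nlab p1 p2) (nlab p1 p3) && lablt (nlab p1 p3) (nlab p2 p3) ||
  lablt (nlab p2 p3) (nlab p1 p3) && lablt (nlab p1 p3) (nlab p1 p2).
Proof.
move=> h1 h2 h3 h4; rewrite /nlab.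
by case: (ltP p1 0) => ?; case: (ltP p2 0) => ?; case: (leP n%:Z p1) => ?;
  case: (leP n%:Z p2) => ?; rewrite /label_lt /inwin /=;
  case: (ltP p2 n%:Z) => ?; case: (ltP p3 n%:Z) => ?;
  rewrite ?ltrDl ?ltrD2r; try lia;
  case: (ltP (p3 + n%:Z) n%:Z) => ?; case: (ltP (p2 + n%:Z) n%:Z) => ?;
  case: (ltP (p3 - n%:Z) n%:Z) => ?; lia.
Qed.

Lemma lablt_total l l' : l <> l' -> lablt l l' || lablt l' l.
Proof.
case: l l' => [p q] [p' q'] hne; have : (p != p') || (q != q').
  by rewrite -negb_and; apply/negP => /andP[/eqP e /eqP e']; apply: hne; rewrite e e'.
by rewrite /label_lt /inwin /=; case: (ltP q n%:Z) => ?; case: (ltP q' n%:Z) => ? /=; lia.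
Qed.

Definition diamond_alt f z l l' : Prop := exists r r',
  [/\ norm_label r, norm_label r', bcov f r.1 r.2, bnd (f \o swp n r.1 r.2) &
   [/\ bcov (f \o swp n r.1 r.2) r'.1 r'.2, (f \o swp n r.1 r.2) \o swp n r'.1 r'.2 = z,
       lablt r l & lablt l' r']].

(** Both steps are covers because the rank rises by two in total. *)
Lemma diamond_finish f z (a b c d : int) l l' : bnd f -> bnd z ->
  - n%:Z <= a < 2%:Z * n%:Z -> - n%:Z <= c < 2%:Z * n%:Z ->
  a < b -> b < a + n%:Z -> c < d -> d < c + n%:Z ->
  f a < f b -> (f \o swp n a b) c < (f \o swp n a b) d ->
  (f \o swp n a b) \o swp n c d = z -> brank z = brank f + 2%:Z ->
  lablt (nlab a b) l -> lablt l' (nlab c d) -> diamond_alt f z l l'.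
Proof.
move=> hf hz ha hc ab1 ab2 cd1 cd2 fab fcd ez hr hl hl'.
have p1 : upath f (f \o swp n a b) by apply: upath_ustep.
have p2 : upath (f \o swp n a b) z by rewrite -ez; apply: upath_ustep.
have hb : bnd (f \o swp n a b).
  by apply: (upath_bnd n_gt0 p2) => //; apply: avg_swp => //;
    [exact: hf.1|apply: not_cong_near].
have [e|r1] := upath_brank n_gt0 hkn hf hb p1.
  by have := congr1 (fun h => h a) e => /=; rewrite swpL; lia.
have [e|r2] := upath_brank n_gt0 hkn hb hz p2.
  by have := congr1 (fun h => h c) e; rewrite -ez /= swpL /=; move: fcd => /=; lia.
have c1 : bcov f a b by apply: rank_bcov => //; lia.
have c2 : bcov (f \o swp n a b) c d by apply: rank_bcov => //; rewrite ?ez //; lia.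
exists (nlab a b), (nlab c d); rewrite !nlab_swp; split.
- exact: nlab_norm.
- exact: nlab_norm.
- exact: nlab_bcov.
- by [].
- by split=> //; apply: nlab_bcov.
Qed.

(** If the two exchanges share no position they commute.  Otherwise they move
    three positions, and [nlab_between] shows which of the two other
    factorizations starts with a smaller and ends with a larger label.  When
    one ends where the other starts, boundedness of z excludes that the two
    outer positions are a full period or more apart. *)
Lemma diamond_core f z (p q a b : int) : norm_label (p, q) -> bnd f -> bnd z ->
  (f \o swp n p q) \o swp n a b = z -> f p < f q ->
  - n%:Z <= a < 2%:Z * n%:Z -> a < b -> b < a + n%:Z ->
  (f \o swp n p q) a < (f \o swp n p q) b -> brank z = brank f + 2%:Z ->
  ~~ lablt (p, q) (nlab a b) ->
  [\/ a = p, b = q, a = q | b = p \/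
     [/\ ~~ cong n a p, ~~ cong n a q, ~~ cong n b p & ~~ cong n b q]] ->
  diamond_alt f z (p, q) (nlab a b).
Proof.
move=> hn hf hz ez lf ha ab1 ab2 lf1 hr hnl hcase.
have epq : nlab p q = (p, q) by have := nlab_id hn.
move: (hn); rewrite /normal_label /= => /andP[hp /andP[pq1 pq2]].
have cpq : ~~ cong n p q by apply: not_cong_near.
have cab : ~~ cong n a b by apply: not_cong_near.
have ltr : transitive lablt := lablt_trans n_gt0 hkn.
have far (x y : int) : x < y -> y < x + n%:Z -> ~~ cong n x y /\ ~~ cong n y x.
  by move=> h1 h2; rewrite [cong n y x]cong_sym; split; apply: not_cong_near.
have zr : (f \o swp n a b) \o swp n (swp n a b p) (swp n a b q) = z.
  rewrite -ez; apply/funext => x.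
  exact: (congr1 (fun t : int -> int => f (t x)) (esym (swp_comm_r p q cab))).
have zl : (f \o swp n (swp n p q a) (swp n p q b)) \o swp n p q = z.
  rewrite -ez; apply/funext => x.
  exact: (congr1 (fun t : int -> int => f (t x)) (esym (swp_comm_l a b cpq))).
have pf := bnd_per hf.
have bt (p1 p2 p3 : int) : - n%:Z <= p1 < n%:Z -> p1 < p2 -> p2 < p3 -> p3 < p1 + n%:Z ->
    (~~ lablt (nlab p2 p3) (nlab p1 p3) || ~~ lablt (nlab p1 p3) (nlab p1 p2)
     || ~~ lablt (nlab p2 p3) (nlab p1 p2)) ->
    [/\ lablt (nlab p1 p2) (nlab p1 p3), lablt (nlab p1 p3) (nlab p2 p3) &
        lablt (nlab p1 p2) (nlab p2 p3)].
  move=> h1 h2 h3 h4 h5; case/orP: (nlab_between h1 h2 h3 h4) => /andP[l1 l2].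
    by split=> //; apply: ltr _ _ _ l1 l2.
  by move: h5; rewrite l1 l2 (ltr _ _ _ l1 l2).
have bt' (p1 p2 p3 : int) : - n%:Z <= p1 < n%:Z -> p1 < p2 -> p2 < p3 -> p3 < p1 + n%:Z ->
    (~~ lablt (nlab p1 p2) (nlab p1 p3) || ~~ lablt (nlab p1 p3) (nlab p2 p3)
     || ~~ lablt (nlab p1 p2) (nlab p2 p3)) ->
    [/\ lablt (nlab p2 p3) (nlab p1 p3), lablt (nlab p1 p3) (nlab p1 p2) &
        lablt (nlab p2 p3) (nlab p1 p2)].
  move=> h1 h2 h3 h4 h5; case/orP: (nlab_between h1 h2 h3 h4) => /andP[l1 l2].
    by move: h5; rewrite l1 l2 (ltr _ _ _ l1 l2).
  by split=> //; apply: ltr _ _ _ l1 l2.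
rewrite -epq in hnl *; clear hn epq.
have p_ge : - n%:Z <= p < n%:Z by clear -hp; lia.
have p2 : - n%:Z <= p < 2%:Z * n%:Z by clear -p_ge; lia.
case: hcase => [e|e|e|[e|[c1 c2 c3 c4]]].
- subst a; have hbq : b <> q by move=> e; move: lf1; rewrite e /= swpL swpR // => h; clear -h lf; lia.
  have [cbq cqb] : ~~ cong n b q /\ ~~ cong n q b.
    case: (ltgtP q b) => hqb; last by case: hbq.
      by have [] := far q b hqb _ => //; clear -ab2 hqb pq1; lia.
    by apply: far => //; clear -ab1 pq2; lia.
  have [cpb cbp] := far p b ab1 ab2; have [_ cqp] := far p q pq1 pq2.
  have f1b : swp n p q b = b by apply: swp_id.
  have hb1 : swp n p b q = q by apply: swp_id.
  rewrite /= swpL f1b in lf1; rewrite swpL f1b in zl; rewrite swpL hb1 in zr.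
  case: (ltgtP q b) => hqb; last by case: hbq.
    have [|l1 l2 l3] := bt' p q b p_ge pq1 hqb ab2; first by rewrite hnl ?orbT.
    apply: (diamond_finish hf hz _ _ _ _ _ _ _ _ zl hr) => //.
    + by clear -p_ge pq1 pq2; lia.
    + by clear -ab2 pq1; lia.
    + by rewrite /= swpL swp_id //; exact: lt_trans lf lf1.
  have [|l1 l2 l3] := bt p b q p_ge ab1 hqb pq2; first by rewrite hnl ?orbT.
  apply: (diamond_finish hf hz _ _ _ _ _ _ _ _ zr hr) => //.
  + by clear -p_ge ab1 ab2; lia.
  + by clear -pq2 ab1; lia.
  + by clear -lf lf1; lia.
  + by rewrite /= swpR // hb1.
- subst b; have hap : a <> p by move=> e; move: lf1; rewrite e /= swpL swpR // => h; clear -h lf; lia.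
  have [cqa caq] := far a q ab1 ab2; have [_ cqp] := far p q pq1 pq2.
  have [cap cpa] : ~~ cong n a p /\ ~~ cong n p a.
    case: (ltgtP a p) => hh; last by case: hap.
      by apply: far => //; clear -ab2 pq1; lia.
    by have [] := far p a hh _ => //; clear -ab1 pq2; lia.
  have f1a : swp n p q a = a by apply: swp_id.
  have hp1 : swp n a q p = p by apply: swp_id.
  rewrite /= swpR // f1a in lf1; rewrite swpR // f1a in zl; rewrite swpR // hp1 in zr.
  case: (ltgtP a p) => hh; last by case: hap.
    have [||l1 l2 l3] := bt a p q _ hh pq1 ab2.
    + by clear -ha hh p_ge; lia.
    + by rewrite hnl.
    apply: (diamond_finish hf hz _ _ _ _ _ _ _ _ zl hr) => //.
    + by clear -ab2 pq1; lia.
    + by rewrite /= swpR // swp_id //; clear -lf lf1; lia.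
  have [|l1 l2 l3] := bt' p a q p_ge hh ab1 pq2; first by rewrite hnl ?orbT.
  apply: (diamond_finish hf hz _ _ _ _ _ _ _ _ zr hr) => //.
  + by clear -ab1 pq2; lia.
  + by clear -lf lf1; lia.
  + by rewrite /= hp1 swpL.
- subst a.
  have zb : b <= f p.
    by have := bnd_ge b hz; rewrite -ez /= !swpR.
  have fpn := bnd_le p hf.
  have [bpn|bpn] := eqVneq b (p + n%:Z).
    have := bnd_le q hz; rewrite -ez /= swpL bpn swp_periodic swpL pf => h.
    by clear -h zb bpn lf pq2; lia.
  have bp2 : b < p + n%:Z by clear -bpn zb fpn; lia.
  have pb : p < b by clear -ab1 pq1; lia.
  have [cpb cbp] := far p b pb bp2; have [_ cqp] := far p q pq1 pq2.
  have cbq : ~~ cong n b q by rewrite cong_sym.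
  have f1b : swp n p q b = b by apply: swp_id.
  have hp1 : swp n q b p = p by apply: swp_id.
  rewrite /= swpR // f1b in lf1; rewrite swpR // f1b in zl; rewrite swpL hp1 in zr.
  have hfbq : f q != f b by apply/eqP => /(bnd_inj hf) h; clear -h ab1; lia.
  have [|l1 l2 l3] := bt' p q b p_ge pq1 ab1 bp2; first by rewrite hnl ?orbT.
  case: (ltgtP (f q) (f b)) => hh; last by rewrite hh eqxx in hfbq.
    apply: (diamond_finish hf hz _ _ _ _ _ _ _ _ zr hr) => //.
    by rewrite /= hp1 swpR.
  apply: (diamond_finish hf hz _ _ _ _ _ _ _ _ zl hr) => //.
  by rewrite /= swpL swp_id // cong_sym.
- subst b.
  have za : f q <= a + n%:Z by have := bnd_le a hz; rewrite -ez /= !swpL.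
  have [eqa|qna] := eqVneq q (a + n%:Z).
    have := bnd_ge p hz; rewrite -ez /= swpR //.
    have -> : a = q - n%:Z by rewrite eqa addrK.
    have := @swp_periodic n p q (q - n%:Z); rewrite subrK swpR // => e1.
    have := pf (swp n p q (q - n%:Z)); rewrite -e1 => e2 e3.
    by clear -e2 e3 za lf eqa pq2; lia.
  have [cap cpa] := far a p ab1 ab2; have [_ cqp] := far p q pq1 pq2.
  have cqa : ~~ cong n q a.
    apply/negP => h; have h' : cong n q (a + n%:Z).
      by apply: cong_trans h _; rewrite cong_sym cong_add.
    have e := cong_near h'; move/eqP: qna; apply; apply: e; clear -ab2 pq2 ab1 pq1; lia.
  have caq : ~~ cong n a q by rewrite cong_sym.
  have hq1 : swp n a p q = q by apply: swp_id.
  have f1a : swp n p q a = a by apply: swp_id.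
  have zq : q <= f p by have := bnd_ge q hz; rewrite -ez /= hq1 swpR.
  rewrite /= swpL f1a in lf1; rewrite swpL f1a in zl; rewrite swpR // hq1 in zr.
  have qa : q < a + n%:Z by clear -zq lf za; lia.
  have aq : a < q by clear -ab1 pq1; lia.
  have hfap : f a != f p by apply/eqP => /(bnd_inj hf) h; clear -h ab1; lia.
  have [||l1 l2 l3] := bt a p q _ ab1 pq1 qa.
  + by clear -ha ab1 p_ge; lia.
  + by rewrite hnl ?orbT.
  case: (ltgtP (f a) (f p)) => hh; last by rewrite hh eqxx in hfap.
    apply: (diamond_finish hf hz _ _ _ _ _ _ _ _ zr hr) => //.
    by rewrite /= swpL hq1.
  apply: (diamond_finish hf hz _ _ _ _ _ _ _ _ zl hr) => //.
  by rewrite /= swpR // swp_id // cong_sym.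
have ep : swp n a b p = p by apply: swp_id; rewrite cong_sym.
have eq : swp n a b q = q by apply: swp_id; rewrite cong_sym.
have ea : swp n p q a = a by apply: swp_id.
have eb : swp n p q b = b by apply: swp_id.
rewrite ep eq in zr; rewrite /= ea eb in lf1.
have hl : lablt (nlab a b) (nlab p q).
  have /lablt_total : nlab a b <> nlab p q.
    move=> e; have [j [e1 _]] := nlab_shift a b; have [j' [e2 _]] := nlab_shift p q.
    by case/negP: c1; apply/congP; exists (j' - j); rewrite e e2 in e1; lia.
  by rewrite (negbTE hnl) orbF.
apply: (diamond_finish hf hz _ _ _ _ _ _ _ _ zr hr) => //.
by rewrite /= ep eq.
Qed.

(** Two successive covers whose labels do not increase can be replaced by two
    covers with the same ends, a smaller first and a larger second label: the
    two exchanges t t' generate a dihedral group, and t t' = t' (t' t t')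
    = (t t' t) t. *)
Lemma diamond f l l' : norm_label l -> norm_label l' -> bnd f -> bcov f l.1 l.2 ->
  bnd (f \o swp n l.1 l.2) -> bcov (f \o swp n l.1 l.2) l'.1 l'.2 ->
  bnd ((f \o swp n l.1 l.2) \o swp n l'.1 l'.2) -> ~~ lablt l l' ->
  diamond_alt f ((f \o swp n l.1 l.2) \o swp n l'.1 l'.2) l l'.
Proof.
case: l l' => [p q] [p' q'] /= hn hn' hf hc hf1 hc' hz hnl.
have hr : brank ((f \o swp n p q) \o swp n p' q') = brank f + 2%:Z.
  by rewrite (bcov_rank n_gt0 hkn hf1 hz hc') (bcov_rank n_gt0 hkn hf hf1 hc) -addrA.
have [_ _ lf _] := hc; have [_ _ lf' _] := hc'.
have hb := hn; have hb' := hn'; rewrite /normal_label /= in hb hb'.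
have nl (j : int) : - n%:Z <= p' + j * n%:Z < 2%:Z * n%:Z ->
    nlab (p' + j * n%:Z) (q' + j * n%:Z) = (p', q').
  move=> hj; have [e|[e|e]] : j = 0 \/ (j = 1 \/ j = -1).
    have : j < 2%:Z by clear -hj hb' n_gt0; nia.
    have : -2%:Z < j by clear -hj hb' n_gt0; nia.
    by clear; lia.
  - by subst j; rewrite !mul0r !addr0; apply: nlab_id hn'.
  - subst j; rewrite !mul1r /nlab; have -> : p' + n%:Z < 0 = false by clear -hb'; lia.
    by have -> : n%:Z <= p' + n%:Z by [clear -hb'; lia|]; rewrite !addrK.
  - subst j; rewrite !mulN1r /nlab; have -> : p' - n%:Z < 0 by clear -hb'; lia.
    by rewrite !subrK.
suff [j [h2 h3]] : exists j : int, 
    - n%:Z <= p' + j * n%:Z < 2%:Z * n%:Z /\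
   [\/ p' + j * n%:Z = p, q' + j * n%:Z = q, p' + j * n%:Z = q | q' + j * n%:Z = p \/
   [/\ ~~ cong n (p' + j * n%:Z) p, ~~ cong n (p' + j * n%:Z) q,
       ~~ cong n (q' + j * n%:Z) p & ~~ cong n (q' + j * n%:Z) q]].
  have ez : (f \o swp n p q) \o swp n (p' + j * n%:Z) (q' + j * n%:Z) =
     (f \o swp n p q) \o swp n p' q' by rewrite swp_shift.
  rewrite -[in diamond_alt _ _ _ _](nl j h2); apply: (diamond_core hn hf hz ez lf h2) => //.
  - by rewrite ltrD2r; clear -hb'; lia.
  - by clear -hb'; lia.
  - by rewrite !(periodicM (bnd_per hf1)) ltrD2r.
  - by rewrite nl.
have [/congP[j hj]|c1] := boolP (cong n p p').
  by exists j; rewrite -hj; split; [clear -hb; lia|constructor 1].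
have [/congP[j hj]|c2] := boolP (cong n q q').
  by exists j; rewrite -hj; split; [clear -hb hb' hj; lia|constructor 2].
have [/congP[j hj]|c3] := boolP (cong n q p').
  by exists j; rewrite -hj; split; [clear -hb; lia|constructor 3].
have [/congP[j hj]|c4] := boolP (cong n p q').
  by exists j; rewrite -hj; split; [clear -hb hb' hj; lia|constructor 4; left].
exists 0; rewrite !mul0r !addr0; split; first by clear -hb'; lia.
by constructor 4; right; rewrite ![cong n _ p]cong_sym ![cong n _ q]cong_sym.
Qed.

(** * Codes of labels *)

(** The order of labels is embedded into the natural numbers. *)
Definition code (l : int * int) : nat :=
  absz (if inwin n l then l.1 * (2%:Z * n%:Z) + l.2
        else 2%:Z * n%:Z * n%:Z + l.1 * (2%:Z * n%:Z) + (2%:Z * n%:Z - l.2))%R.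

Lemma lex_lt (N a b c d : int) : 0 <= b < N -> 0 <= d < N ->
  (a * N + b < c * N + d) = (a < c) || ((a == c) && (b < d)).
Proof.
move=> hb hd; case: (ltgtP a c) => h /=.
- have : (a + 1) * N <= c * N by nia.
  by lia.
- have : (c + 1) * N <= a * N by nia.
  by lia.
- by subst c; lia.
Qed.

Lemma code_lt l l' : norm_label l -> norm_label l' -> (code l < code l')%N = lablt l l'.
Proof.
case: l l' => [p q] [p' q']; rewrite /normal_label /code /label_lt /inwin /= => h h'.
have e1 : 0 <= p * (2%:Z * n%:Z) by clear -h n_gt0; nia.
have e2 : 0 <= p' * (2%:Z * n%:Z) by clear -h' n_gt0; nia.
have e3 : (p + 1) * (2%:Z * n%:Z) <= 2%:Z * n%:Z * n%:Z by clear -h n_gt0; nia.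
have e4 : (p' + 1) * (2%:Z * n%:Z) <= 2%:Z * n%:Z * n%:Z by clear -h' n_gt0; nia.
have e5 : 0 <= 2%:Z * n%:Z * n%:Z by clear; lia.
have L b d : 0 <= b < 2%:Z * n%:Z -> 0 <= d < 2%:Z * n%:Z ->
   (p * (2%:Z * n%:Z) + b < p' * (2%:Z * n%:Z) + d) = (p < p') || ((p == p') && (b < d)).
  exact: lex_lt.
have := L q q'; have := L (2%:Z * n%:Z - q) (2%:Z * n%:Z - q'); clear L => L1 L2.
case: (ltP q n%:Z) => h1; case: (ltP q' n%:Z) => h2 /=.
- by move: (L2 ltac:(clear -h h1; lia) ltac:(clear -h' h2; lia)) => <-; lia.
- by lia.
- by lia.
- move: (L1 ltac:(clear -h h1; lia) ltac:(clear -h' h2; lia)) => E.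
  have -> : (q' < q) = (2%:Z * n%:Z - q < 2%:Z * n%:Z - q') by clear; lia.
  by rewrite -E; lia.
Qed.

Lemma code_inj l l' : norm_label l -> norm_label l' -> code l = code l' -> l = l'.
Proof.
move=> h h' e; apply: contrapT => /lablt_total; rewrite -!code_lt // e ltnn //.
Qed.

Lemma code_le l : norm_label l -> (code l <= 4 * n * n + 2 * n)%N.
Proof.
case: l => [p q]; rewrite /normal_label /code /= => h.
have e1 : 0 <= p * (2%:Z * n%:Z) by clear -h n_gt0; nia.
have e3 : (p + 1) * (2%:Z * n%:Z) <= 2%:Z * n%:Z * n%:Z by clear -h n_gt0; nia.
by case: ifP => _; lia.
Qed.

End Diamond.

(** * Criteria for shellability and for the Eulerian property *)

Section Dual.
Variables (T : choiceType) (le : rel T).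

Lemma dual_poset : is_poset le -> is_poset (dual_rel le).
Proof.
move=> [h1 h2 h3]; split=> [x|x y|x y z hy hz]; first exact: h1.
  by rewrite andbC; apply: h2.
exact: h3 hz hy.
Qed.

Lemma dual_coveredE x y : covered_by (dual_rel le) x y = covered_by le y x.
Proof.
rewrite /covered_by /dual_rel eq_sym; congr [&& _, _ & _].
by apply: asbool_equiv_eq; split=> h z h1 h2; have := h z h2 h1; tauto.
Qed.

End Dual.

Section ELCriterion.
Local Open Scope ring_scope.

Variables (T : choiceType) (le : rel T) (lab : T -> T -> nat) (rho : T -> int).

Local Notation cov := (covered_by le).

(** In each interval the atom with the smallest label starts a chain which is
    lexicographically least; it is increasing because two successive covers
    whose labels do not increase can be replaced by an earlier first label. *)
Lemma EL_criterion : is_poset le -> rank_function le rho ->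
  (forall x y, le x y -> x != y -> exists2 z, cov x z & le z y) ->
  (forall x y y', cov x y -> cov x y' -> lab x y = lab x y' -> y = y') ->
  (forall x y z, cov x y -> cov y z -> (lab y z <= lab x y)%N ->
     exists y', [/\ cov x y', cov y' z & (lab x y' < lab x y)%N]) ->
  (forall x y c c', increasing_chain le lab x y c -> increasing_chain le lab x y c' -> c = c') ->
  EL_labeling le lab.
Proof.
move=> [hr ha ht] [rlt rcov] hatom hinj hdia huniq x y.
have [d] := ubnP (absz (rho y - rho x)%R); elim: d x => // d IH x hd hxy.
suff [c hc hmin] : exists2 c, increasing_chain le lab x y c & 
    forall c', saturated_chain le x y c' ->
      (chain_labels lab x c <= chain_labels lab x c')%O.
  by exists c; split=> // c' hc'; apply: huniq hc' hc.
have [e|hne] := eqVneq x y.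
  by subst y; exists [::] => //; rewrite /increasing_chain /saturated_chain /= eqxx.
pose P m := `[< exists z, [/\ cov x z, le z y & lab x z = m] >].
have exP : exists m, P m.
  by have [z h1 h2] := hatom _ _ hxy hne; exists (lab x z); apply/asboolP; exists z.
have [m /asboolP[z [hxz hzy hm]] minP] := ex_minnP exP.
have hlt := rcov _ _ hxz.
have hle : rho z <= rho y by have [->|h] := eqVneq z y; [|apply/ltW/rlt].
have [c [/andP[/andP[hc1 hc2] hc3] _ hcmin]] := IH z ltac:(lia) hzy.
exists (z :: c).
  rewrite /increasing_chain /saturated_chain /= hxz hc1 hc2 /=.
  case: c hc1 hc2 hc3 {hcmin} => [|w c] //= /andP[hzw hpw] hlast -> ; rewrite andbT.
  rewrite ltNge; apply/negP => hlab.
  have [y' [h1 h2 h3]] := hdia _ _ _ hxz hzw hlab.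
  have hwy : le w y.
    elim: c w hpw hlast {hzw hlab h2} => [|v c IHc] w /=; first by move=> _ /eqP->; apply: hr.
    by move=> /andP[/and3P[hwv _ _] hp] hl; apply: ht hwv (IHc v hp hl).
  have hy'y : le y' y by move/and3P: h2 => [h2 _ _]; apply: ht h2 hwy.
  have : (m <= lab x y')%N by apply: minP; apply/asboolP; exists y'.
  by rewrite -hm leqNgt h3.
move=> [|z' c'] /andP[/=]; first by move=> _ /eqP e; rewrite e eqxx in hne.
move=> /andP[hxz' hp'] hl'.
have hz'y : le z' y.
  elim: c' z' hp' hl' {hxz'} => [|v c' IHc] w /=; first by move=> _ /eqP->; apply: hr.
  by move=> /andP[/and3P[hwv _ _] hp] hl; apply: ht hwv (IHc v hp hl).
have hmz : (m <= lab x z')%N by apply: minP; apply/asboolP; exists z'.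
rewrite /chain_labels /=; change ((lab x z <= lab x z')%O && ((lab x z' <= lab x z)%O ==>
  (chain_labels lab z c <= chain_labels lab z' c')%O)).
rewrite !leEnat hm hmz /=; apply/implyP => hzm.
have e : z = z' by apply: (hinj x) => //; apply/eqP; rewrite eqn_leq hm hmz.
by subst z'; apply: hcmin; rewrite /saturated_chain hp' hl'.
Qed.

End ELCriterion.

Lemma sub_eq_inj (N a b : nat) : a <= N -> b <= N -> N - a = N - b -> a = b.
Proof. lia. Qed.

Lemma sub_le_le (N a b : nat) : b <= N -> N - a <= N - b -> b <= a.
Proof. lia. Qed.

Lemma sub_lt_lt (N a b : nat) : a <= N -> a < b -> b <= N -> N - b < N - a.
Proof. lia. Qed.

Section ELBoth.
Local Open Scope ring_scope.

Variables (T : choiceType) (le : rel T) (lab : T -> T -> nat) (rho : T -> int) (N : nat).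

Local Notation cov := (covered_by le).
Local Notation dlab := (fun x y => N - lab y x)%N.

Lemma rank_dual : rank_function le rho -> rank_function (dual_rel le) (fun x => - rho x).
Proof.
move=> [h1 h2]; split=> x y; first by rewrite /dual_rel eq_sym => h h'; have := h1 _ _ h h'; lia.
by rewrite dual_coveredE => /h2; lia.
Qed.

Lemma last_rev_belast x (c : seq T) : last (last x c) (rev (belast x c)) = x.
Proof. by case: c => //= y c; rewrite rev_cons last_rcons. Qed.

Lemma pairmap_rev x (c : seq T) :
  pairmap lab (last x c) (rev (belast x c)) = rev (pairmap (fun a b => lab b a) x c).
Proof.
elim: c x => //= y c IH x; rewrite !rev_cons -IH.
by rewrite -cats1 pairmap_cat /= last_rev_belast cats1.
Qed.

Lemma rev_belast_inj x (c c' : seq T) : last x c = last x c' ->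
  rev (belast x c) = rev (belast x c') -> c = c'.
Proof.
move=> hl /(congr1 rev); rewrite !revK => hb.
have : x :: c = x :: c' by rewrite !lastI hl hb.
by case.
Qed.

Lemma increasing_dual x y c : increasing_chain (dual_rel le) dlab y x c ->
  increasing_chain le lab x y (rev (belast y c)).
Proof.
move=> /andP[/andP[hp /eqP hl] hs]; apply/andP; split.
  apply/andP; split; last by rewrite -hl last_rev_belast.
  rewrite -hl rev_path; apply: sub_path hp => a b; by rewrite dual_coveredE.
rewrite /chain_labels -hl pairmap_rev rev_sorted.
have e : chain_labels dlab y c = map (fun a => N - a)%N (pairmap (fun a b => lab b a) y c) :> seq nat.
  by rewrite /chain_labels; elim: (c) (y) => //= a c' IHc b; rewrite IHc.
move: hs; rewrite e sorted_map; apply: sub_sorted => a b /=.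
by rewrite !ltEnat /=; lia.
Qed.

(** Reversing both the poset and the order of the labels turns the condition on
    two successive covers, and uniqueness, into themselves. *)
Theorem EL_both : is_poset le -> rank_function le rho ->
  (forall x y, le x y -> x != y -> exists2 z, cov x z & le z y) ->
  (forall x y, le x y -> x != y -> exists2 z, le x z & cov z y) ->
  (forall x y, cov x y -> (lab x y <= N)%N) ->
  (forall x y y', cov x y -> cov x y' -> lab x y = lab x y' -> y = y') ->
  (forall x x' y, cov x y -> cov x' y -> lab x y = lab x' y -> x = x') ->
  (forall x y z, cov x y -> cov y z -> (lab y z <= lab x y)%N ->
     exists y', [/\ cov x y', cov y' z, (lab x y' < lab x y)%N & (lab y z < lab y' z)%N]) ->
  (forall x y c c', increasing_chain le lab x y c -> increasing_chain le lab x y c' -> c = c') ->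
  EL_shellable le /\ EL_shellable (dual_rel le).
Proof.
move=> hp hrk hatom hcoatom hN hinj hinj' hdia huniq; split.
  exists _, nat, lab; apply: (EL_criterion hp hrk) => // x y z h1 h2 h3.
  by have [y' [? ? ? ?]] := hdia _ _ _ h1 h2 h3; exists y'.
exists _, nat, dlab; apply: (EL_criterion (dual_poset hp) (rank_dual hrk)).
- move=> x y hxy hne; have [|z h1 h2] := hcoatom y x hxy; first by rewrite eq_sym.
  by exists z; rewrite ?(dual_coveredE le).
- move=> x y y'; rewrite !(dual_coveredE le) => h1 h2 h3; apply: (hinj' _ _ _ h1 h2).
  exact: sub_eq_inj (hN _ _ h1) (hN _ _ h2) h3.
- move=> x y z; rewrite !(dual_coveredE le) => h1 h2 h3.
  have hle : (lab y x <= lab z y)%N.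
    exact: sub_le_le (hN _ _ h1) h3.
  have [y' [h4 h5 h6 h7]] := hdia _ _ _ h2 h1 hle.
  exists y'; rewrite !(dual_coveredE le); split=> //.
  exact: sub_lt_lt (hN _ _ h1) h7 (hN _ _ h5).
move=> x y c c' h h'.
have e := huniq _ _ _ _ (increasing_dual h) (increasing_dual h').
move: h h' => /andP[/andP[_ /eqP hl] _] /andP[/andP[_ /eqP hl'] _].
by apply: rev_belast_inj e; rewrite hl hl'.
Qed.

End ELBoth.

Section EulerianCriterion.
Local Open Scope ring_scope.
Local Open Scope classical_set_scope.

Definition sgz_pow (z : int) : int := (-1) ^+ (absz z).

Lemma sgz_powE (z : int) : (-1) ^ z = sgz_pow z :> int.
Proof.
by case: z => m //=; rewrite /sgz_pow NegzE absz_nat abszN /=.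
Qed.

Lemma sgz_powD (a b : int) : sgz_pow (a + b) = sgz_pow a * sgz_pow b.
Proof.
rewrite /sgz_pow -exprD -signr_odd -[RHS]signr_odd; congr (_ ^+ nat_of_bool _).
by rewrite oddD; lia.
Qed.

Lemma sgz_powN (a : int) : sgz_pow (- a) = sgz_pow a.
Proof. by rewrite /sgz_pow abszN. Qed.

Variables (T : choiceType) (le : rel T).

(** The signs (-1)^(rho x - rho y) form the Moebius function as soon as the signed
    sums over nontrivial intervals vanish. *)
Lemma eulerian_crit rho : is_poset le -> rank_function le rho ->
  (forall x y, le x y -> x != y -> finite_set (poset_interval le x y) ->
     \sum_(z \in poset_interval le x y) sgz_pow (rho z) = 0) ->
  eulerian le.
Proof.
move=> hp hr hs; split=> //.
exists rho, (fun x y => sgz_pow (rho x - rho y)); split=> //.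
  split=> [x|x y hxy hne hfin]; first by rewrite subrr.
  under eq_fsbigr do rewrite sgz_powD sgz_powN.
  by rewrite -mulr_fsumr hs // mulr0.
by move=> x y _ _; rewrite sgz_powE.
Qed.

End EulerianCriterion.

Section EulerianBoth.
Local Open Scope ring_scope.
Local Open Scope classical_set_scope.

Variables (T : choiceType) (le : rel T).

Lemma eulerian_both rho : is_poset le -> rank_function le rho ->
  (forall x y, le x y -> x != y -> finite_set (poset_interval le x y) ->
     \sum_(z \in poset_interval le x y) sgz_pow (rho z) = 0) ->
  eulerian le /\ eulerian (dual_rel le).
Proof.
move=> hp hr hs; split; first exact: eulerian_crit hr hs.
apply: (eulerian_crit (dual_poset hp) (rank_dual hr)) => x y hxy hne.
have -> : poset_interval (dual_rel le) x y = poset_interval le y x.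
  by apply/seteqP; split=> z [h1 h2].
move=> hfin; under eq_fsbigr do rewrite sgz_powN.
by apply: hs => //; rewrite eq_sym.
Qed.

End EulerianBoth.

(** * Transport along an isomorphism *)

Section Transport.
Local Open Scope ring_scope.
Local Open Scope classical_set_scope.

Variables (T U : choiceType) (le : rel T) (le' : rel U) (phi : T -> U).
Hypothesis phi_bij : bijective phi.
Hypothesis phi_le : forall x y, le x y = le' (phi x) (phi y).

Lemma iso_covered x y : covered_by le x y = covered_by le' (phi x) (phi y).
Proof.
have [psi phiK psiK] := phi_bij.
rewrite /covered_by phi_le (inj_eq (bij_inj phi_bij)); congr [&& _, _ & _].
apply: asbool_equiv_eq; split=> h z.
  rewrite -(psiK z) -!phi_le => h1 h2.
  by case: (h _ h1 h2) => ->; [left|right].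
by rewrite !phi_le => h1 h2; case: (h _ h1 h2) => /(bij_inj phi_bij); [left|right].
Qed.

Lemma iso_poset : is_poset le' -> is_poset le.
Proof.
move=> [h1 h2 h3]; split=> [x|x y|y x z]; rewrite !phi_le //.
  by move=> h; apply: (bij_inj phi_bij); apply: h2.
exact: h3.
Qed.

Lemma iso_rank rho : rank_function le' rho -> rank_function le (rho \o phi).
Proof.
move=> [h1 h2]; split=> x y /=; last by rewrite iso_covered => /h2.
by rewrite phi_le => h hne; apply: h1 => //; rewrite (inj_eq (bij_inj phi_bij)).
Qed.

Lemma iso_interval x y :
  set_bij (poset_interval le x y) (poset_interval le' (phi x) (phi y)) phi.
Proof.
have [psi phiK psiK] := phi_bij.
split; first by move=> z [h1 h2]; split; rewrite -phi_le.
  by move=> a b _ _; apply: bij_inj.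
move=> z [h1 h2]; exists (psi z); last exact: psiK.
by split; rewrite phi_le psiK.
Qed.

Lemma iso_eulerian : eulerian le' -> eulerian le.
Proof.
move=> [hp [rho [mu [hr [hm1 hm2] he]]]]; split; first exact: iso_poset.
have hfin x y : finite_set (poset_interval le x y) ->
    finite_set (poset_interval le' (phi x) (phi y)).
  have [_ _ hsur] := iso_interval x y.
  by move=> /(finite_image phi); apply: sub_finite_set.
exists (rho \o phi), (fun x y => mu (phi x) (phi y)); split.
- exact: iso_rank.
- split=> [x|x y hxy hne hf]; first exact: hm1.
  rewrite -(reindex_fsbig phi _ _ (mu (phi x)) (iso_interval x y)).
  apply: hm2; [by rewrite -phi_le|by rewrite (inj_eq (bij_inj phi_bij))|exact: hfin].
- by move=> x y hxy hf; apply: he; [rewrite -phi_le|apply: hfin].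
Qed.

Lemma iso_EL : EL_shellable le' -> EL_shellable le.
Proof.
have [psi phiK psiK] := phi_bij.
move=> [d [L [lab hlab]]]; exists d, L, (fun x y => lab (phi x) (phi y)).
have hpath x c : path (covered_by le) x c = path (covered_by le') (phi x) (map phi c).
  by elim: c x => //= y c IH x; rewrite iso_covered IH.
have hsat x y c : saturated_chain le x y c = saturated_chain le' (phi x) (phi y) (map phi c).
  by rewrite /saturated_chain hpath last_map (inj_eq (bij_inj phi_bij)).
have hch x c : chain_labels (fun x y => lab (phi x) (phi y)) x c =
    chain_labels lab (phi x) (map phi c).
  by rewrite /chain_labels; elim: c x => //= y c IH x; rewrite IH.
have hinc x y c : increasing_chain le (fun x y => lab (phi x) (phi y)) x y c =
    increasing_chain le' lab (phi x) (phi y) (map phi c).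
  by rewrite /increasing_chain hsat hch.
move=> x y; rewrite phi_le => /hlab[c [h1 h2 h3]].
have mK : map phi (map psi c) = c by rewrite -map_comp map_id_in // => z _ /=.
exists (map psi c); rewrite hinc mK; split=> //.
  move=> c'; rewrite hinc => /h2 e; apply: (inj_map (bij_inj phi_bij)).
  by rewrite e mK.
by move=> c'; rewrite hsat => /h3; rewrite !hch mK.
Qed.

End Transport.

(** * Verma's argument *)

(** Every y that is not minimal comes with a partial involution s (right
    multiplication by a simple reflection that lowers y) which has the lifting
    property below y.  Intervals from an element that s raises cancel in pairs;
    the others reduce to these and to intervals below s y. *)
Section Verma.
Local Open Scope ring_scope.

Variables (T : finType) (le : rel T) (rho : T -> int).
Hypothesis le_poset : is_poset le.
Hypothesis le_rank : rank_function le rho.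

Definition isum x y : int := \sum_(z | le x z && le z y) sgz_pow (rho z).

Hypothesis lifting : forall y, (forall x, le x y -> x = y) \/ exists s : T -> T,
  [/\ le (s y) y /\ s y != y,
      forall z, le z y -> [/\ le (s z) y, s (s z) = z, s z != z, 
        sgz_pow (rho (s z)) = - sgz_pow (rho z) & le z (s z) || le (s z) z],
      forall x z, le z y -> le x z -> le x (s x) -> le x (s z),
      forall x z, le z y -> le (s x) z -> le (s x) x -> le (s z) z -> le x y -> le x z &
      forall z, le z y -> le z (s z) -> le z (s y)].

Lemma isum0 x y : ~~ le x y -> isum x y = 0.
Proof.
have [_ _ ht] := le_poset.
move=> h; rewrite /isum big1 // => z /andP[h1 h2].
by case/negP: h; apply: ht h1 h2.
Qed.

(** If s raises x, then s pairs off the interval [x, y].  If s lowers x, compare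
    [s x, y] with [x, y]: by lifting, the elements of the former that are not
    above x all lie below s y, so that the difference of the two sums is the
    same with s y in place of y, where induction applies. *)
Lemma isum_eq0 x y : x != y -> isum x y = 0.
Proof.
have [hr ha ht] := le_poset.
have [d] := ubnP #|[set z | le z y]|; elim: d y x => // d IH y x hd hne.
have [hxy|] := boolP (le x y); last exact: isum0.
have [hmin|[s [[sy1 sy2] hs h1 h2 h3]]] := lifting y.
  by rewrite (hmin x hxy) eqxx in hne.
have pair x' : le x' y -> le x' (s x') -> isum x' y = 0.
  move=> hx' hup; rewrite /isum.
  have e : \sum_(z | le x' z && le z y) sgz_pow (rho z) = 
           - \sum_(z | le x' z && le z y) sgz_pow (rho z).
    rewrite {1}(reindex_onto s s) /=; last by move=> z /andP[_ hz]; have [] := hs z hz.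
    rewrite -sumrN; apply: eq_big => [z|z /andP[/andP[hx'z hzy] /eqP e]].
      apply/andP/andP => [[/andP[ha1 ha2] /eqP e]|[ha1 ha2]].
        have [hb1 hb2 hb3 hb4 hb5] := hs _ ha2; rewrite e in hb1.
        by split=> //; rewrite -e; apply: h1.
      have [hb1 hb2 hb3 hb4 hb5] := hs _ ha2.
      by split; [rewrite hb1 andbT; apply: h1|rewrite hb2].
    have [hb1 hb2 hb3 hb4 hb5] := hs _ hzy; rewrite e in hb1.
    by have [_ _ _ -> _] := hs _ hb1.
  lia.
have [hx1 hx2 hx3 hx4 /orP[hup|hdn]] := hs x hxy; first exact: pair.
have s0 : isum (s x) y = 0 by apply: pair => //; rewrite hx2.
have hsyd : (#|[set z | le z (s y)]| < d)%N.
  rewrite -ltnS; apply: leq_trans hd; rewrite ltnS; apply: proper_card.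
  apply/properP; split.
    by apply/fintype.subsetP => z; rewrite !inE => hz; apply: ht hz sy1.
  exists y; rewrite inE ?hr //; apply: contra sy2 => hysy; apply/eqP.
  by apply: ha; rewrite sy1 hysy.
have split_ x' : isum (s x) x' = isum x x' +
    \sum_(z | [&& le (s x) z, ~~ le x z & le z x']) sgz_pow (rho z).
  rewrite /isum (bigID (le x)) /=; congr (_ + _); apply: eq_bigl => z; last first.
    by rewrite -andbA; congr andb; rewrite andbC.
  have [hz|] := boolP (le x z); last by rewrite andbF.
  by rewrite (ht _ _ _ hdn hz) andbT.
have e1 := split_ y; have e2 := split_ (s y).
have e3 : \sum_(z | [&& le (s x) z, ~~ le x z & le z y]) sgz_pow (rho z) =
          \sum_(z | [&& le (s x) z, ~~ le x z & le z (s y)]) sgz_pow (rho z).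
  apply: eq_bigl => z; apply/and3P/and3P => -[ha1 ha2 ha3]; split=> //; last exact: ht ha3 sy1.
  apply: h3 => //; have [_ _ _ _ /orP[//|hzdn]] := hs z ha3.
  by case/negP: ha2; apply: h2.
have z1 : isum (s x) (s y) = 0.
  apply: IH => //; apply/eqP => e; have [_ hxx _ _ _] := hs _ hxy.
  have [_ hyy _ _ _] := hs _ (hr y).
  by move/eqP: hne; apply; rewrite -hxx e hyy.
have z2 : isum x (s y) = 0.
  apply: IH => //; apply/eqP => e; move: hdn; rewrite e.
  have [_ -> _ _ _] := hs _ (hr y) => hysy.
  by case/eqP: sy2; apply: ha; rewrite sy1 hysy.
by move: e1; rewrite s0 e3; move: e2; rewrite z1 z2; lia.
Qed.

Lemma verma_eulerian : eulerian le /\ eulerian (dual_rel le).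
Proof.
apply: (eulerian_both le_poset le_rank) => x y hxy hne _.
rewrite (fsbigE (enum [pred z | le x z && le z y])) ?enum_uniq //; first last.
- by move=> z [h1 h2]; rewrite mem_enum inE /= h1 h2.
- by move=> z /=; rewrite mem_enum inE => /andP[h1 h2].
transitivity (isum x y); last exact: isum_eq0.
rewrite /isum big_enum_cond; apply: eq_bigl => z.
rewrite inE /= andb_idr // => /andP[h1 h2].
by rewrite in_setE.
Qed.

End Verma.

(** * Shellability of the bounded permutations *)

Section BoundEL.
Local Open Scope ring_scope.

Variables (k n : nat).
Hypothesis n_gt0 : (0 < n)%N.
Hypothesis hkn : (k <= n)%N.

Local Notation bnd := (bounded_perm k n).
Local Notation upath := (upath n).
Local Notation brank := (@brank k n).
Local Notation bcov := (bcov n).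
Local Notation lablt := (label_lt n).
Local Notation norm_label := (normal_label n).
Local Notation B := (Bound k n).
Local Notation le := (@Bound_le k n).
Implicit Types F G H : B.

Lemma Bound_bnd F : bnd (val F).
Proof. exact/asboolP/(valP F). Qed.

Definition mkBound (f : int -> int) (hf : bnd f) : B := exist _ f (introT (asboolP _) hf).

Lemma Bound_poset : is_poset le.
Proof.
split=> [F|F G /andP[/(Bound_leP n_gt0) h1 /(Bound_leP n_gt0) h2]|G F H].
- by apply/(Bound_leP n_gt0); apply: rt_refl.
- apply/val_inj; have [//|h3] := upath_brank n_gt0 hkn (Bound_bnd F) (Bound_bnd G) h1.
  by have [//|h4] := upath_brank n_gt0 hkn (Bound_bnd G) (Bound_bnd F) h2; lia.
move=> /(Bound_leP n_gt0) h1 /(Bound_leP n_gt0) h2; apply/(Bound_leP n_gt0).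
exact: rt_trans h1 h2.
Qed.

Lemma cover_label f (p q : int) : bnd f -> bcov f p q ->
  exists l, [/\ norm_label l, bcov f l.1 l.2 & swp n l.1 l.2 = swp n p q].
Proof.
move=> hf hc; have [d [hd /congP[j hj]]] := win_rep n_gt0 0 p.
rewrite add0r in hj.
have hc' := bcov_shift n_gt0 hkn j hf hc.
exists (p + j * n%:Z, q + j * n%:Z); split=> //; last exact: swp_shift.
by rewrite /normal_label /= -hj; case: hc => h1 h2 _ _; lia.
Qed.

Lemma swp_label l l' : norm_label l -> norm_label l' ->
  swp n l.1 l.2 = swp n l'.1 l'.2 -> l = l'.
Proof.
case: l l' => p q [p' q'] /andP[/= h1 h2] /andP[/= h3 h4] /(congr1 (fun t : int -> int => t p)).
rewrite swpL => e.
have [c1|c1] := boolP (cong n p p').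
  have ep : p = p' by apply: (cong_near c1); lia.
  by move: e; rewrite -ep swpL => <-.
have [c2|c2] := boolP (cong n p q').
  by move: e; rewrite swpRc //; [lia|apply: not_cong_near; lia].
by move: e; rewrite swp_id //; lia.
Qed.

(** Ranks rise by one along these exchanges, so nothing fits in between. *)
Lemma Bound_covP F G : covered_by le F G <->
  exists l, [/\ norm_label l, bcov (val F) l.1 l.2 & val G = val F \o swp n l.1 l.2].
Proof.
split=> [/and3P[/(Bound_leP n_gt0) hp /eqP hne /asboolP hc]|[l [hl hc e]]].
  have hne' : val F <> val G by move=> /val_inj.
  have [p [q [h1 h2 h3]]] := upath_cover n_gt0 hkn (Bound_bnd F) (Bound_bnd G) hp hne'.
  have [l [hl1 hl2 hl3]] := cover_label (Bound_bnd F) h1.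
  exists l; split=> //; rewrite hl3.
  have [||e|<-//] := hc (mkBound h2).
  - by apply/(Bound_leP n_gt0); rewrite /=; apply: (bcov_upath h1).
  - exact/(Bound_leP n_gt0).
  by case: (bcov_neq n_gt0 hkn h1); rewrite -[in LHS]e.
have hb : bnd (val F \o swp n l.1 l.2) by rewrite -e; apply: Bound_bnd.
have hr := bcov_rank n_gt0 hkn (Bound_bnd F) hb hc; rewrite -e in hr.
apply/and3P; split.
- by apply/(Bound_leP n_gt0); rewrite e; apply: (bcov_upath hc).
- by apply/eqP => eFG; rewrite eFG in hr; lia.
apply/asboolP => H /(Bound_leP n_gt0) h1 /(Bound_leP n_gt0) h2.
have [e1|h3] := upath_brank n_gt0 hkn (Bound_bnd F) (Bound_bnd H) h1.
  by left; apply/val_inj.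
have [e2|h4] := upath_brank n_gt0 hkn (Bound_bnd H) (Bound_bnd G) h2.
  by right; apply/val_inj.
lia.
Qed.

Lemma Bound_rank : rank_function le (fun F => brank (val F)).
Proof.
split=> F G.
  move=> /(Bound_leP n_gt0) h /eqP hne.
  by have [/val_inj//|] := upath_brank n_gt0 hkn (Bound_bnd F) (Bound_bnd G) h.
move=> /Bound_covP[l [hl hc e]].
have hb : bnd (val F \o swp n l.1 l.2) by rewrite -e; apply: Bound_bnd.
by rewrite e (bcov_rank n_gt0 hkn (Bound_bnd F) hb hc).
Qed.

(** The default value is only taken at pairs that are not covers. *)
Definition cov_label F G : int * int :=
  xget (0, 0) [set l | norm_label l /\ val G = val F \o swp n l.1 l.2]%classic.

Lemma cov_labelP F G : covered_by le F G ->
  [/\ norm_label (cov_label F G), bcov (val F) (cov_label F G).1 (cov_label F G).2 &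
      val G = val F \o swp n (cov_label F G).1 (cov_label F G).2].
Proof.
move=> /Bound_covP[l [hl hc e]]; rewrite /cov_label.
case: xgetP => [l' _ [hl' e'] | /(_ l)]; last by case; split.
suff -> : l' = l by [].
apply: swp_label => //; apply/funext => x; apply: (bnd_inj (Bound_bnd F)).
by have := congr1 (fun t : int -> int => t x) e; rewrite e'.
Qed.

Lemma cov_labelE F G l : norm_label l -> val G = val F \o swp n l.1 l.2 -> cov_label F G = l.
Proof.
move=> hl e; rewrite /cov_label; case: xgetP => [l' _ [hl' e'] | /(_ l)]; last by case; split.
apply: swp_label => //; apply/funext => x; apply: (bnd_inj (Bound_bnd F)).
by have := congr1 (fun t : int -> int => t x) e; rewrite e'.
Qed.

(** A chain is determined by its labels, as recorded by the last component. *)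
Lemma chain_lch F c : path (covered_by le) F c -> exists ls : seq (int * int),
  [/\ lch k n (val F) ls (val (last F c)), all norm_label ls,
      pairmap (fun F G => code n (cov_label F G)) F c = map (code n) ls &
      map val c = scanl (fun (f : int -> int) (l : int * int) => f \o swp n l.1 l.2) (val F) ls].
Proof.
elim: c F => [|G c IH] F /=; first by exists [::].
move=> /andP[/cov_labelP[hl hc e] /IH[ls [h1 h2 h3 h4]]].
exists (cov_label F G :: ls); rewrite /= -e hl h2 h3 h4; split=> //.
by split=> //; apply: Bound_bnd.
Qed.

Theorem Bound_EL : EL_shellable le /\ EL_shellable (dual_rel le).
Proof.
apply: (@EL_both _ _ (fun F G => code n (cov_label F G)) _ (4 * n * n + 2 * n)
  Bound_poset Bound_rank).
- move=> F G /(Bound_leP n_gt0) hp /eqP hne; have hne' : val F <> val G by move=> /val_inj.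
  have [p [q [h1 h2 h3]]] := upath_cover n_gt0 hkn (Bound_bnd F) (Bound_bnd G) hp hne'.
  exists (mkBound h2); last exact/(Bound_leP n_gt0).
  have [l [hl1 hl2 hl3]] := cover_label (Bound_bnd F) h1.
  by apply/Bound_covP; exists l; rewrite /= hl3.
- move=> F G /(Bound_leP n_gt0) hp /eqP hne; have hne' : val F <> val G by move=> /val_inj.
  have [h [p [q [h1 h2 h3 h4]]]] := upath_cocover n_gt0 hkn (Bound_bnd F) (Bound_bnd G) hp hne'.
  exists (mkBound h1); first exact/(Bound_leP n_gt0).
  have [l [hl1 hl2 hl3]] := cover_label h1 h2.
  by apply/Bound_covP; exists l; rewrite /= hl3.
- by move=> F G /cov_labelP[hl _ _]; apply: (code_le n_gt0 hkn).
- move=> F G G' /cov_labelP[h1 _ h2] /cov_labelP[h3 _ h4] /(code_inj n_gt0 hkn h1 h3) e.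
  by apply/val_inj; rewrite h2 h4 e.
- move=> F F' G /cov_labelP[h1 c1 h2] /cov_labelP[h3 c3 h4] /(code_inj n_gt0 hkn h1 h3) e.
  apply/val_inj; apply/funext => x.
  have := congr1 (fun t : int -> int => t (swp n (cov_label F G).1 (cov_label F G).2 x)) h2.
  rewrite {1}h4 /= e swpK // ; exact: (bcov_ncong c3).
- move=> F G H hFG hGH hle.
  have [h1 c1 e1] := cov_labelP hFG; have [h2 c2 e2] := cov_labelP hGH.
  set l := cov_label F G in h1 c1 e1 hle *; set l' := cov_label G H in h2 c2 e2 hle *.
  have hnl : ~~ lablt l l' by rewrite -(code_lt n_gt0 hkn) // -leqNgt.
  have hb1 : bnd (val F \o swp n l.1 l.2) by rewrite -e1; apply: Bound_bnd.
  have hb2 : bnd ((val F \o swp n l.1 l.2) \o swp n l'.1 l'.2) by rewrite -e1 -e2; apply: Bound_bnd.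
  have c2' : bcov (val F \o swp n l.1 l.2) l'.1 l'.2 by rewrite -e1.
  have [r [r' [hr hr' d1 d2 [d3 d4 d5 d6]]]] :=
    diamond n_gt0 hkn h1 h2 (Bound_bnd F) c1 hb1 c2' hb2 hnl.
  have el1 : cov_label F (mkBound d2) = r by apply: cov_labelE.
  have el2 : cov_label (mkBound d2) H = r' by apply: cov_labelE => //=; rewrite d4 -e1.
  exists (mkBound d2); rewrite el1 el2 !(code_lt n_gt0 hkn) //; split=> //; apply/Bound_covP.
    by exists r.
  by exists r'; split=> //=; rewrite d4 -e1.
- move=> F G c c' /andP[/andP[/chain_lch[ls [h1 h2 h3 h4]] /eqP e1] s1].
  move=> /andP[/andP[/chain_lch[ls' [h1' h2' h3' h4']] /eqP e2] s2].
  have hs m : all norm_label m -> sorted <%O (map (code n) m : seq nat) -> sorted lablt m.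
    move=> hm; rewrite sorted_map; apply: (@sub_in_sorted _ norm_label) => //.
    by move=> a b ha hb; rewrite /= ltEnat /= (code_lt n_gt0 hkn).
  rewrite e1 in h1; rewrite e2 in h1'.
  rewrite /chain_labels h3 in s1; rewrite /chain_labels h3' in s2.
  have e : ls = ls' by apply: (increasing_unique n_gt0 hkn (Bound_bnd F) h1 h1'); apply: hs.
  by apply: (inj_map val_inj); rewrite h4 h4' e.
Qed.

End BoundEL.

(** * The order on subsets by counting *)

Lemma count_geq_all (s : seq nat) c : all (leq c) s -> count (leq c) s = size s.
Proof. by rewrite all_count => /eqP. Qed.

(** Comparing the heads amounts to counting with c equal to the smaller head. *)
Lemma all2_leq_count (s t : seq nat) : size s = size t -> sorted ltn s -> sorted ltn t ->
  reflect (forall c, count (leq c) s <= count (leq c) t) (all2 leq s t).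
Proof.
move=> hsz hs ht; apply: (iffP idP).
  move: t hsz {hs ht}; elim: s => [|a s IH] [|b t] //= [hsz] /andP[hab h] c.
  by apply: leq_add (IH _ hsz h c); case: (leqP c a) => // h'; rewrite (leq_trans h' hab).
move: t hsz hs ht; elim: s => [|a s IH] [|b t] //= [hsz] hs ht hc.
have ha : all (leq a) s by apply: sub_all (order_path_min ltn_trans hs) => x /ltnW.
have hb : all (leq b) t by apply: sub_all (order_path_min ltn_trans ht) => x /ltnW.
have hab : a <= b.
  have := hc a; rewrite leqnn (count_geq_all ha).
  by have := count_size (leq a) t; case: leqP; lia.
rewrite hab /=; apply: IH => //; [exact: path_sorted hs|exact: path_sorted ht|].
move=> c; have := hc c; case: (leqP c a) => h1; first by rewrite (leq_trans h1 hab); lia.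
case: (leqP c b) => h2; last by lia.
move=> _; have /count_geq_all -> : all (leq c) t by apply: sub_all hb => x; apply: leq_trans.
by rewrite -hsz count_size.
Qed.

Section Subsets.
Variable n : nat.
Implicit Types A B : {set 'I_n}.

Definition cnt A (c : nat) := #|[set x in A | (c <= x)%N]|.

Lemma cnt_enum A c : cnt A c = count (leq c) (map val (enum A)).
Proof.
rewrite /cnt cardE count_map -size_filter; apply: perm_size.
apply: uniq_perm; [exact: enum_uniq|exact/filter_uniq/enum_uniq|].
by move=> x; rewrite mem_enum inE mem_filter mem_enum andbC.
Qed.

Lemma subset_leP A B : #|A| = #|B| ->
  reflect (forall c, cnt A c <= cnt B c) (subset_le A B).
Proof.
move=> hc; rewrite /subset_le.
have -> : all2 (fun a b : 'I_n => a <= b) (enum A) (enum B) =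
          all2 leq (map val (enum A)) (map val (enum B)).
  by elim: (enum A) (enum B) => [|a s IH] [|b t] //=; rewrite IH.
apply: (iffP (all2_leq_count _ (sorted_enum_ord A) (sorted_enum_ord B))).
- by rewrite !size_map -!cardE.
- by move=> h c; rewrite !cnt_enum.
- by move=> h c; rewrite -!cnt_enum.
Qed.

Definition nmem A (j : nat) : bool := [exists x in A, val x == j].

Lemma nmem_val A (x : 'I_n) : nmem A x = (x \in A).
Proof.
apply/existsP/idP => [[y /andP[h /eqP/val_inj <-]]//|h]; exists x.
by rewrite h /=.
Qed.

Lemma nmem_lt A j : nmem A j -> (j < n)%N.
Proof. by case/existsP => x /andP[_ /eqP <-]; apply: ltn_ord. Qed.

Lemma shift_downE A (y : 'I_n) : (y \in shift_down A) = nmem A y.+1.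
Proof. by rewrite inE. Qed.

Lemma sum_nmem A (F : nat -> nat) : \sum_(x in A) F x = \sum_(0 <= j < n) nmem A j * F j.
Proof.
rewrite big_mkord big_mkcond; apply: eq_bigr => x _; rewrite nmem_val.
by case: (x \in A); lia.
Qed.

Lemma sum_shift_down A (F : nat -> nat) :
  \sum_(x in A) F x = \sum_(y in shift_down A) F y.+1 + nmem A 0 * F 0.
Proof.
rewrite sum_nmem [in RHS]big_mkcond.
have -> : \sum_(y : 'I_n) (if y \in shift_down A then F y.+1 else 0) =
          \sum_(0 <= j < n) nmem A j.+1 * F j.+1.
  by rewrite big_mkord; apply: eq_bigr => y _; rewrite shift_downE; case: (nmem _ _); lia.
have hn : nmem A n = false by apply: contraTF isT => h; have := nmem_lt h; rewrite ltnn.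
have := big_nat_recl n 0 (fun j => nmem A j * F j) (leq0n n) (op := addn) (idx := 0).
have := big_nat_recr n 0 (fun j => nmem A j * F j) (leq0n n) (op := addn) (idx := 0).
by rewrite /= hn; lia.
Qed.

(** If the state A is followed by the state B, the sum of the landing times grows
    by the height of the throw. *)
Definition throw A B : nat := (\sum_(y in B) y.+1 - \sum_(x in A) x)%N.

(** The ball caught at the present time, if any, is thrown to the only new
    landing time. *)
Lemma throwP A B : #|A| = #|B| -> shift_down A \subset B ->
  \sum_(y in B) y.+1 = \sum_(x in A) x + throw A B /\
  (if nmem A 0 then exists2 x : 'I_n, x \notin shift_down A & B = x |: shift_down A /\ throw A B = x.+1
   else B = shift_down A /\ throw A B = 0).
Proof.
move=> hc hs; rewrite /throw.
have h1 := sum_shift_down A (fun _ => 1); rewrite !sum1_card in h1.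
have h2 := sum_shift_down A id; rewrite muln0 addn0 in h2.
case: ifP => h0; rewrite h0 in h1.
  have hd : #|B :\: shift_down A| = 1.
    have := cardsID (shift_down A) B; have /finset.setIidPr -> := hs; lia.
  have /cards1P[x hx] : #|B :\: shift_down A| == 1 by rewrite hd.
  have hxB : x \in B :\: shift_down A by rewrite hx set11.
  rewrite inE in hxB; have /andP[hx1 hx2] := hxB.
  have hB : B = x |: shift_down A by rewrite -hx finset.setUC -{1}(finset.setID B (shift_down A)) (finset.setIidPr hs).
  have e : \sum_(y in B) y.+1 = x.+1 + \sum_(y in shift_down A) y.+1.
    by rewrite hB big_setU1.
  by split; [|exists x => //; split=> //]; lia.
have hB : shift_down A = B by apply/eqP; rewrite eqEcard hs -hc h1; lia.
by rewrite hB in h2; split; [|split=> //]; lia.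
Qed.

End Subsets.

Section Juggling.
Local Open Scope ring_scope.

Variables (k n : nat).
Hypothesis n_gt0 : (0 < n)%N.
Hypothesis hkn : (k <= n)%N.

Local Notation bnd := (bounded_perm k n).

Lemma res_lt (i : int) : (absz (modz i n%:Z) < n)%N.
Proof.
have h0 : n%:Z != 0 by lia.
by have := modz_ge0 i h0; have := ltz_mod i h0; lia.
Qed.

Definition res (i : int) : 'I_n := Ordinal (res_lt i).

Lemma resE i : (res i : nat)%:Z = modz i n%:Z.
Proof. by rewrite /= gez0_abs // modz_ge0 //; lia. Qed.

Lemma res_small i : 0 <= i < n%:Z -> (res i : nat)%:Z = i.
Proof. by move=> h; rewrite resE modz_small. Qed.

Lemma res_ord (r : 'I_n) : res (r : nat)%:Z = r.
Proof.
apply/val_inj; have h := ltn_ord r.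
have hr : 0 <= (r : nat)%:Z < n%:Z by lia.
by have [] := res_small hr.
Qed.

Lemma res_add i : res (i + n%:Z) = res i.
Proof.
by apply/val_inj; have := resE (i + n%:Z); rewrite modzDr -resE => -[].
Qed.

Lemma res_S i : res (i + 1) = ordS (res i).
Proof.
apply/val_inj => /=; have := resE (i + 1); rewrite -modzDml -(resE i).
by rewrite -PoszD modz_nat addn1 => -[].
Qed.

Lemma res_decomp i : exists j, i = (res i : nat)%:Z + j * n%:Z.
Proof. by exists (divz i n%:Z); rewrite resE {1}(divz_eq i n%:Z); lia. Qed.

(** * From bounded permutations to juggling sequences *)

Definition throws (f : int -> int) (i v : int) : Prop := exists2 a, a < i & f a = v.

(** The times, relative to i, at which balls thrown before i will land. *)
Definition states (f : int -> int) : {ffun 'I_n -> {set 'I_n}} :=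
  [ffun i : 'I_n => [set y : 'I_n | `[< throws f (i : nat)%:Z ((i : nat)%:Z + (y : nat)%:Z) >]]%SET].

Lemma throws_shift f i v j : bnd f -> throws f (i + j * n%:Z) (v + j * n%:Z) -> throws f i v.
Proof.
move=> hf [a h1 h2]; exists (a - j * n%:Z); first by lia.
have := periodicM (bnd_per hf) (a - j * n%:Z) j; rewrite subrK h2; lia.
Qed.

Lemma in_states f (i : 'I_n) (y : 'I_n) :
  (y \in states f i) = `[< throws f (i : nat)%:Z ((i : nat)%:Z + (y : nat)%:Z) >].
Proof. by rewrite ffunE inE. Qed.

(** The balls in the air at time i that land no earlier than i + c. *)
Lemma states_cnt f (i : 'I_n) (c : nat) : bnd f ->
  cnt (states f i) c = rk n f ((i : nat)%:Z - 1) ((i : nat)%:Z + c%:Z).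
Proof.
move=> hf; rewrite /rk big_mkord /cnt.
set I := (i : nat)%:Z.
rewrite -big_mkcond /= sum1_card.
pose D := [set d : 'I_n | I + c%:Z <= f (I - 1 - (d : nat)%:Z)].
pose h (d : 'I_n) := res (f (I - 1 - (d : nat)%:Z) - I).
have hval d : d \in D -> (h d : nat)%:Z = f (I - 1 - (d : nat)%:Z) - I.
  rewrite inE => hd; apply: res_small.
  by have := bnd_le (I - 1 - (d : nat)%:Z) hf; lia.
transitivity #|D|; last by apply: eq_card => d; rewrite !inE.
rewrite -(card_in_imset (f := h)) => [|d d' hd hd' e]; last first.
  have : f (I - 1 - (d : nat)%:Z) = f (I - 1 - (d' : nat)%:Z).
    by have := hval _ hd; have := hval _ hd'; rewrite e; lia.
  by move=> /(bnd_inj hf) e'; apply/val_inj => /=; lia.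
apply: eq_card => y; rewrite !inE in_states.
apply/andP/imsetP => [[/asboolP[a h1 h2] hc]|[d hd ->]].
  have hd : (absz (I - 1 - a)%R < n)%N.
    by have := bnd_le a hf; rewrite h2 -/I; rewrite -/I in h1; lia.
  have ha : I - 1 - (absz (I - 1 - a)%R)%:Z = a by rewrite -/I in h1; lia.
  have hD : Ordinal hd \in D by rewrite inE /= ha h2 -/I; lia.
  exists (Ordinal hd) => //; apply/val_inj => /=.
  by have := hval _ hD; rewrite /= ha h2 -/I; lia.
have e := hval _ hd; split; last by rewrite inE in hd; lia.
by apply/asboolP; exists (I - 1 - (d : nat)%:Z); rewrite -/I; lia.
Qed.

Lemma states_juggling f : bnd f -> is_juggling k (states f).
Proof.
move=> hf; apply/andP; split; apply/forallP => i.
  have := states_cnt i 0 hf; rewrite addr0 (rk_ball n_gt0 _ hf) => e.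
  by rewrite -[X in _ == X]e; apply/eqP; apply: eq_card => x; rewrite inE andbT.
apply/fintype.subsetP => y; rewrite !inE => /existsP[x /andP[hx /eqP hxy]].
move: hx; rewrite !in_states => /asboolP[a h1 h2]; apply/asboolP.
have [j hj] := res_decomp ((i : nat)%:Z + 1); rewrite res_S res_ord in hj.
apply: (@throws_shift _ _ _ j hf); exists a; first by lia.
have exy : (x : nat) = y.+1 := hxy.
by rewrite h2; lia.
Qed.

Definition state_map (F : Bound k n) : Jugg k n := exist _ (states (val F)) (states_juggling (Bound_bnd F)).

(** Both orders compare the counts of [rk]: for the juggling sequences by
    [subset_leP], for the bounded permutations by the rank criterion. *)
Lemma state_map_le F G : Bound_le F G = Jugg_le (state_map F) (state_map G).
Proof.
have hF := Bound_bnd F; have hG := Bound_bnd G.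
have hcard (H : Bound k n) (i : 'I_n) : #|states (val H) i| = k.
  by have /andP[/forallP/(_ i)/eqP] := states_juggling (Bound_bnd H).
apply/idP/forallP => [/(Bound_leP n_gt0)/(upath_rkleE n_gt0 hF hG) h i|h].
  apply/subset_leP => [|c]; first by rewrite !hcard.
  by rewrite !states_cnt //; apply: h; lia.
apply/(Bound_leP n_gt0)/(upath_rkleE n_gt0 hF hG) => a b hab.
have [j hj] := res_decomp (a + 1).
set i := res (a + 1) in hj.
have ea : a = (i : nat)%:Z - 1 + j * n%:Z by lia.
have eb : b = (i : nat)%:Z + (absz (b - a - 1)%R)%:Z + j * n%:Z by lia.
rewrite ea eb (rk_shift n_gt0 _ _ _ hF) (rk_shift n_gt0 _ _ _ hG) -!states_cnt //.
by move: (h i) => /subset_leP; apply; rewrite !hcard.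
Qed.

Lemma state_map_inj : injective state_map.
Proof.
move=> F G e; have [_ ha _] := Bound_poset n_gt0 hkn.
have hr : reflexive (@Bound_le k n) by have [] := Bound_poset n_gt0 hkn.
by apply: ha; rewrite !state_map_le e -state_map_le hr.
Qed.

(** * From juggling sequences to bounded permutations *)

Section Inverse.
Variable J : {ffun 'I_n -> {set 'I_n}}.
Hypothesis hJ : is_juggling k J.

Lemma J_card i : #|J i| = k.
Proof. by have /andP[/forallP/(_ i)/eqP] := hJ. Qed.

Lemma J_shift i : shift_down (J i) \subset J (ordS i).
Proof. by have /andP[_ /forallP/(_ i)] := hJ. Qed.

(** At time i a ball is due to land at time v. *)
Definition ball (i v : int) : bool := (i <= v) && nmem (J (res i)) (absz (v - i)%R).

Definition throw_at (i : int) : nat := throw (J (res i)) (J (res (i + 1))).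

Definition unjuggle (i : int) : int := i + (throw_at i)%:Z.

Lemma ball_bnd i v : ball i v -> i <= v < i + n%:Z.
Proof. by move=> /andP[h1 /nmem_lt h2]; lia. Qed.

Lemma ball_step i v : i < v -> ball (i + 1) v =
  ball i v || (ball i i && (v == unjuggle i)).
Proof.
move=> hv.
have hcard : #|J (res i)| = #|J (res (i + 1))| by rewrite !J_card.
have hsub : shift_down (J (res i)) \subset J (res (i + 1)) by rewrite res_S J_shift.
have [_ h] := throwP hcard hsub.
have eb : ball i i = nmem (J (res i)) 0 by rewrite /ball lexx subrr.
have eb1 : ball i v = nmem (J (res i)) (absz (v - i)%R) by rewrite /ball (ltW hv).
have hS (A : {set 'I_n}) : nmem (shift_down A) (absz (v - (i + 1))%R) = nmem A (absz (v - i)%R) :> bool.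
  have e : absz (v - i)%R = (absz (v - (i + 1))%R).+1 by lia.
  rewrite e; apply/idP/idP => hm; last first.
    have hlt : (absz (v - (i + 1))%R < n)%N by exact: ltnW (nmem_lt hm).
    by rewrite -[absz _]/(val (Ordinal hlt)) nmem_val shift_downE.
  by move: hm => /existsP[y /andP[hy /eqP <-]]; rewrite -shift_downE.
have -> : ball (i + 1) v = nmem (J (res (i + 1))) (absz (v - (i + 1))%R).
  by rewrite /ball; have -> : i + 1 <= v by lia.
rewrite eb eb1 /unjuggle /throw_at; case: ifP h => h0 [].
  move=> x hx [hB ht]; rewrite ht {1}hB -hS /=.
  apply/idP/orP => [/existsP[y /andP[]]|[/existsP[y /andP[hy1 hy2]]|/eqP hv']].
  - rewrite finset.in_setU1 => /orP[/eqP-> /eqP hy|hy1 hy2].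
      by right; have hy' : (x : nat) = _ := hy; lia.
    by left; apply/existsP; exists y; rewrite hy1.
  - by apply/existsP; exists y; rewrite finset.in_setU1 hy1 orbT.
  - apply/existsP; exists x; rewrite finset.in_setU1 eqxx /=.
    by apply/eqP; rewrite [LHS]/=; lia.
by move=> hB _; rewrite {1}hB hS orbF.
Qed.

Lemma unjuggle_id i : ~~ ball i i -> unjuggle i = i.
Proof.
have hcard : #|J (res i)| = #|J (res (i + 1))| by rewrite !J_card.
have hsub : shift_down (J (res i)) \subset J (res (i + 1)) by rewrite res_S J_shift.
have [_] := throwP hcard hsub.
rewrite /ball lexx subrr /= /unjuggle /throw_at; case: ifP => // _ [_ ->] _; lia.
Qed.

Lemma unjuggle_new i : ball i i -> [/\ i < unjuggle i, unjuggle i <= i + n%:Z & ~~ ball i (unjuggle i)].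
Proof.
have hcard : #|J (res i)| = #|J (res (i + 1))| by rewrite !J_card.
have hsub : shift_down (J (res i)) \subset J (res (i + 1)) by rewrite res_S J_shift.
have [_] := throwP hcard hsub.
rewrite /ball lexx subrr /= /unjuggle /throw_at; case: ifP => // _ [x hx [_ ->]] _.
have hlt := ltn_ord x; split; [lia|lia|].
rewrite shift_downE in hx; apply/negP => /andP[_].
have -> : absz (i + (x.+1)%:Z - i)%R = x.+1 by lia.
by move=> h; rewrite h in hx.
Qed.

Lemma ball_persist i j v : ball i v -> i <= j -> j <= v -> ball j v.
Proof.
move=> h hij; have [m ->] : exists m : nat, j = i + m%:Z by exists (absz (j - i)%R); lia.
elim: m {hij} => [|m IH] hv; first by rewrite addr0.
have -> : i + m.+1%:Z = i + m%:Z + 1 by lia.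
by rewrite ball_step; [rewrite IH //; lia|lia].
Qed.

(** No ball is due n steps in advance, so it must have been thrown since then. *)
Lemma ball_thrown i v : ball i v -> exists2 a, a < i & unjuggle a = v.
Proof.
move=> h; have hb := ball_bnd h.
have [m hm] : exists m : nat, i = v - n%:Z + m%:Z by exists (absz (i - v + n%:Z)%R); lia.
elim: m i hm h hb => [|m IH] i hm h hb; first by lia.
have ei : i = (i - 1) + 1 by lia.
move: (h); rewrite ei ball_step; last by lia.
case/orP => [h'|/andP[h1 /eqP ->]]; last by exists (i - 1) => //; lia.
have hb' := ball_bnd h'.
have [||a ha1 ha2] := IH (i - 1) _ h'; [lia|exact: hb'|].
by exists a => //; lia.
Qed.

Lemma thrown_ball a i : a < i -> i <= unjuggle a -> ball i (unjuggle a).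
Proof.
move=> h1 h2; have [hb|/unjuggle_id e] := boolP (ball a a); last by lia.
apply: (@ball_persist (a + 1)) => //; last by lia.
by rewrite ball_step; [rewrite hb eqxx orbT|lia].
Qed.

Lemma unjuggle_ge i : i <= unjuggle i.
Proof. by rewrite /unjuggle; lia. Qed.

Lemma unjuggle_inj : injective unjuggle.
Proof.
suff H a a' : a < a' -> unjuggle a <> unjuggle a'.
  move=> a a' e; case: (ltgtP a a') => // h; first by case: (H _ _ h).
  by case: (H _ _ h).
move=> h e; have hg := unjuggle_ge a'; rewrite -e in hg.
have hb := thrown_ball h hg; rewrite e in hb.
have [h1|h1] := boolP (ball a' a'); first by have [_ _] := unjuggle_new h1; rewrite hb.
by rewrite unjuggle_id // in hb; rewrite hb in h1.
Qed.

Lemma unjuggle_surj v : exists a, unjuggle a = v.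
Proof.
have [/ball_thrown[a _ h]|/unjuggle_id h] := boolP (ball v v); first by exists a.
by exists v.
Qed.

(** The throws telescope: f i - i is the change of the sum of all absolute landing
    times, which grows by k n in one period. *)
Lemma unjuggle_bnd : bnd unjuggle.
Proof.
split; [split; [split|]|].
- have [g hg] := boolp.choice unjuggle_surj.
  by exists g => // i; apply: unjuggle_inj; rewrite hg.
- move=> i; rewrite /unjuggle /throw_at.
  have -> : i + n%:Z + 1 = i + 1 + n%:Z by lia.
  by rewrite !res_add; lia.
- pose E (i : nat) : int := k%:Z * i%:Z + (\sum_(x in J (res i%:Z)) (x : nat))%N%:Z.
  rewrite (eq_bigr (fun i => E i.+1 - E i)) => [|i _]; last first.
    have hcard : #|J (res i)| = #|J (res (i%:Z + 1))| by rewrite !J_card.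
    have hsub : shift_down (J (res i)) \subset J (res (i%:Z + 1)) by rewrite res_S J_shift.
    have [h _] := throwP hcard hsub.
    have e : (\sum_(y in J (res (i%:Z + 1))) y.+1 = k + \sum_(y in J (res (i%:Z + 1))) y)%N.
      by rewrite -(J_card (res (i%:Z + 1))) -sum1_card -big_split.
    have ei : i.+1%:Z = i%:Z + 1 by lia.
    by rewrite /E ei /unjuggle /throw_at; rewrite e in h; lia.
  rewrite telescope_sumr // /E.
  have -> : n.+1%:Z = 1 + n%:Z by lia.
  rewrite res_add -[1%Z]/(1%:Z : int) mulrDr mulr1.
  by move: (\sum_(x in J _) _)%N => s; lia.
move=> i; have h := unjuggle_ge i; rewrite h /=.
have [/unjuggle_new[_ -> _]//|/unjuggle_id ->] := boolP (ball i i); lia.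
Qed.

Lemma unjuggleK : states unjuggle = J.
Proof.
apply/ffunP => i; apply/finset.setP => y; rewrite in_states.
have e : ball (i : nat)%:Z ((i : nat)%:Z + (y : nat)%:Z) = (y \in J i).
  rewrite /ball res_ord; have -> : absz ((i : nat)%:Z + (y : nat)%:Z - (i : nat)%:Z)%R = y by lia.
  by rewrite nmem_val; case: (y \in _); rewrite ?andbF //; lia.
rewrite -e; apply/asboolP/idP => [[a h1 h2]|/ball_thrown[a h1 h2]]; last by exists a.
by rewrite -h2; apply: thrown_ball => //; rewrite h2; lia.
Qed.

End Inverse.

Lemma state_map_bij : bijective state_map.
Proof.
have sur (J : Jugg k n) : exists F, state_map F = J.
  exists (mkBound (unjuggle_bnd (valP J))); apply/val_inj => /=.
  exact: unjuggleK (valP J).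
have [g hg] := boolp.choice sur.
by exists g => // F; apply: state_map_inj; rewrite hg.
Qed.

End Juggling.

(** * Lifting for bounded permutations *)

(** Right multiplication by the exchange of i and i + 1 preserves the order of
    every other pair of positions, hence turns steps into steps. *)
Section Lifting.
Local Open Scope ring_scope.

Variables (k n : nat).
Hypothesis n_gt0 : (0 < n)%N.
Variable i : int.
Hypothesis hi : ~~ cong n i (i + 1).

Local Notation s := (swp n i (i + 1)).
Local Notation upath := (upath n).
Local Notation ustep := (ustep n).
Local Notation bnd := (bounded_perm k n).
Local Notation avg := (affine_perm_avg n k%:Z).

Definition ascent (f : int -> int) := f i < f (i + 1).
Definition raised f := if ascent f then f \o s else f.
Definition lowered f := if ascent f then f else f \o s.

Lemma simple_order (p q : int) : p < q -> ~~ cong n p q ->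
  s p < s q \/ (cong n p i /\ q = p + 1).
Proof.
move=> hpq hc; have [h1|h1] := boolP (cong n p i).
  have [h2|h2] := boolP (q == p + 1); first by right; split=> //; apply/eqP.
  left; rewrite (swpLc _ h1); have [h3|h3] := boolP (cong n q i).
    by rewrite (swpLc _ h3); lia.
  have [h4|h4] := boolP (cong n q (i + 1)); last by rewrite swp_id //; lia.
  rewrite (swpRc hi h4); have [e|] := eqVneq q (p + 2); last by lia.
  case/negP: hi; have h5 : cong n (p + 1) (i + 1) by rewrite congDr.
  have h6 : cong n (p + 2) (p + 1) by rewrite -e; apply: cong_trans h4 _; rewrite cong_sym.
  have e2 : p + 2 = p + 1 + 1 by lia.
  move: h6; rewrite e2 congDr => h6; apply: (cong_trans (y := p)); first by rewrite cong_sym.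
  by apply: cong_trans h5; rewrite cong_sym.
left; have [h3|h3] := boolP (cong n p (i + 1)).
  rewrite (swpRc hi h3); have [h4|h4] := boolP (cong n q i); first by rewrite (swpLc _ h4); lia.
  have [h5|h5] := boolP (cong n q (i + 1)); last by rewrite swp_id //; lia.
  by rewrite (swpRc hi h5); lia.
rewrite (swp_id h1 h3); have [h4|h4] := boolP (cong n q i); first by rewrite (swpLc _ h4); lia.
have [h5|h5] := boolP (cong n q (i + 1)); last by rewrite swp_id.
rewrite (swpRc hi h5); have [e|] := eqVneq q (p + 1); last by lia.
by case/negP: h1; move: h5; rewrite e congDr.
Qed.

Lemma ustep_conj f g : periodic n f -> ustep f g ->
  ustep (f \o s) (g \o s) \/ (ascent f /\ g = f \o s).
Proof.
move=> hf [p [q [h1 h2 h3 ->]]].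
have [h|[/congP[j ej] eq]] := simple_order h1 h2.
  left; exists (s p), (s q); split=> //=.
  - by apply: contra h2; rewrite cong_inj //; [exact: swp_periodic|exact: swp_inj].
  - by rewrite !swpK.
  by apply/funext => x /=; rewrite (@swp_conj n s) ?swpK //; [exact: swp_periodic|exact: swp_inj].
right; split.
  have e' : i + 1 + j * n%:Z = q by lia.
  have := periodicM hf i j; have := periodicM hf (i + 1) j.
  by rewrite e' -ej /ascent; lia.
have -> : q = i + 1 + j * n%:Z by lia.
by rewrite ej swp_shift.
Qed.

Lemma ascent_step f : ascent f -> ustep f (f \o s).
Proof. by move=> h; exists i, (i + 1); split=> //; lia. Qed.

Lemma descent_step f : avg f -> ~~ ascent f -> ustep (f \o s) f.
Proof.
move=> [[bf _] _]; rewrite /ascent -leNgt => h; exists i, (i + 1); split=> //; first by lia.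
  rewrite /= swpL swpR // lt_neqAle h andbT; apply/eqP => /(bij_inj bf); lia.
by rewrite swpKf.
Qed.

Lemma lift_step f g : avg f -> ustep f g ->
  upath (raised f) (raised g) /\ upath (lowered f) (lowered g).
Proof.
move=> hf hs; have hg := ustep_avg n_gt0 hs hf.
have [hc|[ha e]] := ustep_conj hf.1.2 hs; last first.
  have hng : ~~ ascent g by rewrite e /ascent /= swpL swpR // -leNgt ltW.
  rewrite /raised /lowered ha (negbTE hng) e swpKf //; split; exact: rt_refl.
have r1 := rt_step _ _ _ _ hs; have r2 := rt_step _ _ _ _ hc.
rewrite /raised /lowered; case: ifPn => h1; case: ifPn => h2; split=> //.
- exact: rt_trans r2 (rt_step _ _ _ _ (descent_step hg h2)).
- exact: rt_trans (rt_step _ _ _ _ (ascent_step h1)) r2.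
- exact: rt_trans r1 (rt_step _ _ _ _ (ascent_step h2)).
- exact: rt_trans (rt_step _ _ _ _ (descent_step hf h1)) r1.
Qed.

(** Of the two permutations f and f s, passing to the larger, or to the smaller,
    is monotone; this contains all forms of the lifting property. *)
Lemma lifting_path f g : upath f g -> avg f ->
  upath (raised f) (raised g) /\ upath (lowered f) (lowered g).
Proof.
elim=> [x y h hx|x hx|x y z hxy IH1 _ IH2 hx]; first exact: lift_step.
  by split; apply: rt_refl.
have [h1 h2] := IH1 hx; have [h3 h4] := IH2 (upath_avg n_gt0 hxy hx).
by split; [apply: rt_trans h1 h3|apply: rt_trans h2 h4].
Qed.

End Lifting.

Section BoundEulerian.
Local Open Scope ring_scope.

Variables (k n : nat).
Hypothesis n_gt0 : (0 < n)%N.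
Hypothesis hkn : (k <= n)%N.

Local Notation bnd := (bounded_perm k n).
Local Notation brank := (@brank k n).
Local Notation B := (Bound k n).
Local Notation le := (@Bound_le k n).

(** The last step of a chain that ends in G puts a larger value before a smaller
    one, so G has a descent between neighbours. *)
Lemma descent_or_minimal (G : B) : (forall F, le F G -> F = G) \/
  exists i, ~~ cong n i (i + 1) /\ ~~ ascent i (val G).
Proof.
have hG := Bound_bnd G.
case: (pselect (exists i, val G (i + 1) < val G i)) => [[i hi]|hno].
  right; exists i; rewrite /ascent -leNgt ltW //; split=> //.
  apply: contraTN hi => /congP[j ej]; have := periodicM (bnd_per hG) (i + 1) j; rewrite -ej => e.
  have ej' : j * n%:Z = -1 by lia.
  by rewrite -leNgt e ej'; lia.
left=> F /(Bound_leP n_gt0) hp; apply/eqP/negPn/negP => /eqP hne.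
have hne' : val F <> val G by move=> /val_inj.
have [h [p [q [h1 hb h4 _]]]] := upath_cocover n_gt0 hkn (Bound_bnd F) hG hp hne'.
have hmono (a b : int) : a <= b -> val G a <= val G b.
  move=> hab; have [m ->] : exists m : nat, b = a + m%:Z by exists (absz (b - a)%R); lia.
  elim: m => [|m IH]; first by rewrite addr0.
  have e : a + m.+1%:Z = a + m%:Z + 1 by lia.
  rewrite e; apply: le_trans IH _; rewrite leNgt; apply/negP => hlt.
  by apply: hno; exists (a + m%:Z).
have [h2 _ h3 _] := hb.
have := hmono p q (ltW h2); rewrite -h4 /= swpL swpR; first by lia.
exact: (bcov_ncong hb).
Qed.

(** Below an element with a descent at i the product is always bounded, so there
    the second case does not occur. *)
Definition mulr_simple (i : int) (F : B) : B :=
  if pselect (bnd (val F \o swp n i (i + 1))) is left h then mkBound h else F.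

Lemma mulr_simpleE i F : bnd (val F \o swp n i (i + 1)) ->
  val (mulr_simple i F) = val F \o swp n i (i + 1).
Proof. by move=> h; rewrite /mulr_simple; case: pselect. Qed.

(** At a descent of y, right multiplication by the exchange of i and i + 1 is an
    involution below y that satisfies the hypotheses of Verma's argument. *)
Lemma Bound_lifting (y : B) : (forall x, le x y -> x = y) \/ exists s : B -> B,
  [/\ le (s y) y /\ s y != y,
      forall z, le z y -> [/\ le (s z) y, s (s z) = z, s z != z, 
        sgz_pow (brank (val (s z))) = - sgz_pow (brank (val z)) & le z (s z) || le (s z) z],
      forall x z, le z y -> le x z -> le x (s x) -> le x (s z),
      forall x z, le z y -> le (s x) z -> le (s x) x -> le (s z) z -> le x y -> le x z &
      forall z, le z y -> le z (s z) -> le z (s y)].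
Proof.
have [|[i [hi hy]]] := descent_or_minimal y; [by left|right].
have [hr ha ht] := Bound_poset n_gt0 hkn.
have hB (F : B) := Bound_bnd F.
have leP F G : reflect (upath n (val F) (val G)) (le F G) by apply: (iffP idP) => /(Bound_leP n_gt0).
exists (mulr_simple i).
have lift (F G : B) : le F G -> upath n (raised n i (val F)) (raised n i (val G)) /\
    upath n (lowered n i (val F)) (lowered n i (val G)).
  by move=> /leP h; apply: (lifting_path n_gt0 hi h (hB F).1).
have upy : raised n i (val y) = val y by rewrite /raised (negbTE hy).
have hbnd z : le z y -> bnd (val z \o swp n i (i + 1)).
  move=> hz; have [h1 _] := lift _ _ hz; rewrite upy /raised in h1.
  have hav : affine_perm_avg n k%:Z (val z \o swp n i (i + 1)) by apply: avg_swp => //; exact: (hB z).1.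
  case: ifPn h1 => hz' h1; first exact: (upath_bnd n_gt0 h1 hav (hB y)).
  have hst := rt_step _ _ _ _ (descent_step n_gt0 hi (hB z).1 hz').
  exact: (upath_bnd n_gt0 hst hav (hB z)).
have hE z : le z y -> val (mulr_simple i z) = val z \o swp n i (i + 1).
  by move=> hz; apply: mulr_simpleE; apply: hbnd.
have hup z : le z y -> ascent i (val z) -> le z (mulr_simple i z).
  move=> hz hz'; apply/leP; rewrite hE //; apply: rt_step; exact: (ascent_step n_gt0 hi).
have hdn z : le z y -> ~~ ascent i (val z) -> le (mulr_simple i z) z.
  move=> hz hz'; apply/leP; rewrite hE //; apply: rt_step; apply: (descent_step n_gt0 hi) => //; exact: (hB z).1.
have hle z : le z y -> le (mulr_simple i z) y.
  move=> hz; have [hz'|hz'] := boolP (ascent i (val z)); last exact: ht (hdn _ hz hz') hz.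
  by have [h1 _] := lift _ _ hz; apply/leP; rewrite hE // -{1}upy; rewrite upy /raised hz' in h1 *.
have hK z : le z y -> mulr_simple i (mulr_simple i z) = z.
  by move=> hz; apply/val_inj; rewrite hE ?hle // hE // swpKf.
have hne z : le z y -> mulr_simple i z != z.
  move=> hz; apply/eqP => /(congr1 val); rewrite hE // => e.
  have := congr1 (fun t : int -> int => t i) e => /=; rewrite swpL => /(bnd_inj (hB z)); lia.
have asc z : le z y -> le z (mulr_simple i z) -> ascent i (val z).
  move=> hz h; apply/negPn/negP => h'; case/eqP: (hne z hz); apply: ha.
  by rewrite h hdn.
have des z : le z y -> le (mulr_simple i z) z -> ~~ ascent i (val z).
  move=> hz h; apply/negP => h'; case/eqP: (hne z hz); apply: ha.
  by rewrite h hup.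
have flip z : le z y -> ascent i (val (mulr_simple i z)) = ~~ ascent i (val z).
  move=> hz; rewrite hE // /ascent /= swpL swpR // -leNgt lt_neqAle andb_idl // => _.
  by apply/eqP => /(bnd_inj (hB z)); lia.
have par z : le z y -> ascent i (val z) -> brank (val (mulr_simple i z)) = brank (val z) + 1.
  move=> hz hz'; rewrite hE // (bcov_rank n_gt0 hkn) //; first exact: hbnd.
  split=> //; [by lia| |by move=> m h1 h2; lia].
  rewrite ltNge; apply: contra hi => h; have -> : n = 1%N by lia.
  by apply/congP; exists (-1); lia.
split.
- by split; [exact: hdn|exact: hne].
- move=> z hz; split; [exact: hle|exact: hK|exact: hne| |].
    have [hz'|hz'] := boolP (ascent i (val z)); first by rewrite par // sgz_powD mulrN1.
    have e := par _ (hle z hz); rewrite flip // hK // in e.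
    by rewrite (e hz') sgz_powD mulrN1 opprK.
  have [hz'|hz'] := boolP (ascent i (val z)); first by rewrite hup.
  by rewrite hdn ?orbT.
- move=> x z hz hxz hx; have hxy := ht _ _ _ hxz hz; have [_ h2] := lift _ _ hxz.
  have [hz'|hz'] := boolP (ascent i (val z)); first exact: ht hxz (hup _ hz hz').
  by apply/leP; rewrite hE //; rewrite /lowered (asc _ hxy hx) (negbTE hz') in h2.
- move=> x z hz hxz hx hz' hxy; have [h1 _] := lift _ _ hxz.
  rewrite /raised flip // (des _ hxy hx) (negbTE (des _ hz hz')) hE // swpKf // in h1.
  exact/leP.
move=> z hz hz'; have [_ h2] := lift _ _ hz.
rewrite /lowered (asc _ hz hz') (negbTE hy) in h2.
by apply/leP; rewrite hE.
Qed.

(** Verma's argument runs on the finite type of juggling sequences. *)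
Theorem Jugg_eulerian : eulerian (@Jugg_le k n) /\ eulerian (dual_rel (@Jugg_le k n)).
Proof.
have [psi psiK phiK] := state_map_bij n_gt0 hkn.
set phi := state_map n_gt0 hkn in psiK phiK.
have psi_bij : bijective psi by exists phi.
have hle J J' : Jugg_le J J' = le (psi J) (psi J').
  by rewrite (state_map_le n_gt0 hkn) -/phi !phiK.
apply: (@verma_eulerian _ (@Jugg_le k n) ((fun F : B => brank (val F)) \o psi)).
- exact: iso_poset psi_bij hle (Bound_poset n_gt0 hkn).
- by have hr := iso_rank psi_bij hle (Bound_rank n_gt0 hkn); exact hr.
move=> y; have [hmin|[s [h1 h2 h3 h4 h5]]] := Bound_lifting (psi y); [left|right].
  by move=> x; rewrite hle => /hmin /(bij_inj psi_bij).
exists (phi \o s \o psi); split=> [|z|x z|x z|z]; rewrite !hle /= ?psiK.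
- by split; [exact: h1.1|rewrite -(inj_eq (bij_inj psi_bij)) psiK; exact: h1.2].
- move=> hz; have [a1 a2 a3 a4 a5] := h2 _ hz; rewrite ?psiK a2 phiK; split=> //.
  by rewrite -(inj_eq (bij_inj psi_bij)) psiK.
- exact: h3.
- by move=> hz; exact: h4.
exact: h5.
Qed.

End BoundEulerian.

(** * Classes of k-Bruhat intervals *)

Section QIso.
Local Open Scope ring_scope.

Variables (k n : nat).
Hypothesis n_gt0 : (0 < n)%N.
Hypothesis hkn : (k <= n)%N.

Local Notation bnd := (bounded_perm k n).
Local Notation crit := (@crit k n).
Local Notation fpair := (@fpair k n).
Local Notation grass := (@grass k n).
Local Notation upath := (upath n).
Local Notation equiv := (@k_interval_equiv k n).
Implicit Types (p q : k_interval k n) (A : Q k n).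

Definition interval_perm p : int -> int := fpair (val p).1 (val p).2.

Lemma interval_crit p : crit (val p).1 (val p).2.
Proof. exact/k_bruhatP/(valP p). Qed.

Lemma equivC p q : equiv p q = equiv q p.
Proof. by apply: sym_connect_sym => a b; rewrite orbC. Qed.

Lemma equiv_trans q p r : equiv p q -> equiv q r -> equiv p r.
Proof. exact: connect_trans. Qed.

Lemma step_perm p q : k_interval_step p q -> interval_perm p = interval_perm q.
Proof.
move=> /existsP[z /andP[hz /and3P[_ _ /eqP e]]].
rewrite /interval_perm e /= /Defs.pcomp (fpair_young n_gt0 hkn) // => x.
move: hz; rewrite inE => /eqP hz.
have hx : (z x \in z @: initial_segment k n) = (x \in initial_segment k n).
  by apply: mem_imset; apply: perm_inj.
by rewrite hz !inE in hx.
Qed.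

Lemma equiv_perm p q : equiv p q -> interval_perm p = interval_perm q.
Proof.
case/connectP => c hc ->; elim: c p hc => //= r c IH p /andP[h hc].
rewrite -(IH _ hc); case/orP: h => /step_perm //.
Qed.

(** Both ends have a descent at the exchanged positions, so lengths add up. *)
Lemma tperm_step (i i' : 'I_n) p q : (i' : nat) = i.+1 -> (i < k)%N = (i' < k)%N ->
  ((val p).1 i' < (val p).1 i)%N -> ((val p).2 i' < (val p).2 i)%N ->
  val q = ((tperm i i' * (val p).1)%g, (tperm i i' * (val p).2)%g) -> k_interval_step q p.
Proof.
move=> hii hk h1 h2 e; apply/existsP; exists (tperm i i').
have inv1 : inversions (tperm i i') = 1%N.
  rewrite (adj_inversions n_gt0 hkn (i := i) (i' := i')) ?tpermL ?tpermR ?hii //.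
  rewrite -[X in (_ * X)%g]mulg1 swapK; congr _.+1; apply/eqP; rewrite cards_eq0.
  apply/eqP/finset.setP => -[a b]; rewrite !inE !perm1 /=; lia.
have hy : tperm i i' \in young_subgroup k n.
  rewrite inE; apply/eqP/finset.setP => x; rewrite -{1}(tpermK i i' x).
  by rewrite mem_imset; [rewrite !inE tperm_young|apply: perm_inj].
rewrite hy /length_additive e /= /Defs.pcomp !swapK inv1 !addn1.
rewrite (adj_inversions n_gt0 hkn hii h1) (adj_inversions n_gt0 hkn hii h2) !eqxx /=.
by apply/eqP; case: (val p).
Qed.

(** Sorting a pair by simple reflections of the Young subgroup lowers both
    components, so each step is one of the generating equivalences. *)
Lemma equiv_grass p : exists2 q, equiv p q & grass (val q).2.
Proof.
pose P u w := forall p, val p = (u, w) -> exists2 q, equiv p q & grass (val q).2.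
suff H u w : crit u w -> P u w.
  by apply: (H _ _ (interval_crit p)); case: (val p).
apply: (crit_sort n_gt0 hkn) => {u w p}.
  by move=> u w _ hg p e; exists p; [exact: connect0|rewrite e].
move=> u w i i' hii hk hc hw hu hc' IH p e.
have hb : k_bruhat k (tperm i i' * u)%g (tperm i i' * w)%g by apply/k_bruhatP.
pose q : k_interval k n := exist (fun p : 'S_n * 'S_n => is_true (k_bruhat k p.1 p.2)) (_, _) hb.
have [r hr hgr] := IH q erefl; exists r => //.
apply: equiv_trans hr; rewrite equivC; apply: connect1.
by rewrite (tperm_step hii hk) // e.
Qed.

(** Both intervals are equivalent to the one with a Grassmannian top end. *)
Lemma perm_equiv p q : interval_perm p = interval_perm q -> equiv p q.
Proof.
have [p0 hp gp] := equiv_grass p; have [q0 hq gq] := equiv_grass q.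
rewrite (equiv_perm hp) (equiv_perm hq) => e.
have [e1 e2] := grass_unique n_gt0 hkn gp gq e.
have e0 : p0 = q0 by apply/val_inj; case: (val p0) (val q0) e1 e2 => ? ? [? ?] /= -> ->.
by apply: equiv_trans hp _; rewrite e0 equivC.
Qed.

Lemma Q_class A : exists p, val A = [set q | equiv p q]%SET.
Proof.
have /imsetP[p _ e] := valP A; exists p; rewrite e.
by apply/finset.setP => q; rewrite !inE.
Qed.

Definition class_of p : Q k n.
Proof.
exists [set q in [set: k_interval k n] | equiv p q]%SET.
by apply/imsetP; exists p.
Defined.

Lemma mem_class p q : (q \in val (class_of p)) = equiv p q.
Proof. by rewrite !inE. Qed.

Lemma classE A p : p \in val A -> A = class_of p.
Proof.
have [q e] := Q_class A; rewrite e inE => h; apply/val_inj; rewrite e /=.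
apply/finset.setP => r; rewrite !inE; apply/idP/idP; last exact: equiv_trans.
by apply: equiv_trans; rewrite equivC.
Qed.

Lemma Q_nonempty A : exists p, p \in val A.
Proof. by have [p e] := Q_class A; exists p; rewrite e inE; apply: connect0. Qed.

Definition Q_rep A := xchoose (Q_nonempty A).

Lemma Q_repP A : Q_rep A \in val A.
Proof. exact: xchooseP. Qed.

Lemma Q_rep_perm A p : p \in val A -> interval_perm p = interval_perm (Q_rep A).
Proof.
move=> /classE e; apply: equiv_perm; rewrite -mem_class -e; exact: Q_repP.
Qed.

Definition Q_map A : Bound k n := mkBound (crit_bnd n_gt0 hkn (interval_crit (Q_rep A))).

Lemma Q_map_inj : injective Q_map.
Proof.
move=> A B /(congr1 val) e; rewrite (classE (Q_repP A)); apply/esym/classE.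
have h := perm_equiv e.
by rewrite (classE (Q_repP B)) mem_class equivC.
Qed.

Lemma crit_interval u w : crit u w -> exists p, val p = (u, w).
Proof.
move=> /k_bruhatP hb.
by exists (exist (fun p : 'S_n * 'S_n => is_true (k_bruhat k p.1 p.2)) (u, w) hb).
Qed.

Lemma Q_map_bij : bijective Q_map.
Proof.
have sur (F : Bound k n) : exists A, Q_map A = F.
  have [u [w [hc _ e]]] := pair_exists n_gt0 hkn (Bound_bnd F).
  have [p hp] := crit_interval hc; exists (class_of p); apply/val_inj => /=.
  rewrite -[LHS]/(interval_perm _) -(@Q_rep_perm _ p) ?mem_class; last exact: connect0.
  by rewrite /interval_perm hp.
have [g hg] := boolp.choice sur.
by exists g => // A; apply: Q_map_inj; rewrite hg.
Qed.

(** Each cover enlarges the interval of a suitable representative on one side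
    only; containment does not depend on the representative and is transitive. *)
Lemma upath_contains f g u w : crit u w -> fpair u w = f -> bnd g -> upath f g ->
  contains k u w g.
Proof.
move=> hc e hg hp; have hf : bnd f by rewrite -e; apply: crit_bnd.
move: u w hc e; pattern f; apply: (upath_cover_ind n_gt0 hkn hg _ _ hf hp).
  by move=> u w hc e; exists u, w; split=> //; apply: bruhat_refl.
move=> {f hf hp} f a b hf [h1 h2 h3 h4] hb _ IH u w hc e.
have [u0 [w0 [u1 [w1 [[hc0 hw0 e0 hc1 e1] hcase]]]]] := cover_pair n_gt0 hkn hf h1 h2 h3 h4 hb.
apply/(contains_indep n_gt0 hkn g hc hc0); first by rewrite e e0.
apply: (contains_trans n_gt0 hkn (u' := u1) (w' := w1)) => //; last exact: IH.
exists u1, w1; split=> //.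
  by case: hcase => [[_ [i [j [hij hu _ ->]]]]|[-> _]]; [apply: bruhat_up|apply: bruhat_refl].
by case: hcase => [[-> _]|[_ [i [j [hij hu _ ->]]]]]; [apply: bruhat_refl|apply: bruhat_up].
Qed.

(** Inclusion of intervals is [contains], which implies the rank order for a
    Grassmannian representative; [upath_contains] is the converse. *)
Lemma Q_map_le A B : Q_le A B = Bound_le (Q_map A) (Q_map B).
Proof.
have hA := Bound_bnd (Q_map A); have hB := Bound_bnd (Q_map B).
apply/existsP/idP => [[p /andP[hp /existsP[q /andP[hq /fintype.subsetP hs]]]]|].
  apply/(Bound_leP n_gt0)/(upath_rkleE n_gt0 hA hB).
  have hbq := k_bruhat_bruhat (valP q).
  have /andP[b1 _] : bruhat (val p).1 (val q).1 && bruhat (val q).1 (val p).2.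
    by have := hs (val q).1; rewrite !inE bruhat_refl hbq => /(_ isT).
  have /andP[_ b2] : bruhat (val p).1 (val q).2 && bruhat (val q).2 (val p).2.
    by have := hs (val q).2; rewrite !inE bruhat_refl hbq => /(_ isT).
  have [u [w [hc hw e]]] := pair_exists n_gt0 hkn hA.
  rewrite -e; apply: (contains_rkle n_gt0 hkn hc hw).
  apply/(contains_indep n_gt0 hkn _ hc (interval_crit p)).
    by rewrite e /= -[LHS]/(interval_perm _) -(Q_rep_perm hp).
  exists (val q).1, (val q).2; split=> //; first exact: interval_crit.
  exact: (Q_rep_perm hq).
move=> /(Bound_leP n_gt0) hp.
have [u [w [hc e b1 b2]]] := upath_contains (interval_crit (Q_rep A)) erefl hB hp.
have [q hq] := crit_interval hc.
exists (Q_rep A); rewrite Q_repP; apply/existsP; exists q.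
have hqB : q \in val B.
  rewrite (classE (Q_repP B)) mem_class; apply: perm_equiv.
  by rewrite [RHS]/interval_perm hq e.
rewrite hqB hq; apply/fintype.subsetP => v; rewrite !inE => /andP[v1 v2].
by rewrite (bruhat_trans b1 v1) (bruhat_trans v2 b2).
Qed.

End QIso.

(** * The case n = 0 and the theorem *)

Section Subsingleton.
Local Open Scope ring_scope.
Variables (T : choiceType) (le : rel T).
Hypothesis T_sub : forall x y : T, x = y.
Hypothesis le_refl : reflexive le.

Lemma subsingleton_eulerian : eulerian le.
Proof.
split.
  by split=> [x|x y _|y x z _ _]; [exact: le_refl|exact: T_sub|rewrite (T_sub x z)].
exists (fun _ => 0), (fun _ _ => 1); split=> [||x y _ _]; last by rewrite subrr.
  by split=> x y; [move=> _|case/and3P => _]; rewrite (T_sub x y) eqxx.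
by split=> // x y _; rewrite (T_sub x y) eqxx.
Qed.

Lemma subsingleton_EL : EL_shellable le.
Proof.
exists _, nat, (fun _ _ => 0%N) => x y _; exists [::].
have h c : saturated_chain le x y c -> c = [::].
  by case: c => // z c /andP[/andP[/and3P[_ ]]]; rewrite (T_sub x z) eqxx.
split; first by rewrite /increasing_chain /saturated_chain /= (T_sub x y) eqxx.
  by move=> c /andP[/h].
by move=> c /h ->.
Qed.

End Subsingleton.

Lemma Bound0 (k : nat) (F G : Bound k 0) : F = G.
Proof.
apply/val_inj/funext => i.
have [_ /(_ i)/andP[a1 a2]] := Bound_bnd F; have [_ /(_ i)/andP[b1 b2]] := Bound_bnd G.
by move: a1 a2 b1 b2; clear; lia.
Qed.

Theorem corollary3p17 (k n : nat) (hkn : k <= n) :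
  [/\ [/\ eulerian (@Q_le k n), EL_shellable (@Q_le k n),
          eulerian (dual_rel (@Q_le k n)) & EL_shellable (dual_rel (@Q_le k n))],
      [/\ eulerian (@Bound_le k n), EL_shellable (@Bound_le k n),
          eulerian (dual_rel (@Bound_le k n)) &
          EL_shellable (dual_rel (@Bound_le k n))] &
      [/\ eulerian (@Jugg_le k n), EL_shellable (@Jugg_le k n),
          eulerian (dual_rel (@Jugg_le k n)) &
          EL_shellable (dual_rel (@Jugg_le k n))]].
Proof.
have sub (T : choiceType) (le : rel T) : (forall x y : T, x = y) -> reflexive le ->
    [/\ eulerian le, EL_shellable le, eulerian (dual_rel le) & EL_shellable (dual_rel le)].
  by move=> h hr; split; (apply: subsingleton_eulerian || apply: subsingleton_EL).
have [n0|n_gt0] := posnP n.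
  subst n; split; apply: sub.
  - have hp (p q : k_interval k 0) : p = q.
      by apply/val_inj; rewrite (surjective_pairing (val p)) (surjective_pairing (val q));
        congr pair; apply/permP => -[].
    move=> A B; have [p hA] := Q_nonempty A; have [q hB] := Q_nonempty B.
    by rewrite (classE hA) (classE hB) (hp p q).
  - move=> A; have [p hA] := Q_nonempty A.
    by apply/existsP; exists p; rewrite hA; apply/existsP; exists p; rewrite hA /=.
  - exact: Bound0.
  - by move=> F; apply/asboolP; apply: rt_refl.
  - by move=> J J'; apply/val_inj/ffunP => -[].
  - by move=> J; apply/forallP => -[].
have [hE hE'] := Jugg_eulerian n_gt0 hkn; have [hL hL'] := Bound_EL n_gt0 hkn.
have hB := state_map_bij n_gt0 hkn; have hBle := state_map_le n_gt0 hkn.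
have hQ := Q_map_bij n_gt0 hkn; have hQle := @Q_map_le k n n_gt0 hkn.
have [psi psiK phiK] := hB.
have psi_bij : bijective psi by exists (state_map n_gt0 hkn).
have psi_le J J' : Jugg_le J J' = Bound_le (psi J) (psi J') by rewrite hBle !phiK.
have bE := iso_eulerian hB hBle hE.
have bE' := iso_eulerian (le := dual_rel (@Bound_le k n)) hB (fun x y => hBle y x) hE'.
split; split=> //.
- exact: (iso_eulerian hQ hQle).
- exact: (iso_EL hQ hQle).
- exact: (iso_eulerian (le := dual_rel (@Q_le k n)) hQ (fun x y => hQle y x) bE').
- exact: (iso_EL (le := dual_rel (@Q_le k n)) hQ (fun x y => hQle y x) hL').
- exact: (iso_EL psi_bij psi_le).
exact: (iso_EL (le := dual_rel (@Jugg_le k n)) psi_bij (fun x y => psi_le y x) hL').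
Qed.
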